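(* Let $(\mathcal{X},d,\mu)$ be a geometrically doubling, upper doubling metric measure space. There exist $\alpha$ and $\beta$, depending only on $C_\delta$, such that the following holds. Let $f \in L_1(\mathcal{X},\mu)$ and $t > \|f\|_1/\|\mu\|$, let $\{Q_j\}$ be the maximal cubes of the level set $\{\mathcal{M}_{\mathcal{A},\mu} f > t\}$, let $w_j = \chi_{Q_j}/\sum_k \chi_{Q_k}$, and consider a family of balls $B_j$ fitting in $Q_j$. Then for every family of $(\alpha,\beta)$-doubling dyadic cubes $R_j \in \mathcal{A}$ with $3 C_\delta B_j \subset R_j$ there exist functions $\varphi_j : \mathcal{X} \to \mathbb{C}$ satisfying: (1) $\displaystyle \|\varphi_j\|_\infty \lesssim \frac{1}{\mu(R_j)} \int_{Q_j} |f| \, d\mu$ for every $j$, and $\displaystyle \Big\| \sum_j \varphi_j \Big\|_\infty \lesssim t$; (2) $\displaystyle \mathrm{supp}\, \varphi_j \subset R_j$ and $\displaystyle \int \varphi_j \, d\mu = \int_{Q_j} f w_j \, d\mu$ for every $j$, where $\displaystyle \int_{Q_j} |f| w_j \, d\mu \sim \int_{Q_j} |f| \, d\mu$. In particular, one has the Calderón-Zygmund decomposition adapted to $(\mathcal{X},d,\mu)$ $$f = g + b = \Big( f \chi_{\mathcal{X} \setminus \bigcup_j Q_j} + \sum_j \varphi_j \Big) + \sum_j \big( f w_j - \varphi_j \big),$$ and any Calderón-Zygmund operator on $(\mathcal{X},d,\mu)$ which is bounded on $L_2(\mathcal{X},\mu)$ maps $L_1(\mathcal{X},\mu)$ to $L_{1,\infty}(\mathcal{X},\mu)$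 boundedly.
   Context: A metric space $(\mathcal{X},d)$ is geometrically doubling if there is $N \in \mathbb{N}$ such that every ball $B(x,r)$ can be covered by $N$ balls of radius $r/2$; its geometric dimension is $n = \log_2 N$. The measure $\mu$ is a Borel measure on $\mathcal{X}$, non-atomic and finite on bounded sets; $\|\mu\| = \mu(\mathcal{X})$ (if infinite, $\|f\|_1/\|\mu\|=0$). The space $(\mathcal{X},d,\mu)$ is upper doubling if there is a function $\lambda : \mathcal{X} \times \mathbb{R}_+ \to \mathbb{R}_+$ such that $r \mapsto \lambda(x,r)$ is nondecreasing and $\mu(B(x,r)) \le \lambda(x,r) \le C_\lambda \lambda(x, r/2)$ for all $x,r$. Dyadic cubes (Hytönen-Kairema). Fix a sufficiently small $\delta > 0$. There exist finitely many filtrations $\mathcal{A}_m = \bigcup_{k \in \mathbb{Z}} \{Q_{jk}^m : j \in \Sigma_k\}$, $1 \le m \le K(n,\delta)$, each with points $z_{jk}^m$, such that: $B(z_{jk}^m, \delta^k) \subset Q_{jk}^m \subset 48 B(z_{jk}^m,\delta^k)$; for each $k$ the sets $Q_{jk}^m$, $j \in \Sigma_k$, form a partition of $\mathcal{X}$; and if $k_1 \ge k_2$ then either $Q_{j_1 k_1}^m \subset Q_{j_2 k_2}^m$ or $Q_{j_1 k_1}^m \cap Q_{j_2 k_2}^m = \emptyset$. Moreover there is a constant $C_\delta$ such that every ball $B$ in $\mathcal{X}$ is contained in some $Q \in \mathcal{A} := \bigcup_m \mathcal{A}_m$ with $\mathrm{diam}(Q) \le \frac12 C_\delta \, \mathrm{diam}(B)$.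 Fix such a family $\mathcal{A}$; its elements are called dyadic cubes. For a ball $B = B(x,r)$, $aB = B(x,ar)$. A ball $B$ fits in $Q \in \mathcal{A}$ if $B \subset Q \subset C_\delta B$. A ball $B$ is $(\alpha,\beta)$-doubling if $\mu(\alpha B) \le \beta \mu(B)$. A dyadic cube $Q \in \mathcal{A}$ is $(\alpha,\beta)$-doubling if there exists an $(\alpha,\beta)$-doubling ball $B$ fitting in $Q$. The maximal function is $$\mathcal{M}_{\mathcal{A},\mu} f(x) = \sup_{x \in Q \in \mathcal{A}} \ \sup_{B \subset Q \subset C_\delta B} \frac{1}{\mu(2 C_\delta B)} \int_Q |f(y)| \, d\mu(y),$$ where the inner supremum is over balls $B$ fitting in $Q$. One writes $\{\mathcal{M}_{\mathcal{A},\mu} f > t\} = \bigcup_{j \ge 1} Q_j$ where the $Q_j \in \mathcal{A}$ are maximal, i.e. $Q_j$ is contained in the level set and no $Q \in \mathcal{A}$ satisfies $Q_j \subsetneq Q \subset \{\mathcal{M}_{\mathcal{A},\mu} f > t\}$. The function $w_j$ is understood to be $0$ outside $Q_j$. A Calderón-Zygmund kernel on $(\mathcal{X},d,\mu,\lambda)$ is a function $K(x,y)$, defined for $x \ne y$ in $\mathcal{X}$, with values in $\mathbb{C}$, such that: (a) $|K(x,y)| \lesssim 1/\lambda(x,d(x,y))$; (b) there is $0 < \tau \le 1$ such that $d(y,y') \le \frac12 d(x,y)$ implies $$|K(x,y)-K(x,y')| + |K(y,x)-K(y',x)| \lesssim \frac{d(y,y')^\tau}{d(x,y)^\tau \lambda(x,d(x,y))}.$$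 A Calderón-Zygmund operator is an operator $T$ for which there is such a kernel with $Tf(x) = \int_{\mathcal{X}} K(x,y) f(y)\, d\mu(y)$ for $x \notin \mathrm{supp}\, f$, for a suitable class of test functions $f$ (e.g. bounded functions with bounded support). The symbols $\lesssim$ and $\sim$ in (1) and (2) of the claim denote inequality and two-sided comparability up to constants independent of $f$, $t$, $j$ and the choices of the $B_j$ and $R_j$.
   Formalization: For (1), (2) and the decomposition, each R_j is additionally assumed different from Q_j unless R_j is the whole space; without this, (1) fails in spaces with gaps, where 3C_δB_j ⊂ R_j still allows R_j = Q_j. *)

(* Defs.v *)
From HB Require Import structures.
From mathcomp Require Import all_boot all_order all_algebra.
From mathcomp Require Import all_classical all_reals all_analysis.
From mathcomp Require Import complex.

Set Implicit Arguments.
Unset Strict Implicit.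
Unset Printing Implicit Defensive.

Import Order.TTheory GRing.Theory Num.Theory.
Import numFieldNormedType.Exports.
Import ComplexField.Normc.

Local Open Scope classical_set_scope.
Local Open Scope complex_scope.
Local Open Scope ring_scope.

(* A metric space together with a sigma-algebra; [is_Borel] below says that
   this sigma-algebra is the Borel one. *)
#[short(type="measurableMetricType")]
HB.structure Definition MeasurableMetric d (R : numDomainType) :=
  {T of Measurable d T & Metric R T}.

Section metric_measure_spaces.
Context {R : realType} {d : measure_display} {X : measurableMetricType d R}.
Variable mu : {measure set X -> \bar R}.

Definition is_Borel := (@measurable d X) = <<s (@open X)>>.

Definition geometrically_doubling := exists N : nat,
  forall (x : X) (r : R), 0 < r ->
  exists c : 'I_N -> X, ball x r `<=` \bigcup_i ball (c i) (r / 2).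

Definition non_atomic := forall A, measurable A -> (0 < mu A)%E ->
  exists B, [/\ measurable B, B `<=` A, (0 < mu B)%E & (mu B < mu A)%E].

Definition finite_on_bounded := forall (x : X) (r : R), (mu (ball x r) < +oo)%E.

(* R_+ is ]0, +oo[, both for the radii and for the values of lam. *)
Definition upper_doubling (lam : X -> R -> R) :=
  [/\ forall x r, 0 < r -> 0 < lam x r,
      forall x r s, 0 < r -> r <= s -> lam x r <= lam x s,
      forall x r, 0 < r -> (mu (ball x r) <= (lam x r)%:E)%E
    & exists Clam : R, forall x r, 0 < r -> lam x r <= Clam * lam x (r / 2)].

Definition diam (A : set X) : \bar R :=
  ereal_sup [set (mdist p.1 p.2)%:E | p in A `*` A].

(* A ball remembers its center and its radius, which the underlying set does
   not determine. *)
Record mball := MBall {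
  bcenter : X ;
  bradius : R ;
  bradius_gt0 : 0 < bradius }.

Definition bset (B : mball) : set X := ball (bcenter B) (bradius B).

Definition dilate (a : R) (B : mball) : set X :=
  ball (bcenter B) (a * bradius B).

End metric_measure_spaces.

Arguments mball {R d} X.
Arguments is_Borel {R d} X.
Arguments geometrically_doubling {R d} X.

Section dyadic_cubes.
Context {R : realType} {d : measure_display}.

(* The cube Q_{jk}^m is [dy_cube m k j] for [j] in [dy_Sigma k], and z_{jk}^m is
   [dy_center m k j]. Measurability of the cubes is part of their generating
   filtrations. *)
Record dyadic_system (X : measurableMetricType d R) (delta Cd : R) := {
  dy_number : nat ;
  dy_index : Type ;
  dy_Sigma : int -> set dy_index ;
  dy_cube : 'I_dy_number -> int -> dy_index -> set X ;
  dy_center : 'I_dy_number -> int -> dy_index -> X ;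
  dy_measurable : forall m k j, dy_Sigma k j -> measurable (dy_cube m k j) ;
  dy_ball_sub : forall m k j, dy_Sigma k j ->
    ball (dy_center m k j) (delta ^ k) `<=` dy_cube m k j ;
  dy_sub_ball : forall m k j, dy_Sigma k j ->
    dy_cube m k j `<=` ball (dy_center m k j) (48 * delta ^ k) ;
  dy_partition : forall m k, partition (dy_Sigma k) (dy_cube m k) setT ;
  dy_nested : forall m k1 k2 j1 j2, dy_Sigma k1 j1 -> dy_Sigma k2 j2 ->
    k2 <= k1 ->
    dy_cube m k1 j1 `<=` dy_cube m k2 j2 \/
    dy_cube m k1 j1 `&` dy_cube m k2 j2 = set0 ;
  dy_cover : forall B : mball X, exists m k j,
    [/\ dy_Sigma k j, bset B `<=` dy_cube m k j
      & (diam (dy_cube m k j) <= (Cd / 2)%:E * diam (bset B))%E] }.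

#[global] Arguments dy_Sigma {X delta Cd} _ _ _.
#[global] Arguments dy_cube {X delta Cd} _ _ _ _ _.
#[global] Arguments dy_center {X delta Cd} _ _ _ _.

Definition dyadic_cubes (X : measurableMetricType d R) (delta Cd : R)
    (S : dyadic_system X delta Cd) : set (set X) :=
  [set Q | exists m k j, dy_Sigma S k j /\ Q = dy_cube S m k j].

End dyadic_cubes.

Section complex_valued_functions.
Context {R : realType} {d : measure_display} {X : measurableType d}.
Variable mu : {measure set X -> \bar R}.
Implicit Types (f : X -> R[i]) (D : set X).

Definition cmeasurable f :=
  measurable_fun [set: X] (fun x => complex.Re (f x)) /\
  measurable_fun [set: X] (fun x => complex.Im (f x)).

Definition cintegrable D f :=
  mu.-integrable D (fun x => (complex.Re (f x))%:E) /\
  mu.-integrable D (fun x => (complex.Im (f x))%:E).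

Definition cintegral D f : R[i] :=
  (\int[mu]_(x in D) complex.Re (f x)) +i* (\int[mu]_(x in D) complex.Im (f x)).

Definition absintegral D f : \bar R := (\int[mu]_(x in D) (normc (f x))%:E)%E.

Definition cLnorm (p : \bar R) f : \bar R :=
  Lnorm mu p (fun x => (normc (f x))%:E).

Definition cLp (p : \bar R) f := cmeasurable f /\ (cLnorm p f < +oo)%E.

Definition weakL1 f : \bar R :=
  ereal_sup [set (s%:E * mu [set x | (s < normc (f x))%R])%E
            | s in [set s : R | 0 < s]].

(* T is an operator on L_p with values in classes of functions modulo equality
   almost everywhere. *)
Definition linear_on_Lp (p : \bar R) (T : (X -> R[i]) -> (X -> R[i])) :=
  forall (a : R[i]) f g, cLp p f -> cLp p g ->
  {ae mu, forall x, T (fun y => a * f y + g y) x = a * T f x + T g x}.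

Definition bounded_on_L2 (T : (X -> R[i]) -> (X -> R[i])) :=
  linear_on_Lp 2%:E T /\
  exists C : R, forall f, cLp 2%:E f ->
    cLp 2%:E (T f) /\ (cLnorm 2%:E (T f) <= C%:E * cLnorm 2%:E f)%E.

(* Operators as above are given on L_2; the statement "T maps L_1 to L_{1,oo}"
   means that T extends from the intersection of L_1 and L_2 to L_1. *)
Definition maps_L1_to_weakL1 (T : (X -> R[i]) -> (X -> R[i])) :=
  exists T1 : (X -> R[i]) -> (X -> R[i]),
  [/\ linear_on_Lp 1%:E T1,
      forall f, cLp 1%:E f -> cLp 2%:E f -> {ae mu, forall x, T1 f x = T f x}
    & exists C : R, forall f, cLp 1%:E f ->
        cmeasurable (T1 f) /\ (weakL1 (T1 f) <= C%:E * cLnorm 1%:E f)%E].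

End complex_valued_functions.

Section countable_sums.
Context {R : realType}.
Implicit Types (J : set nat) (u : nat -> R[i]).

Definition csummable J u := summable J (fun j => (normc (u j))%:E).

Definition csum J u : R[i] :=
  limn (fun n => \sum_(0 <= j < n | j \in J) complex.Re (u j)) +i*
  limn (fun n => \sum_(0 <= j < n | j \in J) complex.Im (u j)).

End countable_sums.

Section maximal_function.
Context {R : realType} {d : measure_display} {X : measurableMetricType d R}.
Variables (mu : {measure set X -> \bar R}) (Cd : R) (A : set (set X)).
Implicit Types (f : X -> R[i]) (B : mball X) (Q : set X).

Definition fits B Q := bset B `<=` Q /\ Q `<=` dilate Cd B.

Definition doubling_ball (alpha beta : R) B :=
  (mu (dilate alpha B) <= beta%:E * mu (bset B))%E.

Definition doubling_cube (alpha beta : R) Q :=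
  A Q /\ exists2 B, fits B Q & doubling_ball alpha beta B.

(* When mu (2 Cd B) = 0 the integral vanishes as well, and the extended-real
   conventions 0^-1 = +oo and +oo * 0 = 0 make the average 0. *)
Definition maximal_fun f (x : X) : \bar R :=
  ereal_sup [set
    ereal_sup [set ((mu (dilate (2 * Cd) B))^-1 * absintegral mu Q f)%E
              | B in [set B | fits B Q]]
  | Q in [set Q | A Q /\ Q x]].

Definition level_set f (t : R) : set X :=
  [set x | (t%:E < maximal_fun f x)%E].

Definition maximal_cubes (Omega : set X) : set (set X) :=
  [set Q | [/\ A Q, Q `<=` Omega
             & forall Q', A Q' -> Q `<=` Q' -> Q' `<=` Omega -> Q' = Q]].

End maximal_function.

Section decomposition.
Context {R : realType} {X : Type}.
Variables (J : set nat) (Q : nat -> set X).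
Implicit Types (f : X -> R[i]) (phi : nat -> X -> R[i]).

(* The denominator is a finite sum: the maximal cubes overlap at most as many
   times as there are filtrations. *)
Definition weight (j : nat) (x : X) : R :=
  \1_(Q j) x / \sum_(k \in J) (\1_(Q k) x : R).

Definition cutoff f (j : nat) (x : X) : R[i] := f x * (weight j x)%:C.

Definition good_part f phi (x : X) : R[i] :=
  f x * (\1_(~` \bigcup_(j in J) Q j) x : R)%:C + csum J (fun j => phi j x).

Definition bad_part f phi (x : X) : R[i] :=
  csum J (fun j => cutoff f j x - phi j x).

End decomposition.

Section calderon_zygmund_operators.
Context {R : realType} {d : measure_display} {X : measurableMetricType d R}.
Variables (mu : {measure set X -> \bar R}) (lam : X -> R -> R).

(* The values of K on the diagonal play no role. *)
Definition CZ_kernel (K : X -> X -> R[i]) := exists C tau : R,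
  [/\ 0 < tau <= 1,
      forall x y, x != y -> normc (K x y) <= C / lam x (mdist x y)
    & forall x y y', x != y -> mdist y y' <= mdist x y / 2 ->
        normc (K x y - K x y') + normc (K y x - K y' x) <=
        C * (mdist y y' `^ tau / (mdist x y `^ tau * lam x (mdist x y)))].

Definition csupport (f : X -> R[i]) : set X := closure [set x | f x != 0].

Definition test_function (f : X -> R[i]) :=
  [/\ cmeasurable f, exists M : R, forall x, normc (f x) <= M
    & exists x (r : R), csupport f `<=` ball x r].

Definition CZ_operator (T : (X -> R[i]) -> (X -> R[i])) :=
  exists2 K, CZ_kernel K & forall f, test_function f ->
    {ae mu, forall x, ~ csupport f x ->
       T f x = cintegral mu setT (fun y => K x y * f y)}.

End calderon_zygmund_operators.

(* Main.v *)
Require Import Defs.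
From HB Require Import structures.
From mathcomp Require Import all_boot all_order all_algebra.
From mathcomp Require Import all_classical all_reals all_analysis.
From mathcomp Require Import complex.
From mathcomp Require Import measurable_realfun ess_sup_inf.
From mathcomp Require Import ring lra.

Set Implicit Arguments.
Unset Strict Implicit.
Unset Printing Implicit Defensive.

Import Order.TTheory GRing.Theory Num.Theory.
Import numFieldNormedType.Exports.
Import ComplexField.Normc.

Local Open Scope classical_set_scope.
Local Open Scope complex_scope.
Local Open Scope ring_scope.

(** The statement has two halves, and the second is not derived from the first.

    Decomposition. The cubes [Rc j] overlap without control, so constant
    functions on them may pile up.  A cube of the system is labelled by its
    filtration; among the [Rc j] with the same label, two that meet are nested.
    Write [a_j] for the integral of [normc f] over [Q j] divided by [mu (Rc j)].
    Inside one [Rc j] the cubes [Rc i] of the same label have total mass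
      sum of the integrals of [normc f] over [Q i]
        <= N * integral of [normc f] over [Rc j] <= N * t * beta * mu (Rc j):
    the [Q i] overlap at most [N] times (maximal_cubes_overlap), and [Rc j], if
    not the whole space, is strictly larger than the maximal cube [Q j], hence
    contains a point where the maximal function is at most [t], which the doubling
    ball of [Rc j] turns into a bound on its mean (doubling_average).  This is a Carleson packing
    condition, so by Chebyshev the sum of the [a_i] over the cubes of the same
    label inside [Rc j] is bounded by twice the packing constant on a set
    [E j] that fills at least half of [Rc j] (carleson_selection).  Constants
    supported on the [E j] instead of the [Rc j], with the prescribed integrals,
    have bounded sum: at a given point, the sum over one label is controlled by
    the sum attached to the largest cube (cz_functions).

    Weak type (1,1).  Here balls replace cubes, which avoids a
    differentiation theorem.  Let [f >= 0] be bounded with bounded support, let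
    [F] be the set where [f > t], and [h] the restriction of [f] to [F].  Around
    each point of [F] there is a radius beyond which the integral of [h] over
    every concentric ball is at most [t] times the measure of the ball four times
    larger; finitely many such balls cover [F] up to a small measure, and the
    measure of their union is at most [mu F] plus [t^-1] times the integral of
    [h], up to an arbitrarily small error (stopping_cover).  Cut [h] along these
    balls, and subtract from each piece [g_j] of mass [m_j] its mean [p_j] over
    the first ball, among the dilates by powers of 16, that is doubling
    (doubling_radius).  Then
      - each [T (g_j - p_j)] has integral at most a multiple of [m_j] away from
        its stopping ball (local_estimate): between the stopping ball and the
        doubling ball the measures of the annuli grow geometrically, which makes
        the size estimate of the kernel summable, and beyond the doubling ball
        smoothness applies because the mean vanishes;
      - the sum of the [p_j] is good in [L_2], with squared norm at most a
        multiple of [t] times the integral of [f] (almost_orthogonal), although it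
        need not be bounded.
    Chebyshev in [L_1] and [L_2] gives the weak type estimate (weak_nonneg).
    It passes to complex functions by splitting them into four positive parts
    (weak_bounded_supp), and to all of [L_1] because the images of the truncations of
    [f] converge almost everywhere along a fast subsequence (ext_value_exists). *)

(** * Complex moduli and measurability *)

Section complex_basics.
Context {R : realType}.
Implicit Types z w : R[i].

Lemma normc_ge0 z : 0 <= normc z.
Proof. by case: z => a b; rewrite /normc; exact: sqrtr_ge0. Qed.

Lemma normRe_le z : `|complex.Re z| <= normc z.
Proof.
case: z => a b /=; rewrite -sqrtr_sqr ler_sqrt ?lerDl ?sqr_ge0//.
by rewrite addr_ge0 ?sqr_ge0.
Qed.

Lemma normIm_le z : `|complex.Im z| <= normc z.
Proof.
case: z => a b /=; rewrite -sqrtr_sqr ler_sqrt ?lerDr ?sqr_ge0//.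
by rewrite addr_ge0 ?sqr_ge0.
Qed.

Lemma normc_le z : normc z <= `|complex.Re z| + `|complex.Im z|.
Proof.
case: z => a b /=; rewrite -(ger0_norm (_ : 0 <= `|a| + `|b|)) ?addr_ge0//.
rewrite -sqrtr_sqr ler_sqrt ?sqr_ge0// sqrrD !real_normK ?num_real//.
by rewrite lerD2r lerDl mulrn_wge0 ?mulr_ge0.
Qed.

Lemma normc_real (r : R) : normc (r%:C) = `|r|.
Proof. by rewrite /normc /= expr0n/= addr0 sqrtr_sqr. Qed.

Lemma normc_triangle z w : normc (z + w) <= normc z + normc w.
Proof. exact: le_normcD. Qed.

Lemma normcB z w : normc (z - w) = normc (w - z).
Proof. by rewrite -[LHS](normcN (z - w)) opprB. Qed.

Lemma ReD z w : complex.Re (z + w) = complex.Re z + complex.Re w.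
Proof. by case: z w => ? ? []. Qed.
Lemma ImD z w : complex.Im (z + w) = complex.Im z + complex.Im w.
Proof. by case: z w => ? ? []. Qed.
Lemma ReN z : complex.Re (- z) = - complex.Re z.
Proof. by case: z. Qed.
Lemma ImN z : complex.Im (- z) = - complex.Im z.
Proof. by case: z. Qed.
Lemma ReM z w : complex.Re (z * w) =
  complex.Re z * complex.Re w - complex.Im z * complex.Im w.
Proof. by case: z w => ? ? []. Qed.
Lemma ImM z w : complex.Im (z * w) =
  complex.Re z * complex.Im w + complex.Im z * complex.Re w.
Proof. by case: z w => ? ? []. Qed.

Lemma ReMr z (r : R) : complex.Re (z * r%:C) = complex.Re z * r.
Proof. by rewrite ReM /= mulr0 subr0. Qed.
Lemma ImMr z (r : R) : complex.Im (z * r%:C) = complex.Im z * r.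
Proof. by rewrite ImM /= mulr0 add0r. Qed.

Lemma normc_sum (I : Type) (s : seq I) (F : I -> R[i]) :
  normc (\sum_(i <- s) F i) <= \sum_(i <- s) normc (F i).
Proof.
elim: s => [|i s IH]; first by rewrite !big_nil normc0.
by rewrite !big_cons (le_trans (normc_triangle _ _))// lerD2l.
Qed.

End complex_basics.

Section complex_measurable.
Context {R : realType} {d : measure_display} {X : measurableType d}.
Implicit Types (f g : X -> R[i]).

Lemma cmeasurableD f g : cmeasurable f -> cmeasurable g ->
  cmeasurable (fun x => f x + g x).
Proof.
move=> [f1 f2] [g1 g2]; split.
  by under eq_fun do rewrite ReD; exact: measurable_funD.
by under eq_fun do rewrite ImD; exact: measurable_funD.
Qed.

Lemma cmeasurableM f g : cmeasurable f -> cmeasurable g ->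
  cmeasurable (fun x => f x * g x).
Proof.
move=> [f1 f2] [g1 g2]; split.
  by under eq_fun do rewrite ReM; apply: measurable_funB; exact: measurable_funM.
by under eq_fun do rewrite ImM; apply: measurable_funD; exact: measurable_funM.
Qed.

Lemma cmeasurable_cst (a : R[i]) : cmeasurable (fun _ : X => a).
Proof. by split; exact: measurable_cst. Qed.

Lemma cmeasurableN f : cmeasurable f -> cmeasurable (fun x => - f x).
Proof.
move=> [f1 f2]; split.
  by under eq_fun do rewrite ReN; exact: measurableT_comp.
by under eq_fun do rewrite ImN; exact: measurableT_comp.
Qed.

Lemma cmeasurableB f g : cmeasurable f -> cmeasurable g ->
  cmeasurable (fun x => f x - g x).
Proof. by move=> mf mg; apply: cmeasurableD => //; exact: cmeasurableN. Qed.

Lemma cmeasurable_real (u : X -> R) : measurable_fun [set: X] u ->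
  cmeasurable (fun x => (u x)%:C).
Proof. by move=> mu; split => //=; exact: measurable_cst. Qed.

Lemma cmeasurable_sum (I : Type) (s : seq I) (F : I -> X -> R[i]) :
  (forall i, cmeasurable (F i)) -> cmeasurable (fun x => \sum_(i <- s) F i x).
Proof.
move=> mF; elim: s => [|i s IH].
  by under eq_fun do rewrite big_nil; exact: cmeasurable_cst.
by under eq_fun do rewrite big_cons; exact: cmeasurableD.
Qed.

Lemma measurable_normc f : cmeasurable f ->
  measurable_fun [set: X] (fun x => normc (f x)).
Proof.
move=> [f1 f2].
rewrite (_ : (fun x => _) = (fun x => Num.sqrt (complex.Re (f x) ^+ 2 + complex.Im (f x) ^+ 2))).
  apply: (@measurableT_comp _ _ _ _ _ _ (@Num.sqrt R)) => //.
    apply: continuous_measurable_fun; exact: sqrt_continuous.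
  by apply: measurable_funD; exact: measurable_funX.
by apply/funext => x; case: (f x).
Qed.

Lemma measurable_Enormc f : cmeasurable f ->
  measurable_fun [set: X] (fun x => (normc (f x))%:E).
Proof. by move=> mf; apply/measurable_EFinP; exact: measurable_normc. Qed.

Lemma measurable_Enormc2 f : cmeasurable f ->
  measurable_fun [set: X] (fun x => ((normc (f x)) ^+ 2)%:E).
Proof.
by move=> mf; apply/measurable_EFinP/measurable_funX; exact: measurable_normc.
Qed.

Lemma measurable_normc_gt f (s : R) : cmeasurable f ->
  measurable [set x | s < normc (f x)].
Proof.
move=> mf; rewrite -[X in measurable X]setTI.
have -> : [set x | s < normc (f x)] = (fun x => normc (f x)) @^-1` `]s, +oo[.
  by apply/seteqP; split => x /=; rewrite in_itv/= andbT.
by apply: (measurable_normc mf) => //; exact: measurable_itv.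
Qed.

End complex_measurable.

(** * L_1 and L_2 masses *)

Section lebesgue_norms.
Context {R : realType} {d : measure_display} {X : measurableType d}.
Variable mu : {measure set X -> \bar R}.
Implicit Types (f g : X -> R[i]).
Local Open Scope ereal_scope.

(** The square of the L_2 norm, which avoids powers with real exponent. *)
Definition L2mass f : \bar R := \int[mu]_x ((normc (f x)) ^+ 2)%:E.

Lemma le_mu (A B : set X) : measurable A -> measurable B -> A `<=` B ->
  mu A <= mu B.
Proof. by move=> mA mB AB; apply: le_measure; rewrite ?inE. Qed.

(** Images of functions by [T] are only determined almost everywhere, so
    level sets are compared up to null sets. *)
Lemma le_mu_ae (A B : set X) : measurable A -> measurable B ->
  {ae mu, forall x, A x -> B x} -> mu A <= mu B.
Proof.
move=> mA mB [N [mN N0 hN]]; apply: (@le_trans _ _ (mu (B `|` N))).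
  apply: le_mu => //; first exact: measurableU.
  move=> x Ax; have [Bx|nBx] := pselect (B x); first by left.
  by right; apply: hN => /(_ Ax).
by rewrite (le_trans (measureU2 _ mB mN))// [X in _ + X]N0 adde0.
Qed.

Lemma cLnorm1E f : cLnorm mu 1%:E f = absintegral mu setT f.
Proof.
rewrite /cLnorm Lnorm1 /absintegral; apply: eq_integral => x _.
by rewrite gee0_abs// lee_fin normc_ge0.
Qed.

Lemma absintegral_ge0 D f : 0 <= absintegral mu D f.
Proof. by apply: integral_ge0 => x _; rewrite lee_fin normc_ge0. Qed.

Lemma L2mass_ge0 f : 0 <= L2mass f.
Proof. by apply: integral_ge0 => x _; rewrite lee_fin sqr_ge0. Qed.

Lemma cLnorm2E f : cLnorm mu 2%:E f `^ 2 = L2mass f.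
Proof.
rewrite /cLnorm poweR_Lnorm ?pnatr_eq0//; apply: eq_integral => x _.
by rewrite gee0_abs ?lee_fin ?normc_ge0//= powR_mulrn// normc_ge0.
Qed.

Lemma cLp2P f : cLp mu 2%:E f <-> cmeasurable f /\ L2mass f < +oo.
Proof.
split=> -[mf h]; split=> //; move: h; rewrite -cLnorm2E.
  by move=> h; rewrite poweR_lty.
by apply: lty_poweRy; rewrite pnatr_eq0.
Qed.

Lemma cLp1P f : cLp mu 1%:E f <-> cmeasurable f /\ absintegral mu setT f < +oo.
Proof. by rewrite /cLp cLnorm1E. Qed.

(** Adding 1 to the squared constant makes it positive. *)
Lemma L2mass_bounded (T : (X -> R[i]) -> (X -> R[i])) : bounded_on_L2 mu T ->
  exists2 C : R, (0 < C)%R & forall f, cLp mu 2%:E f ->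
    cmeasurable (T f) /\ L2mass (T f) <= C%:E * L2mass f.
Proof.
move=> [_ [C HC]]; exists (`|C| ^+ 2 + 1)%R; first by rewrite ltr_wpDl ?sqr_ge0.
move=> f /[dup] f2 /HC [[mTf _] le]; split=> //.
rewrite -!cLnorm2E; set a := cLnorm _ _ _ in le *; set b := cLnorm _ _ _ in le *.
have a0 : 0 <= a by exact: Lnorm_ge0.
have b0 : 0 <= b by exact: Lnorm_ge0.
have le' : a <= `|C|%:E * b.
  by rewrite (le_trans le)// lee_wpmul2r// lee_fin ler_norm.
rewrite (@le_trans _ _ ((`|C|%:E * b) `^ 2))//.
  by apply: gt0_ler_poweR => //; rewrite ?in_itv/= ?leey ?andbT// mule_ge0.
rewrite poweRM// poweR_EFin powR_mulrn// lee_wpmul2r ?poweR_ge0//.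
by rewrite lee_fin lerDl.
Qed.

(** Chebyshev's inequality. *)
Lemma absintegral_lt D f (s : R) : measurable D -> cmeasurable f -> (0 < s)%R ->
  s%:E * mu (D `&` [set x | (s < normc (f x))%R]) <= absintegral mu D f.
Proof.
move=> mD mf s0.
have mfD : measurable_fun D (fun x => (normc (f x))%:E).
  by apply: measurable_funTS; exact: measurable_Enormc.
have h := @le_integral_abse _ _ _ mu _ mD _ s mfD s0.
apply: (@le_trans _ _ (s%:E * mu (D `&` [set x | s%:E <= `|(normc (f x))%:E|]))).
  rewrite lee_pmul2l ?lte_fin//; apply: le_mu.
  - by apply: measurableI => //; exact: measurable_normc_gt.
  - by apply: emeasurable_fun_c_infty => //; exact: measurableT_comp.
  - by move=> x [Dx /ltW h']; split => //=; rewrite lee_fin ger0_norm ?normc_ge0.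
apply: (le_trans h); rewrite /absintegral le_eqVlt; apply/orP; left; apply/eqP.
by apply: eq_integral => x _; rewrite gee0_abs// lee_fin normc_ge0.
Qed.

Lemma L2mass_lt f (s : R) : cmeasurable f -> (0 < s)%R ->
  (s ^+ 2)%:E * mu [set x | (s < normc (f x))%R] <= L2mass f.
Proof.
move=> mf s0.
have s20 : (0 < s ^+ 2)%R by rewrite exprn_gt0.
have := @le_integral_abse _ _ _ mu _ measurableT _ (s^+2)%R (measurable_Enormc2 mf) s20.
rewrite setTI => h; apply: (@le_trans _ _ ((s ^+ 2)%:E * mu [set x | (s ^+ 2)%:E <= `|((normc (f x))^+2)%:E|])).
  rewrite lee_pmul2l ?lte_fin//; apply: le_measure; rewrite ?inE.
  - exact: measurable_normc_gt.
  - rewrite -[X in measurable X]setTI.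
    by apply: emeasurable_fun_c_infty => //; apply: measurableT_comp => //; exact: measurable_Enormc2.
  - move=> x /= /ltW h'; rewrite lee_fin ger0_norm ?sqr_ge0//.
    by rewrite ler_sqr ?nnegrE ?normc_ge0// ltW.
apply: (le_trans h); rewrite /L2mass le_eqVlt; apply/orP; left; apply/eqP.
by apply: eq_integral => x _; rewrite gee0_abs// lee_fin sqr_ge0.
Qed.

Lemma L2massD f g : cmeasurable f -> cmeasurable g ->
  L2mass (fun x => f x + g x)%R <= 2%:E * L2mass f + 2%:E * L2mass g.
Proof.
move=> mf mg; rewrite /L2mass -!ge0_integralZl_EFin//; last 4 first.
- by move=> x _; rewrite lee_fin sqr_ge0.
- exact: measurable_Enormc2.
- by move=> x _; rewrite lee_fin sqr_ge0.
- exact: measurable_Enormc2.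
rewrite -ge0_integralD//; last 4 first.
- by move=> x _; rewrite -EFinM lee_fin mulr_ge0 ?sqr_ge0.
- by apply: measurable_funeM; exact: measurable_Enormc2.
- by move=> x _; rewrite -EFinM lee_fin mulr_ge0 ?sqr_ge0.
- by apply: measurable_funeM; exact: measurable_Enormc2.
apply: ge0_le_integral => //.
- by move=> x _; rewrite lee_fin sqr_ge0.
- by apply: measurable_Enormc2; exact: cmeasurableD.
- by apply: emeasurable_funD; apply: measurable_funeM; exact: measurable_Enormc2.
move=> x _; rewrite -!EFinM -EFinD lee_fin.
have := normc_triangle (f x) (g x).
have := normc_ge0 (f x + g x)%R; have := normc_ge0 (f x); have := normc_ge0 (g x).
move: (normc _) (normc _) (normc _) => a b c a0 b0 c0 h.
have hab := sqr_ge0 (b - c)%R.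
rewrite (@le_trans _ _ ((b + c) ^+ 2)%R)//; last by clear -hab; nra.
by rewrite ler_sqr ?nnegrE ?addr_ge0.
Qed.

Lemma absintegralD D f g : measurable D -> cmeasurable f -> cmeasurable g ->
  absintegral mu D (fun x => f x + g x)%R <= absintegral mu D f + absintegral mu D g.
Proof.
move=> mD mf mg; rewrite /absintegral -ge0_integralD//; last 4 first.
- by move=> x _; rewrite lee_fin normc_ge0.
- by apply: measurable_funTS; exact: measurable_Enormc.
- by move=> x _; rewrite lee_fin normc_ge0.
- by apply: measurable_funTS; exact: measurable_Enormc.
apply: ge0_le_integral => //.
- by move=> x _; rewrite lee_fin normc_ge0.
- by apply: measurable_funTS; apply: measurable_Enormc; exact: cmeasurableD.
- by apply: emeasurable_funD; apply: measurable_funTS; exact: measurable_Enormc.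
by move=> x _; rewrite -EFinD lee_fin normc_triangle.
Qed.

Lemma absintegralZ D (a : R[i]) f : measurable D -> cmeasurable f ->
  absintegral mu D (fun x => a * f x)%R = (normc a)%:E * absintegral mu D f.
Proof.
move=> mD mf; rewrite /absintegral -ge0_integralZl_EFin ?normc_ge0//.
- by under eq_integral do rewrite normcM EFinM.
- by move=> x _; rewrite lee_fin normc_ge0.
- by apply: measurable_funTS; exact: measurable_Enormc.
Qed.

Lemma L2massZ (a : R[i]) f : cmeasurable f ->
  L2mass (fun x => a * f x)%R = ((normc a)^+2)%:E * L2mass f.
Proof.
move=> mf; rewrite /L2mass -ge0_integralZl_EFin ?sqr_ge0//.
- by under eq_integral do rewrite normcM exprMn EFinM.
- by move=> x _; rewrite lee_fin sqr_ge0.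
- exact: measurable_Enormc2.
Qed.

Lemma absintegral_null D f : measurable D -> cmeasurable f -> mu D = 0 ->
  absintegral mu D f = 0.
Proof.
move=> mD mf; apply: null_set_integral => //.
by apply: measurable_funTS; exact: measurable_Enormc.
Qed.

Lemma le_absintegral D D' f : measurable D -> measurable D' -> cmeasurable f ->
  D `<=` D' -> absintegral mu D f <= absintegral mu D' f.
Proof.
move=> mD mD' mf; apply: ge0_subset_integral => //.
  by apply: measurable_funTS; exact: measurable_Enormc.
by move=> x _; rewrite lee_fin normc_ge0.
Qed.

End lebesgue_norms.

(** * Selection of large subsets under a packing condition *)

Section carleson.
Context {R : realType} {d : measure_display} {X : measurableType d}.
Variable mu : {measure set X -> \bar R}.

(** The form in which Chebyshev's inequality is used in [carleson_selection]:
    [p], [q], [r] are the measures of a set, of its part where a function is small,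
    and of its part where the function is at least [2 * L]. *)
Lemma half_mass (p q r : \bar R) (L : R) : (0 < L)%R ->
  (0 <= p -> p < +oo -> 0 <= q -> q <= p -> 0 <= r -> r <= p ->
   (2 * L)%:E * r <= L%:E * p -> p <= q + r -> p <= 2%:E * q)%E.
Proof.
move: p q r => [p| |] [q| |] [r| |]// L0 p0 _ q0 _ r0 _.
rewrite -?EFinM -?EFinD !lee_fin => h h2.
have : r * 2 <= p by rewrite -(ler_pM2l L0); move: h; congr (_ <= _); ring.
by move: h2; clear; lra.
Qed.

Lemma chain_max (D : nat -> set X) (s : seq nat) : s != [::] ->
  (forall i j, i \in s -> j \in s -> D i `<=` D j \/ D j `<=` D i) ->
  exists2 j, j \in s & forall i, i \in s -> D i `<=` D j.
Proof.
elim: s => [//|a s IH] _ H.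
have [->|s0] := eqVneq s [::].
  by exists a; rewrite ?mem_head// => i; rewrite inE => /eqP ->.
have [//|i j si sj|j js Hj] := IH.
  by apply: H; rewrite inE ?si ?sj orbT.
have [aj|ja] := H a j (mem_head _ _) ltac:(by rewrite inE js orbT).
  exists j; first by rewrite inE js orbT.
  by move=> i; rewrite inE => /orP[/eqP->//|/Hj].
exists a; rewrite ?mem_head// => i; rewrite inE => /orP[/eqP->//|/Hj h].
exact: subset_trans h ja.
Qed.

Variables (K : nat) (J : set nat) (kind : nat -> 'I_K) (D : nat -> set X).
Variables (m : nat -> R) (L : R).
Hypothesis L0 : 0 < L.
Hypothesis mD : forall j, J j -> measurable (D j).
Hypothesis finD : forall j, J j -> (mu (D j) < +oo)%E.
Hypothesis m0 : forall j, 0 <= m j.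
Hypothesis nest : forall i j, J i -> J j -> kind i = kind j ->
  D i `&` D j !=set0 -> D i `<=` D j \/ D j `<=` D i.
Let P j := [set i | [/\ J i, kind i = kind j & D i `<=` D j]].
Hypothesis packing : forall j, J j ->
  (\esum_(i in P j) (m i)%:E <= L%:E * mu (D j))%E.

Let a i := m i / fine (mu (D i)).
Let a0 i : 0 <= a i.
Proof. by rewrite /a divr_ge0// fine_ge0. Qed.
Let b j i := if i \in P j then a i else 0.
Let b0 j i : 0 <= b j i.
Proof. by rewrite /b; case: ifP. Qed.
Let S j x : \bar R := (\sum_(0 <= i <oo) (b j i * \1_(D i) x)%:E)%E.

Let mS1 j i : measurable_fun [set: X] (fun x => (b j i * \1_(D i) x)%:E).
Proof.
apply/measurable_EFinP; rewrite /b; case: ifPn => [|_].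
  by rewrite inE => -[Ji _ _]; apply: measurable_funM => //; exact: measurable_indic (mD Ji).
by under eq_fun do rewrite mul0r; exact: measurable_cst.
Qed.

Let S1_ge0 j i x : (0 <= (b j i * \1_(D i) x)%:E)%E.
Proof. by rewrite lee_fin mulr_ge0. Qed.

Let mS j : measurable_fun [set: X] (S j).
Proof. by apply: ge0_emeasurable_sum => // i x _ _; exact: S1_ge0. Qed.

Let S_ge0 j x : (0 <= S j x)%E.
Proof. by apply: nneseries_ge0 => i _ _; exact: S1_ge0. Qed.

Let intS j : J j -> (\int[mu]_(x in D j) S j x <= L%:E * mu (D j))%E.
Proof.
move=> Jj; apply: le_trans (packing Jj).
rewrite integral_nneseries; [|exact: mD|by move=> i; exact: measurable_funTS|by []].
rewrite esum_mkcond -nneseries_esumT; last by move=> i; case: ifP => // _; rewrite lee_fin.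
apply: lee_nneseries => i _.
  by move=> _; apply: integral_ge0.
rewrite /b; case: ifPn => [|_]; last first.
  by under eq_integral do rewrite mul0r; rewrite integral0.
rewrite inE => -[Ji _ ij].
under eq_integral do rewrite EFinM.
rewrite ge0_integralZl_EFin//; [|exact: mD|by apply/measurable_EFinP; exact: measurable_indic (mD Ji)].
rewrite integral_indic; [|exact: mD|exact: mD].
rewrite (setIidl ij).
have muf : mu (D i) \is a fin_num by rewrite ge0_fin_numE ?finD.
rewrite /a -[X in (_ * X)%E](fineK muf) -EFinM lee_fin.
have [->|rN0] := eqVneq (fine (mu (D i))) 0; first by rewrite mulr0.
by rewrite divfK.
Qed.

Let E j := D j `&` [set x | (S j x <= (2 * L)%:E)%E].

(** [S j], the sum of the densities of the sets of the same kind inside [D j],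
    has mean at most [L] on [D j], hence is at most [2 * L] on a set [E j] filling
    half of [D j].  At a point [x], the sets [D j] of one kind with [E j x] form a
    chain, so finitely many of their densities are among the terms of [S j x]
    for the largest of them. *)
Lemma carleson_selection : exists E : nat -> set X,
  (forall j, J j -> [/\ measurable (E j), E j `<=` D j &
      (mu (D j) <= 2%:E * mu (E j))%E]) /\
  forall x, (\esum_(j in [set j | J j /\ E j x])
     (m j / fine (mu (D j)))%:E <= (K%:R * (2 * L))%:E)%E.
Proof.
exists E; split=> [j Jj|x].
  have mE : measurable (E j).
    rewrite /E; apply: emeasurable_fun_infty_c; first exact: mD.
    exact: measurable_funTS.
  split=> //; first by move=> x [].
  have := @le_integral_abse _ _ _ mu _ (mD Jj) (S j) (2 * L) (measurable_funTS (@mS j)).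
  move=> /(_ ltac:(by rewrite mulr_gt0)).
  set I1 := (X in (_ <= X)%E) => h.
  have I1E : I1 = (\int[mu]_(x in D j) S j x)%E.
    by apply: eq_integral => x _; rewrite gee0_abs.
  have mG : measurable (D j `&` [set x | ((2 * L)%:E <= `|S j x|)%E]).
    apply: emeasurable_fun_c_infty; first exact: mD.
    by apply: measurableT_comp => //; exact: measurable_funTS.
  have h2 : (mu (D j) <= mu (E j) + mu (D j `&` [set x | ((2 * L)%:E <= `|S j x|)%E]))%E.
    rewrite (le_trans _ (measureU2 _ mE mG))//.
    apply: le_measure; rewrite ?inE//; [exact: mD|exact: measurableU|].
    move=> x Dx; have [h'|/ltW h'] := leP (S j x) (2 * L)%:E; first by left.
    by right; split => //=; rewrite gee0_abs.
  move: h h2; rewrite I1E => h h2.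
  have {}h := le_trans h (intS Jj).
  have GD : (mu (D j `&` [set x | ((2 * L)%:E <= `|S j x|)%E]) <= mu (D j))%E.
    by apply: le_measure; rewrite ?inE//; exact: mD.
  have ED : (mu (E j) <= mu (D j))%E.
    by apply: le_mu => //; [exact: mD|move=> x []].
  exact: (half_mass L0 (measure_ge0 mu _) (finD Jj) (measure_ge0 mu _) ED
            (measure_ge0 mu _) GD h h2).
apply: ge_ereal_sup => _ [A [fA AE] <-].
rewrite fsbig_finite//= sumEFin lee_fin.
set s := finmap.enum_fset (fset_set A).
have sP i : i \in s -> J i /\ E i x.
  by move=> si; apply/AE/set_mem; rewrite -in_fset_set.
rewrite (partition_big kind xpredT)//=.
apply: (@le_trans _ _ (\sum_(k < K) (2 * L))); last by rewrite sumr_const card_ord -[leLHS]mulr_natl.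
apply: ler_sum => k _.
rewrite -big_filter; set s' := [seq i <- s | kind i == k].
have us : uniq s' by rewrite filter_uniq// finmap.fset_uniq.
have s'P i : i \in s' -> [/\ J i, E i x & kind i = k].
  by rewrite mem_filter => /andP[/eqP ki /sP[]].
have [->|s'0] := eqVneq s' [::]; first by rewrite big_nil mulr_ge0// ltW.
have [i j /s'P[Ji [Dix _] ki] /s'P[Jj [Djx _] kj]|j js' jmax] := @chain_max D s' s'0.
  by apply: nest => //; [rewrite ki kj|exists x].
have [Jj [Djx Sjx] kj] := s'P _ js'.
rewrite -lee_fin; apply: le_trans Sjx.
have : (\sum_(i <- s') (b j i * \1_(D i) x)%:E <= S j x)%E.
  rewrite /S nneseries_esumT; last by move=> i; exact: S1_ge0.
  apply: esum_ge; exists [set` s'].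
    by split=> //; exact: finite_seq.
  by rewrite -fsbig_seq.
apply: le_trans; rewrite sumEFin lee_fin.
rewrite big_seq [leRHS]big_seq; apply: ler_sum => i is'.
have [Ji [Dix _] ki] := s'P _ is'.
rewrite indicE mem_set// mulr1 /b mem_set//; split=> //; [by rewrite ki kj|exact: jmax].
Qed.

End carleson.

(** * Countable sums and weights with bounded overlap *)

Section countable_complex_sums.
Context {R : realType}.
Implicit Types (J : set nat) (u v : nat -> R[i]).

Lemma summable_is_cvg J (r : nat -> R) (b : nat -> R) (M : R) :
  (forall j, J j -> `|r j| <= b j) -> (\esum_(j in J) (b j)%:E <= M%:E)%E ->
  cvgn (fun n => \sum_(0 <= j < n | j \in J) r j) /\
  `|limn (fun n => \sum_(0 <= j < n | j \in J) r j)| <= M.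
Proof.
move=> rb bM.
have bd n : \sum_(0 <= j < n | j \in J) `|r j| <= M.
  rewrite -lee_fin; apply: le_trans bM; apply: esum_ge.
  exists ([set` index_iota 0 n] `&` J).
    by split; [exact: finite_setIl (finite_seq _)|move=> x []].
  rewrite fsbig_mkcondr -fsbig_seq ?iota_uniq// -sumEFin [in leLHS]big_mkcond/=.
  apply: lee_sum => j _; case: ifPn => //; rewrite inE lee_fin; exact: rb.
have cv : cvgn (fun n => \sum_(0 <= j < n | j \in J) r j).
  under eq_fun do rewrite big_mkcond/=.
  apply: (@normed_cvg R R^o (fun j => if j \in J then r j else 0)).
  apply: nondecreasing_is_cvgn.
    exact: (@nondecreasing_series R (fun j => `|if j \in J then r j else 0|) xpredT 0%N).
  exists M => _ [n _ <-]; rewrite /series/=; apply: le_trans (bd n).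
  by rewrite [leRHS]big_mkcond/=; apply: ler_sum => j _; case: ifP; rewrite ?normr0.
split=> //.
have bd' n : `|\sum_(0 <= j < n | j \in J) r j| <= M.
  by apply: le_trans (bd n); exact: ler_norm_sum.
rewrite ler_norml; apply/andP; split.
  by apply: limr_ge => //; near=> n; have := bd' n; rewrite ler_norml => /andP[].
by apply: limr_le => //; near=> n; have := bd' n; rewrite ler_norml => /andP[].
Unshelve. all: by end_near. Qed.

Lemma csummable_le J u (M : R) : (\esum_(j in J) (normc (u j))%:E <= M%:E)%E ->
  [/\ csummable J u, cvgn (fun n => \sum_(0 <= j < n | j \in J) complex.Re (u j)),
     cvgn (fun n => \sum_(0 <= j < n | j \in J) complex.Im (u j)) &
     normc (csum J u) <= 2 * M].
Proof.
move=> h.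
have [c1 l1] := summable_is_cvg (fun j _ => normRe_le (u j)) h.
have [c2 l2] := summable_is_cvg (fun j _ => normIm_le (u j)) h.
split=> //.
  rewrite /csummable /summable (le_lt_trans _ (ltry M))//.
  apply: le_trans h; apply: le_esum => j _.
  by rewrite gee0_abs// lee_fin normc_ge0.
by apply: le_trans (normc_le _) _; rewrite mulr_natl mulr2n lerD.
Qed.

Lemma csummableP J u : csummable J u ->
  exists M : R, (\esum_(j in J) (normc (u j))%:E <= M%:E)%E.
Proof.
rewrite /csummable /summable.
have -> : (\esum_(x in J) `|(normc (u x))%:E| = \esum_(x in J) (normc (u x))%:E)%E.
  by apply: eq_esum => j _; rewrite gee0_abs// lee_fin normc_ge0.
have := @esum_ge0 _ _ J (fun x => (normc (u x))%:E) (fun j _ => ltac:(by rewrite lee_fin normc_ge0)).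
by case: (\esum_(j in J) _)%E => [r| |]// _ _; exists r.
Qed.

Lemma csummableD J u v : csummable J u -> csummable J v ->
  csummable J (fun j => u j + v j) /\
  csum J (fun j => u j + v j) = csum J u + csum J v.
Proof.
move=> /[dup] su /csummableP[M uM] /[dup] sv /csummableP[M' vM'].
have [_ cu1 cu2 _] := csummable_le uM.
have [_ cv1 cv2 _] := csummable_le vM'.
split.
  have [|//] := @csummable_le J (fun j => u j + v j) (M + M').
  rewrite EFinD; apply: le_trans (leeD uM vM').
  rewrite -esumD; [|by move=> j _; rewrite lee_fin normc_ge0..].
  by apply: le_esum => j _; rewrite -EFinD lee_fin normc_triangle.
rewrite /csum; apply/eqP; rewrite eq_complex /=; apply/andP; split; apply/eqP.
- rewrite -limD//; congr (limn _); apply/funext => n /=.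
  by under eq_bigr do rewrite ReD; rewrite big_split.
- rewrite -limD//; congr (limn _); apply/funext => n /=.
  by under eq_bigr do rewrite ImD; rewrite big_split.
Qed.

Lemma csummableN J u : csummable J u -> csummable J (fun j => - u j).
Proof.
rewrite /csummable /summable; congr (_ < _)%E; apply: eq_esum => j _.
by rewrite normcN.
Qed.

End countable_complex_sums.

Section bounded_overlap.
Context {R : realType} {X : Type}.
Variables (N : nat) (J : set nat) (Q : nat -> set X).
Hypothesis overlap : forall (s : seq nat) (x : X), uniq s ->
  (forall j, j \in s -> J j /\ Q j x) -> (size s <= N)%N.

Lemma overlap_finite (x : X) : finite_set [set j | J j /\ Q j x].
Proof.
apply: contrapT => /(infinite_set_fset N.+1) [s sJ].
have := @overlap (finmap.enum_fset s) x (finmap.fset_uniq _).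
move=> /(_ (fun j js => sJ j js)) h1 h2.
by have := leq_trans h2 h1; rewrite ltnn.
Qed.

Lemma overlap_sum (x : X) (s : seq nat) : uniq s -> (forall j, j \in s -> J j) ->
  \sum_(j <- s) (\1_(Q j) x : R) <= N%:R.
Proof.
move=> us sJ; rewrite (bigID (fun j => x \in Q j))/= [X in _ + X]big1 ?addr0; last first.
  by move=> j; rewrite indicE => /negbTE ->.
rewrite -big_filter (eq_big_seq (fun=> 1)); last first.
  by move=> j; rewrite mem_filter indicE => /andP[-> _].
rewrite big_const_seq count_predT iter_addr_0 ler_nat.
apply: (@overlap _ x); first exact: filter_uniq.
by move=> j; rewrite mem_filter => /andP[/set_mem Qj /sJ].
Qed.

Let multiplicity (x : X) : R := \sum_(k \in J) (\1_(Q k) x : R).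

Lemma multiplicity_seq x : exists s : seq nat, [/\ uniq s,
  forall j, j \in s <-> J j /\ Q j x & multiplicity x = \sum_(j <- s) (\1_(Q j) x : R)].
Proof.
have fF := overlap_finite x.
exists (finmap.enum_fset (fset_set [set j | J j /\ Q j x])); split.
- exact: finmap.fset_uniq.
- move=> j; rewrite in_fset_set//; split; first by move=> /set_mem.
  by move=> h; apply/mem_set.
rewrite -fsbig_finite//; apply/esym/fsbig_widen; first by move=> j [].
move=> j [Jj /= nJQ]; rewrite indicE; case: (boolP (x \in Q j)) => // /set_mem Qj.
by exfalso; apply: nJQ.
Qed.

Lemma multiplicity_ge1 x j : J j -> Q j x -> 1 <= multiplicity x.
Proof.
move=> Jj Qj; have [s [us sP ->]] := multiplicity_seq x.
have js : j \in s by apply/sP.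
by rewrite (bigD1_seq j)//= indicE mem_set// lerDl sumr_ge0.
Qed.

Lemma multiplicity_le x : multiplicity x <= N%:R.
Proof.
have [s [us sP ->]] := multiplicity_seq x.
by apply: overlap_sum => // j /sP[].
Qed.

Lemma weight_out j x : ~ Q j x -> weight J Q j x = 0 :> R.
Proof. by move=> nQ; rewrite /weight indicE memNset// mul0r. Qed.

Lemma weight_ge0 j x : 0 <= weight J Q j x :> R.
Proof.
rewrite /weight divr_ge0// -/(multiplicity x).
by have [s [_ _ ->]] := multiplicity_seq x; rewrite sumr_ge0.
Qed.

Lemma weight_le1 j x : J j -> weight J Q j x <= 1 :> R.
Proof.
move=> Jj; have [Qj|nQ] := pselect (Q j x); last by rewrite weight_out.
have h := multiplicity_ge1 Jj Qj.
rewrite /weight indicE mem_set//= -/(multiplicity x) mul1r invf_le1//.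
exact: lt_le_trans h.
Qed.

Lemma weight_ge j x : J j -> Q j x -> 1 <= N%:R * weight J Q j x :> R.
Proof.
move=> Jj Qj; have h := multiplicity_ge1 Jj Qj.
rewrite /weight indicE mem_set//= -/(multiplicity x) mul1r ler_pdivlMr ?mul1r ?multiplicity_le//.
exact: lt_le_trans h.
Qed.

Lemma multiplicity_esum x :
  (\esum_(j in J) (\1_(Q j) x : R)%:E = (multiplicity x)%:E)%E.
Proof.
have fF := overlap_finite x.
have [s [us sP ->]] := multiplicity_seq x.
have -> : (\esum_(j in J) (\1_(Q j) x : R)%:E =
           \esum_(j in J `&` [set` s]) (\1_(Q j) x : R)%:E)%E.
  rewrite esum_mkcondr; apply: eq_esum => j Jj; case: ifPn => // h.
  rewrite indicE memNset// => Qj; move: h; rewrite notin_setE; apply => /=.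
  by apply/sP.
have -> : J `&` [set` s] = [set` s].
  by apply/seteqP; split=> [j []//|j js]; split => //; move: js => /= /sP[].
rewrite esum_fset; [|exact: finite_seq|by move=> j _; rewrite lee_fin].
by rewrite -fsbig_seq// sumEFin.
Qed.

(** Only finitely many terms are nonzero, so the partial sums are eventually
    constant; this gives the pointwise identity between [f] and its pieces. *)
Lemma weight_sum x : exists n0, forall n, (n0 <= n)%N ->
  \sum_(0 <= j < n | j \in J) (weight J Q j x : R) =
  \1_(\bigcup_(j in J) Q j) x.
Proof.
have [s [us sP mE]] := multiplicity_seq x.
exists (\max_(j <- s) j).+1 => n hn.
have -> : \sum_(0 <= j < n | j \in J) (weight J Q j x : R) =
          \sum_(j <- s) (weight J Q j x : R).
  rewrite (bigID (mem s))/= [X in _ + X]big1 ?addr0; last first.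
    move=> j /andP[/set_mem Jj js]; apply: weight_out => Qj.
    by move/negP: js; apply; apply/sP.
  rewrite -big_filter; apply: perm_big; apply: uniq_perm => //.
    by rewrite filter_uniq// iota_uniq.
  move=> j; rewrite mem_filter mem_index_iota; apply/idP/idP.
    by move=> /andP[/andP[]].
  move=> js; rewrite js andbT; have [Jj _] := (sP j).1 js; rewrite mem_set//=.
  apply: leq_trans hn; rewrite ltnS.
  by rewrite (big_rem _ js)/= leq_max leqnn.
rewrite /weight -mulr_suml -/(multiplicity x) -mE.
have [[j Jj Qj]|nU] := pselect ((\bigcup_(j in J) Q j) x).
  rewrite indicE mem_set; last by exists j.
  by rewrite divff// gt_eqF// (lt_le_trans _ (multiplicity_ge1 Jj Qj)).
rewrite [RHS]indicE memNset//= mE big_seq big1 ?mul0r// => j /sP[Jj Qj].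
by exfalso; apply: nU; exists j.
Qed.

End bounded_overlap.

(** * Balls and dyadic cubes *)

Section metric_balls.
Context {R : realType}.

Lemma ballP (X : metricType R) (x : X) (r : R) (y : X) :
  ball x r y <-> mdist x y < r.
Proof. by rewrite ballEmdist. Qed.

Lemma open_mball (X : metricType R) (x : X) (r : R) : open (ball x r).
Proof.
rewrite openE => y /ballP xy; apply/nbhs_ballP.
exists (r - mdist x y) => /=; first by rewrite subr_gt0.
move=> z /ballP yz; apply/ballP; apply: le_lt_trans (metric_triangle x y z) _.
by rewrite -ltrBrDl.
Qed.

Lemma subset_mball (X : metricType R) (x y : X) (r s : R) :
  mdist x y + r <= s -> ball y r `<=` ball x s.
Proof.
move=> h z /ballP yz; apply/ballP; apply: le_lt_trans (metric_triangle x y z) _.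
by rewrite (lt_le_trans _ h)// ltrD2l.
Qed.

Lemma open_measurable_Borel (d : measure_display) (X : measurableMetricType d R)
  (U : set X) : is_Borel X -> open U -> measurable U.
Proof. by move=> -> oU; exact: sub_sigma_algebra. Qed.

Lemma measurable_mball (d : measure_display) (X : measurableMetricType d R)
  (x : X) (r : R) : is_Borel X -> measurable (ball x r).
Proof. by move=> hB; apply: open_measurable_Borel => //; exact: open_mball. Qed.

End metric_balls.

Section cubes.
Context {R : realType} {d : measure_display} {X : measurableMetricType d R}.
Variable mu : {measure set X -> \bar R}.
Variables (Cd delta : R) (S : dyadic_system X delta Cd).
Hypotheses (hB : is_Borel X) (hfin : finite_on_bounded mu) (Cd0 : 0 < Cd).
Let A := dyadic_cubes S.
Let N := (dy_number S).+1.

Lemma cube_measurable Q : A Q -> measurable Q.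
Proof. by move=> [m [k [j [Sj ->]]]]; exact: dy_measurable. Qed.

Lemma cube_finite Q : A Q -> (mu Q < +oo)%E.
Proof.
move=> AQ; have mQ := cube_measurable AQ.
case: AQ => [m [k [j [Sj QE]]]].
apply: le_lt_trans (hfin (dy_center S m k j) (48 * delta ^ k)).
apply: le_mu => //; first exact: measurable_mball.
by rewrite QE; exact: dy_sub_ball.
Qed.

(** The label of a cube is one of the filtrations it belongs to.  There is one more
    label than filtrations, so that indices outside [J] have one as well. *)
Lemma cube_filtration (J : set nat) (D : nat -> set X) :
  (forall j, J j -> A (D j)) -> exists kind : nat -> 'I_N,
  forall i j, J i -> J j -> kind i = kind j ->
    D i `&` D j !=set0 -> D i `<=` D j \/ D j `<=` D i.
Proof.
move=> AD.
have /choice[kind hk] : forall j, exists k : 'I_N, J j ->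
    exists m n i, [/\ dy_Sigma S n i, D j = dy_cube S m n i &
      k = widen_ord (leqnSn _) m].
  move=> j; have [Jj|nJ] := pselect (J j); last by exists ord0.
  have [m [n [i [Si DE]]]] := AD _ Jj.
  by exists (widen_ord (leqnSn _) m) => _; exists m, n, i.
exists kind => i j Ji Jj ke ne.
have [m [n [a [Sa Da ka]]]] := hk _ Ji.
have [m' [n' [a' [Sa' Da' ka']]]] := hk _ Jj.
have mm : m' = m.
  by apply/val_inj; move: ke; rewrite ka ka' => /(congr1 val).
subst m'; move: ne; rewrite Da Da' => /set0P ne.
have [le|/ltW le] := leP n n'.
  by have [|h] := dy_nested m Sa' Sa le; [right|move: ne; rewrite setIC h eqxx].
by have [|h] := dy_nested m Sa Sa' le; [left|move: ne; rewrite h eqxx].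
Qed.

(** Two maximal cubes of the same filtration that meet are nested, hence equal by
    maximality; so distinct maximal cubes through a point have distinct labels. *)
Lemma maximal_cubes_overlap (Omega : set X) (J : set nat) (Q : nat -> set X) :
  set_bij J (maximal_cubes A Omega) Q ->
  forall (s : seq nat) (x : X), uniq s ->
    (forall j, j \in s -> J j /\ Q j x) -> (size s <= N)%N.
Proof.
move=> [QA Qinj _] s x us sJ.
have AQ j : J j -> A (Q j) by move=> Jj; have [] := QA _ Jj.
have [kind hk] := cube_filtration AQ.
have <- : size [seq kind j | j <- s] = size s by rewrite size_map.
rewrite -[X in (_ <= X)%N](card_ord N).
have /card_uniqP <- : uniq [seq kind j | j <- s]; last exact: max_card.
rewrite map_inj_in_uniq// => i j is_ js ke.
have [Ji Qix] := sJ _ is_; have [Jj Qjx] := sJ _ js.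
have [_ Qi maxi] := QA _ Ji.
have [_ Qj maxj] := QA _ Jj.
apply: Qinj; rewrite ?inE//.
have [|ij|ji] := hk _ _ Ji Jj ke; first by exists x.
  by apply/esym/maxi => //; exact: AQ.
by apply: maxj => //; exact: AQ.
Qed.

(** The hypothesis on [m = 0] is where the conventions on the inverse of 0 matter. *)
Lemma average_le_measure (m I : \bar R) (t : R) : (0 <= m)%E -> (m < +oo)%E ->
  (0 <= I)%E -> (m = 0 -> I = 0)%E -> (m^-1 * I <= t%:E)%E -> (I <= t%:E * m)%E.
Proof.
case: m => [m| |]//; rewrite lee_fin => m0 _ I0 mI.
have [m00|mN0] := eqVneq m 0; first by move=> _; rewrite (mI (congr1 EFin m00)) m00 mule0.
have mp : 0 < m by rewrite lt_neqAle eq_sym mN0.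
by rewrite inver (negbTE mN0) muleC lee_pdivrMr.
Qed.

(** A point of [Rc] outside the level set bounds the average of [f] relative to
    [2 * Cd] times the doubling ball, and the doubling condition compares that
    measure to the measure of [Rc].  If [Rc] is the whole space, the bound is the
    hypothesis on [t]. *)
Lemma doubling_average f (t alpha beta : R) (Rc : set X) :
  2 * Cd <= alpha -> 0 <= t -> 1 <= beta -> cLp mu 1%:E f ->
  (cLnorm mu 1%:E f / mu setT < t%:E)%E ->
  doubling_cube mu Cd A alpha beta Rc ->
  Rc = setT \/ ~ (Rc `<=` level_set mu Cd A f t) ->
  (absintegral mu Rc f <= (t * beta)%:E * mu Rc)%E.
Proof.
move=> hal t0 hbe /cLp1P[mf fi] ft [ARc [B [BR RB] dB]] hR.
have mRc := cube_measurable ARc.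
case: hR => [RT|/existsNP[x /not_implyP[Rx /negP]]].
  move: ft; rewrite cLnorm1E -RT => /ltW ft.
  apply: (@le_trans _ _ (t%:E * mu Rc)%E); last first.
    by rewrite lee_wpmul2r// lee_fin ler_peMr.
  apply: average_le_measure; rewrite ?(cube_finite ARc)//.
  - exact: absintegral_ge0.
  - move=> m0; exact: absintegral_null.
  - by rewrite muleC.
rewrite -leNgt => Mx.
have m2 : measurable (dilate (2 * Cd) B) by exact: measurable_mball.
have R2 : Rc `<=` dilate (2 * Cd) B.
  apply: (subset_trans RB); apply: subset_mball.
  rewrite mdistxx add0r ler_pM2r ?bradius_gt0//.
  by rewrite ler_peMl ?ltW // ?ltr1n.
apply: (@le_trans _ _ (t%:E * mu (dilate (2 * Cd) B))%E).
  apply: average_le_measure => //.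
  - exact: hfin.
  - exact: absintegral_ge0.
  - move=> m0; apply: absintegral_null => //.
    by apply/eqP; rewrite eq_le measure_ge0 andbT -m0; exact: le_mu.
  - apply: le_trans Mx; apply: (@le_trans _ _ (ereal_sup
      [set ((mu (dilate (2 * Cd) B'))^-1 * absintegral mu Rc f)%E
       | B' in [set B' | fits Cd B' Rc]])).
      by apply: ereal_sup_ubound; exists B.
    by apply: ereal_sup_ubound; exists Rc.
rewrite EFinM -muleA lee_wpmul2l ?lee_fin//.
have ma : measurable (dilate alpha B) by exact: measurable_mball.
apply: (@le_trans _ _ (mu (dilate alpha B))).
  apply: le_mu => //; apply: subset_mball.
  by rewrite mdistxx add0r ler_pM2r ?bradius_gt0.
apply: (le_trans dB); rewrite lee_wpmul2l ?lee_fin// ?(le_trans _ hbe)//.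
by apply: le_mu => //; exact: measurable_mball.
Qed.

End cubes.

(** * Complex integrals *)

Section integrals.
Context {R : realType} {d : measure_display} {X : measurableType d}.
Variable mu : {measure set X -> \bar R}.
Implicit Types (f g : X -> R[i]) (D : set X).

Lemma cintegrableP D f : measurable D -> cmeasurable f ->
  (absintegral mu D f < +oo)%E -> cintegrable mu D f.
Proof.
move=> mD [m1 m2] fi; split; apply/integrableP; split.
- by apply: measurable_funTS; exact/measurable_EFinP.
- apply: le_lt_trans fi; apply: ge0_le_integral => //.
  + by apply: measurableT_comp => //; apply: measurable_funTS; exact/measurable_EFinP.
  + by apply: measurable_funTS; exact: measurable_Enormc.
  + by move=> x _; rewrite /= lee_fin normRe_le.
- by apply: measurable_funTS; exact/measurable_EFinP.
- apply: le_lt_trans fi; apply: ge0_le_integral => //.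
  + by apply: measurableT_comp => //; apply: measurable_funTS; exact/measurable_EFinP.
  + by apply: measurable_funTS; exact: measurable_Enormc.
  + by move=> x _; rewrite /= lee_fin normIm_le.
Qed.

(** The factor 2 comes from bounding real and imaginary parts separately. *)
Lemma normc_cintegral D f : measurable D -> cmeasurable f ->
  (absintegral mu D f < +oo)%E ->
  normc (cintegral mu D f) <= 2 * fine (absintegral mu D f).
Proof.
move=> mD mf fi; have [i1 i2] := cintegrableP mD mf fi.
apply: le_trans (normc_le _) _; rewrite mulr_natl mulr2n.
have mN : measurable_fun D (fun x => (normc (f x))%:E).
  by apply: measurable_funTS; exact: measurable_Enormc.
have fin : absintegral mu D f \is a fin_num.
  by rewrite ge0_fin_numE// absintegral_ge0.
apply: lerD => /=; apply: (le_trans (le_normr_Rintegral _ _)) => //;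
  rewrite /Rintegral -lee_fin fineK//.
- rewrite fineK//; apply: ge0_le_integral => //.
    by apply/measurable_EFinP; apply: measurableT_comp => //; apply: measurable_funTS; have [] := mf.
  by move=> x _; rewrite lee_fin normRe_le.
- rewrite ge0_fin_numE; last exact: integral_ge0.
  by have /integrableP[_] := i1.
- rewrite fineK//; apply: ge0_le_integral => //.
    by apply/measurable_EFinP; apply: measurableT_comp => //; apply: measurable_funTS; have [] := mf.
  by move=> x _; rewrite lee_fin normIm_le.
- rewrite ge0_fin_numE; last exact: integral_ge0.
  by have /integrableP[_] := i2.
Qed.

Lemma cLnorm_oo_le f (M : \bar R) : (0 <= M)%E ->
  (forall x, ((normc (f x))%:E <= M)%E) -> (cLnorm mu +oo f <= M)%E.
Proof.
move=> M0 h; rewrite /cLnorm unlock; case: ifPn => // _.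
apply/ess_supP; apply: aeW => x /=.
by rewrite ger0_norm ?normc_ge0.
Qed.

Lemma absintegral_indic (c : R[i]) (E : set X) : measurable E ->
  absintegral mu setT (fun x => c * ((\1_E x : R)%:C)) = ((normc c)%:E * mu E)%E.
Proof.
move=> mE; rewrite absintegralZ//; last first.
  by apply: cmeasurable_real; exact: measurable_indic.
congr (_ * _)%E; rewrite /absintegral.
under eq_integral do rewrite normc_real ger0_norm//.
by rewrite integral_indic// setIT.
Qed.

Lemma cintegral_indic (c : R[i]) (E : set X) : measurable E -> (mu E < +oo)%E ->
  cintegral mu setT (fun x => c * ((\1_E x : R)%:C)) = c * (fine (mu E))%:C.
Proof.
move=> mE fE.
have i1 : mu.-integrable setT (EFin \o (\1_E : X -> R)).
  apply/integrableP; split; first by apply/measurable_EFinP; exact: measurable_indic.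
  under eq_integral do rewrite /= ger0_norm//.
  by rewrite integral_indic// setIT.
rewrite /cintegral; under eq_Rintegral do rewrite ReMr.
under [X in _ +i* X]eq_Rintegral do rewrite ImMr.
rewrite !RintegralZl//.
have -> : \int[mu]_(x in setT) (\1_E x : R) = fine (mu E).
  by rewrite /Rintegral integral_indic// setIT.
by case: c => a b; rewrite /GRing.mul/= !mulr0 subr0 add0r.
Qed.

(** Integrating the overlap bound on the indicators against [g]. *)
Lemma overlap_integral (s : seq nat) (E : nat -> set X) D (g : X -> R) (n : R) :
  measurable D -> measurable_fun setT g -> (forall x, 0 <= g x) -> 0 <= n ->
  (forall i, i \in s -> measurable (E i) /\ E i `<=` D) ->
  (forall x, \sum_(i <- s) (\1_(E i) x : R) <= n) ->
  (\sum_(i <- s) \int[mu]_(x in E i) (g x)%:E <=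
   n%:E * \int[mu]_(x in D) (g x)%:E)%E.
Proof.
move=> mD mg g0 n0 sE sn.
have mgD : measurable_fun D (fun x => (g x)%:E).
  by apply/measurable_EFinP; exact: measurable_funTS.
rewrite big_seq (eq_bigr (fun i => \int[mu]_(x in D)
    (g x * \1_(if i \in s then E i else set0) x)%:E)%E); last first.
  move=> i si; have [mE ED] := sE _ si; rewrite si -[in LHS](setIidr ED) integral_mkcondr.
  apply: eq_integral => x _; rewrite /patch indicE.
  by case: ifP => _; rewrite ?mulr1 ?mulr0.
have mE i : measurable (if i \in s then E i else set0).
  by case: ifPn => // /sE[].
rewrite -big_seq -ge0_integral_sum//; last 2 first.
- move=> i; apply/measurable_EFinP; apply: measurable_funTS.
  by apply: measurable_funM => //; exact: measurable_indic.
- by move=> i x _; rewrite lee_fin mulr_ge0.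
rewrite -ge0_integralZl_EFin//; last by move=> x _; rewrite lee_fin.
apply: ge0_le_integral => //.
- by move=> x _; rewrite sume_ge0// => i _; rewrite lee_fin mulr_ge0.
- apply: emeasurable_sum => i; apply/measurable_EFinP; apply: measurable_funTS.
  by apply: measurable_funM => //; exact: measurable_indic.
- by apply: measurable_funeM.
move=> x _; rewrite sumEFin lee_fin -mulr_sumr mulrC ler_wpM2r//.
apply: le_trans (sn x); rewrite big_seq [leRHS]big_seq.
by apply: ler_sum => i ->.
Qed.

End integrals.

(** * The functions phi_j *)

Section decomposition.
Context {R : realType} {d : measure_display} {X : measurableMetricType d R}.
Variable mu : {measure set X -> \bar R}.
Variables (Cd delta : R) (S : dyadic_system X delta Cd).
Hypotheses (hB : is_Borel X) (hfin : finite_on_bounded mu) (Cd0 : 0 < Cd).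
Let A := dyadic_cubes S.
Let N := (dy_number S).+1.
Variables (alpha beta : R).
Hypotheses (hal : 2 * Cd <= alpha) (hbe : 1 <= beta).
Variables (f : X -> R[i]) (t : R).
Hypotheses (fL1 : cLp mu 1%:E f) (ft : (cLnorm mu 1%:E f / mu setT < t%:E)%E).
Variables (J : set nat) (Q : nat -> set X).
Hypothesis Qbij : set_bij J (maximal_cubes A (level_set mu Cd A f t)) Q.
Variable B : nat -> mball X.
Hypothesis BQ : forall j, J j -> fits Cd (B j) (Q j).
Variable Rc : nat -> set X.
Hypothesis RcP : forall j, J j -> [/\ doubling_cube mu Cd A alpha beta (Rc j),
   dilate (3 * Cd) (B j) `<=` Rc j & Rc j = Q j -> Rc j = setT].

Let mf : cmeasurable f. Proof. by have /cLp1P[] := fL1. Qed.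

Let AQ j : J j -> A (Q j).
Proof. by move=> Jj; have [QA _ _] := Qbij; have [] := QA _ Jj. Qed.

Let ARc j : J j -> A (Rc j).
Proof. by move=> /RcP[[]]. Qed.

Let mQ j : J j -> measurable (Q j).
Proof. by move=> /AQ; exact: cube_measurable. Qed.

Let mRc j : J j -> measurable (Rc j).
Proof. by move=> /ARc; exact: cube_measurable. Qed.

Let fRc j : J j -> (mu (Rc j) < +oo)%E.
Proof. by move=> /ARc; exact: cube_finite. Qed.

Let t0 : 0 < t.
Proof.
rewrite -lte_fin; apply: le_lt_trans ft.
by rewrite mule_ge0 ?inve_ge0// cLnorm1E absintegral_ge0.
Qed.

Let QRc j : J j -> Q j `<=` Rc j.
Proof.
move=> Jj; have [_ h _] := RcP Jj; apply: subset_trans h.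
have [_ h] := BQ Jj; apply: subset_trans h _; apply: subset_mball.
by rewrite mdistxx add0r ler_pM2r ?bradius_gt0// ler_peMl ?ltW// ltr1n.
Qed.

Let overlap := maximal_cubes_overlap Qbij.

(** A cube containing [Q j] strictly is not contained in the level set, by maximality;
    otherwise [Rc j] is [Q j], hence the whole space. *)
Let Rc_average j : J j ->
  (absintegral mu (Rc j) f <= (t * beta)%:E * mu (Rc j))%E.
Proof.
move=> Jj; have [dR _ RQ] := RcP Jj.
apply: (doubling_average hB hfin Cd0 hal (ltW t0) hbe fL1 ft dR).
have [QA _ _] := Qbij; have [_ Qlev maxQ] := QA _ Jj.
have [lev|] := pselect (Rc j `<=` level_set mu Cd A f t); last by right.
by left; apply: RQ; apply: maxQ => //; [exact: ARc|exact: QRc].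
Qed.

Let mass D := fine (absintegral mu D f).

Let massE D : measurable D -> (mass D)%:E = absintegral mu D f.
Proof.
move=> mD; rewrite /mass fineK// ge0_fin_numE ?absintegral_ge0//.
have /cLp1P[_] := fL1; apply: le_lt_trans; exact: le_absintegral.
Qed.

Let mass_ge0 D : 0 <= mass D.
Proof. by rewrite fine_ge0// absintegral_ge0. Qed.

(** Carleson condition: the maximal cubes inside [Rc j] overlap at most [N] times, and
    the mean of [normc f] over [Rc j] is at most [t * beta]. *)
Let packing (kind : nat -> 'I_N) j : J j ->
  (\esum_(i in [set i | [/\ J i, kind i = kind j & Rc i `<=` Rc j]])
     (4 * mass (Q i))%:E <= (4 * (N%:R * (t * beta)))%:E * mu (Rc j))%E.
Proof.
move=> Jj; apply: ge_ereal_sup => _ [F [fF FJ] <-].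
rewrite fsbig_finite//=; set s := finmap.enum_fset (fset_set F).
have sP i : i \in s -> J i /\ Rc i `<=` Rc j.
  by move=> si; have /FJ[] : F i by apply/set_mem; rewrite -in_fset_set.
under eq_bigr do rewrite EFinM.
rewrite -ge0_sume_distrr; last by move=> i _; rewrite lee_fin.
rewrite [in leRHS]EFinM -muleA; apply: lee_wpmul2l => //.
rewrite (eq_big_seq (fun i => absintegral mu (Q i) f)); last first.
  by move=> i /sP[Ji _]; rewrite massE//; exact: mQ.
apply: (@le_trans _ _ (N%:R%:E * absintegral mu (Rc j) f))%E.
  apply: overlap_integral.
  - exact: mRc.
  - exact: measurable_normc.
  - by move=> x; exact: normc_ge0.
  - by [].
  - move=> i /sP[Ji ij]; split; first exact: mQ.
    exact: subset_trans (QRc Ji) ij.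
  - move=> x; apply: (overlap_sum overlap); first exact: finmap.fset_uniq.
    by move=> i /sP[].
by rewrite EFinM -muleA lee_wpmul2l// ?lee_fin//; exact: Rc_average.
Qed.

Let cut j := cutoff J Q f j.

Let mweight j : J j -> measurable_fun setT (weight J Q j : X -> R).
Proof.
move=> Jj; rewrite /weight; apply: measurable_funM; first exact: measurable_indic (mQ Jj).
rewrite (_ : (fun x => _) = (fun r : R => r `^ (-1)) \o
  (fun x => \sum_(k \in J) (\1_(Q k) x : R))); last first.
  apply/funext => x /=; rewrite powR_inv1// fsumr_ge0//.
apply: measurableT_comp; first exact: measurable_powR.
apply/measurable_EFinP.
rewrite (_ : _ \o _ = (fun x => (\sum_(0 <= k <oo | k \in J) (\1_(Q k) x : R)%:E)%E)).
  apply: ge0_emeasurable_sum => [k x _ _|k]; first by rewrite lee_fin.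
  move=> /set_mem Jk; apply/measurable_EFinP; exact: measurable_indic (mQ Jk).
apply/funext => x /=; rewrite nneseries_esum; last by move=> k _; rewrite lee_fin.
rewrite -(multiplicity_esum overlap x); congr (esum _ _).
by apply/seteqP; split=> k /=; [move/mem_set|move/set_mem].
Qed.

Let mcut j : J j -> cmeasurable (cut j).
Proof.
by move=> Jj; apply: cmeasurableM => //; apply: cmeasurable_real; exact: mweight.
Qed.

Let cut_le j x : J j -> normc (cut j x) <= normc (f x).
Proof.
move=> Jj; rewrite /cut /cutoff normcM normc_real ger0_norm ?(weight_ge0 overlap)//.
by rewrite ler_piMr ?normc_ge0// (weight_le1 overlap).
Qed.

Let abs_cut_le j : J j ->
  (absintegral mu (Q j) (cut j) <= absintegral mu (Q j) f)%E.
Proof.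
move=> Jj; apply: ge0_le_integral; first exact: mQ.
- by move=> x _; rewrite lee_fin normc_ge0.
- by apply: measurable_funTS; apply: measurable_Enormc; exact: mcut.
- by apply: measurable_funTS; exact: measurable_Enormc.
by move=> x _; rewrite lee_fin cut_le.
Qed.

Let abs_cut_ge j : J j ->
  (absintegral mu (Q j) f <= N%:R%:E * absintegral mu (Q j) (cut j))%E.
Proof.
move=> Jj; rewrite /absintegral -ge0_integralZl_EFin//; first last.
- by apply: measurable_funTS; apply: measurable_Enormc; exact: mcut.
- by move=> x _; rewrite lee_fin normc_ge0.
- exact: mQ.
apply: ge0_le_integral; first exact: mQ.
- by move=> x _; rewrite lee_fin normc_ge0.
- by apply: measurable_funTS; exact: measurable_Enormc.
- apply: measurable_funeM; apply: measurable_funTS.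
  by apply: measurable_Enormc; exact: mcut.
move=> x Qx; rewrite -EFinM lee_fin /cut /cutoff normcM normc_real.
rewrite ger0_norm ?(weight_ge0 overlap)// mulrCA ler_peMr ?normc_ge0//.
by apply: (@weight_ge R _ N J Q overlap).
Qed.

Let c j := cintegral mu (Q j) (cut j).

Let cE j : J j -> normc (c j) <= 2 * mass (Q j).
Proof.
move=> Jj; have cut_fin : (absintegral mu (Q j) (cut j) < +oo)%E.
  apply: le_lt_trans (abs_cut_le Jj) _.
  by rewrite -massE ?ltry//; exact: mQ.
apply: le_trans (normc_cintegral _ _ cut_fin) _; [exact: mQ|exact: mcut|].
rewrite ler_pM2l// /mass fine_le//; last exact: abs_cut_le.
- by rewrite ge0_fin_numE// absintegral_ge0.
- by rewrite -massE//; exact: mQ.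
Qed.

Let Q_null j : J j -> mu (Rc j) = 0%E -> mass (Q j) = 0.
Proof.
move=> Jj R0; rewrite /mass absintegral_null//; first exact: mQ.
apply/eqP; rewrite eq_le measure_ge0 andbT -R0.
by apply: le_mu; [exact: mQ|exact: mRc|exact: QRc].
Qed.

(** [phi j] is constant on the set [E j] given by [carleson_selection] for the
    masses [4 * mass (Q j)] and the sets [Rc j].  The factor 4 accounts for the real and
    imaginary parts of the mean (2) and for [mu (Rc j) <= 2 * mu (E j)] (2). *)
Lemma cz_functions : exists phi : nat -> X -> R[i],
   [/\ (forall j, J j -> cmeasurable (phi j) /\
          (cLnorm mu +oo (phi j) <=
             4%:E * ((mu (Rc j))^-1 * absintegral mu (Q j) f))%E),
       ({ae mu, forall x, csummable J (fun j => phi j x)} /\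
        (cLnorm mu +oo (fun x => csum J (fun j => phi j x)) <=
           (16 * N%:R ^+ 2 * beta * t)%:E)%E),
       (forall j, J j ->
          [/\ forall x, ~ Rc j x -> phi j x = 0,
              cintegrable mu setT (phi j),
              cintegral mu setT (phi j) = cintegral mu (Q j) (cutoff J Q f j),
              (absintegral mu (Q j) (cutoff J Q f j) <=
                 absintegral mu (Q j) f)%E
            & (absintegral mu (Q j) f <=
                 N%:R%:E * absintegral mu (Q j) (cutoff J Q f j))%E])
     & {ae mu, forall x,
          csummable J (fun j => cutoff J Q f j x - phi j x) /\
          f x = good_part J Q f phi x + bad_part J Q f phi x}].
Proof.
have [kind hk] := cube_filtration ARc.
have L0 : 0 < 4 * (N%:R * (t * beta)) :> R.
  by rewrite !mulr_gt0// (lt_le_trans _ hbe).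
have [E [EP Esum]] := carleson_selection L0 mRc fRc
  (fun j => mulr_ge0 (ler0n R 4) (mass_ge0 (Q j))) hk (packing kind).
have Efin j : J j -> (mu (E j) < +oo)%E.
  move=> Jj; have [mE ER _] := EP _ Jj.
  by apply: le_lt_trans (fRc Jj); apply: le_mu => //; exact: mRc.
pose k j := c j * ((fine (mu (E j)))^-1)%:C.
pose phi j x := k j * ((\1_(E j) x : R)%:C).
have kE j : J j -> normc (k j) <= 4 * mass (Q j) / fine (mu (Rc j)).
  move=> Jj; rewrite /k normcM normc_real ger0_norm ?invr_ge0 ?fine_ge0//.
  have [mE ER ERm] := EP _ Jj.
  have [R0|R0] := eqVneq (mu (Rc j)) 0%E.
    rewrite R0 invr0 mulr0; have := cE Jj.
    rewrite (Q_null Jj R0) mulr0 => h.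
    have -> : normc (c j) = 0 by apply/eqP; rewrite eq_le h normc_ge0.
    by rewrite mul0r.
  have Rp : 0 < fine (mu (Rc j)).
    by rewrite fine_gt0// fRc// andbT lt_neqAle eq_sym R0/=.
  have RE : fine (mu (Rc j)) <= 2 * fine (mu (E j)).
    rewrite -lee_fin EFinM !fineK// ge0_fin_numE//; [exact: Efin|exact: fRc].
  have Ep : 0 < fine (mu (E j)) by lra.
  apply: (@le_trans _ _ (2 * mass (Q j) * (2 / fine (mu (Rc j))))); last first.
    by rewrite mulrACA -natrM mulrA.
  apply: ler_pM; [exact: normc_ge0|by rewrite invr_ge0 ltW|exact: cE|].
  by rewrite ler_pdivlMr// ler_pdivrMl// mulrC.
have phi_le j x : J j -> normc (phi j x) <= 4 * mass (Q j) / fine (mu (Rc j)) * \1_(E j) x.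
  move=> Jj; rewrite /phi normcM normc_real ger0_norm// ler_wpM2r//.
  exact: kE.
have phi_sum x : (\esum_(j in J) (normc (phi j x))%:E <=
    (N%:R * (2 * (4 * (N%:R * (t * beta)))))%:E)%E.
  apply: le_trans (Esum x).
  rewrite [leRHS](_ : _ = \esum_(j in J `&` [set j | E j x])
      (4 * mass (Q j) / fine (mu (Rc j)))%:E)%E; last by congr (esum _ _); apply/seteqP.
  rewrite esum_mkcondr; apply: le_esum => j Jj.
  have := phi_le j x Jj; rewrite indicE; case: ifPn => h.
    by rewrite mem_set ?mulr1; [rewrite lee_fin|move/set_mem: h].
  rewrite memNset ?mulr0; last by move=> Ex; move: h; rewrite notin_setE.
  by rewrite lee_fin.
have mphi j : J j -> cmeasurable (phi j).
  move=> Jj; apply: cmeasurableM; first exact: cmeasurable_cst.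
  apply: cmeasurable_real; apply: measurable_indic.
  by have [] := EP _ Jj.
exists phi; split.
- move=> j Jj; split; first exact: mphi.
  apply: cLnorm_oo_le.
    by rewrite !mule_ge0// ?inve_ge0// absintegral_ge0.
  move=> x; rewrite -massE; last exact: mQ.
  have [R0|R0] := eqVneq (mu (Rc j)) 0%E.
    rewrite (Q_null Jj R0) mule0 mule0; have := phi_le j x Jj.
    by rewrite (Q_null Jj R0) mulr0 !mul0r lee_fin.
  have fE : mu (Rc j) = (fine (mu (Rc j)))%:E.
    by rewrite fineK// ge0_fin_numE//; exact: fRc.
  rewrite fE inver; case: ifPn => [/eqP h|_]; first by rewrite fE h eqxx in R0.
  rewrite -!EFinM lee_fin; apply: le_trans (phi_le j x Jj) _.
  rewrite [in leRHS](mulrC _^-1) mulrA ler_piMr//.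
  by rewrite divr_ge0 ?mulr_ge0// fine_ge0.
- split; first by apply: aeW => x; have [] := csummable_le (phi_sum x).
  apply: cLnorm_oo_le; first by rewrite lee_fin !mulr_ge0 ?ltW// (lt_le_trans _ hbe).
  move=> x; rewrite lee_fin; have [_ _ _ h] := csummable_le (phi_sum x).
  apply: (le_trans h); rewrite le_eqVlt; apply/orP; left; apply/eqP; ring.
- move=> j Jj; have [mE ER ERm] := EP _ Jj; split.
  + move=> x nR; rewrite /phi indicE memNset ?mulr0// => Ex.
    by apply: nR; exact: ER.
  + apply: cintegrableP => //; first exact: mphi.
    rewrite absintegral_indic// lte_mul_pinfty ?lee_fin ?normc_ge0//.
    exact: Efin.
  + rewrite cintegral_indic//; last exact: Efin.
    rewrite /k -mulrA -[RHS]mulr1 -/(cut j) -/(c j).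
    have [E0|E0] := eqVneq (fine (mu (E j))) 0; last first.
      by rewrite -rmorphM/= mulVf.
    (* a null E j makes Rc j null, hence the prescribed mean is 0 *)
    have c0 : c j = 0.
      apply: eq0_normc; apply/eqP; rewrite eq_le normc_ge0 andbT.
      apply: le_trans (cE Jj) _; rewrite Q_null ?mulr0//.
      apply/eqP; rewrite eq_le measure_ge0 andbT.
      apply: le_trans ERm _; rewrite -(@fineK _ (mu (E j))) ?E0 ?mule0//.
      by rewrite ge0_fin_numE//; exact: Efin.
    by rewrite c0 !mul0r.
  + exact: abs_cut_le.
  + exact: abs_cut_ge.
- apply: aeW => x.
  have [sphi _ _ _] := csummable_le (phi_sum x).
  have scut : csummable J (fun j => cutoff J Q f j x).
    have [|//] := @csummable_le _ J (fun j => cut j x) (normc (f x) * N%:R).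
    apply: ge_ereal_sup => _ [F [fF FJ] <-].
    rewrite fsbig_finite//= sumEFin lee_fin.
    have Fs i : i \in finmap.enum_fset (fset_set F) -> J i.
      by move=> si; apply/FJ/set_mem; rewrite -in_fset_set.
    apply: (@le_trans _ _ (\sum_(i <- finmap.enum_fset (fset_set F)) normc (f x) * (\1_(Q i) x : R))%R).
      rewrite big_seq [leRHS]big_seq; apply: ler_sum => i /Fs Ji.
      rewrite /cut /cutoff normcM normc_real ger0_norm ?(weight_ge0 overlap)//.
      rewrite ler_wpM2l ?normc_ge0// indicE.
      have [Qx|nQ] := pselect (Q i x); last by rewrite (@weight_out R X J Q i x nQ).
      by rewrite mem_set// (weight_le1 overlap).
    rewrite -mulr_sumr ler_wpM2l ?normc_ge0//.
    by apply: (overlap_sum overlap) => //; exact: finmap.fset_uniq.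
  have [sb bE] := csummableD scut (csummableN sphi).
  split=> //.
  have [_ sE] := csummableD sphi sb.
  rewrite /good_part /bad_part -addrA -sE.
  have -> : (fun j => phi j x + (cutoff J Q f j x - phi j x)) = (fun j => cutoff J Q f j x).
    by apply/funext => j; rewrite addrC subrK.
  have [n0 wn0] := @weight_sum R X N J Q overlap x.
  have -> : csum J (fun j => cutoff J Q f j x) =
      f x * ((\1_(\bigcup_(j in J) Q j) x : R)%:C).
    apply/eqP; rewrite eq_complex ReMr ImMr /csum /=; apply/andP; split; apply/eqP.
    - apply: lim_near_cst => //; exists n0 => // n /= hn.
      rewrite -(wn0 n hn) mulr_sumr; apply: eq_bigr => j _.
      by rewrite /cutoff ReMr.
    - apply: lim_near_cst => //; exists n0 => // n /= hn.
      rewrite -(wn0 n hn) mulr_sumr; apply: eq_bigr => j _.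
      by rewrite /cutoff ImMr.
  rewrite -mulrDr -rmorphD/= !indicE in_setC.
  by case: (x \in _); rewrite /= ?addr0 ?add0r rmorph1 mulr1.
Qed.

End decomposition.

(** * Outer regularity on bounded sets *)

Section exhaustion.
Context {R : realType} {d : measure_display} {X : measurableType d}.
Variable mu : {measure set X -> \bar R}.

(** Continuity of the measure from above. *)
Lemma measure_shrink (F : nat -> set X) (e : R) : (0 < e) ->
  (forall n, measurable (F n)) -> nonincreasing_seq F -> (mu (F 0%N) < +oo)%E ->
  \bigcap_n F n = set0 -> exists n, (mu (F n) <= e%:E)%E.
Proof.
move=> e0 mF ndF fF F0.
have := @nonincreasing_cvg_mu _ _ _ mu F fF mF.
rewrite F0 measure0 => /(_ measurable0 ndF) /fine_cvgP[fin cv].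
have cve : \forall n \near \oo, (fine \o (mu \o F)) n <= e by exact: (cvgr_le _ cv).
have /filter_ex[n [fn hn]] : \forall n \near \oo, mu (F n) \is a fin_num /\
    fine (mu (F n)) <= e.
  by near=> n; split; near: n.
by exists n; rewrite -(fineK fn) lee_fin.
Unshelve. all: by end_near. Qed.

Lemma measure_exhaust (F : set X) (G : nat -> set X) (e : R) : 0 < e ->
  measurable F -> (mu F < +oo)%E -> (forall n, measurable (G n)) ->
  F `<=` \bigcup_n G n ->
  exists N, (mu (F `\` \bigcup_(n < N) G n) <= e%:E)%E.
Proof.
move=> e0 mF fF mG FG.
have mU N : measurable (F `\` \bigcup_(n < N) G n).
  by apply: measurableD => //; exact: bigcup_measurable.
apply: measure_shrink => //.
- move=> n m nm; apply/subsetPset => x [Fx h]; split=> // -[k /= kn Gx].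
  by apply: h; exists k => //=; exact: leq_trans kn nm.
- by apply: le_lt_trans fF; apply: le_mu => // x [].
- apply/seteqP; split=> // x h; have [Fx _] := h 0%N I.
  have [k _ Gx] := FG x Fx; have [_] := h k.+1 I.
  by apply; exists k => /=.
Qed.

Lemma measure_bigsetU_le (s : seq nat) (F : nat -> set X) :
  (forall i, measurable (F i)) ->
  (mu (\big[setU/set0]_(i <- s) F i) <= \sum_(i <- s) mu (F i))%E.
Proof.
move=> mF; elim: s => [|i s IH]; first by rewrite !big_nil measure0.
rewrite !big_cons; apply: le_trans (measureU2 _ _ _) _ => //.
  exact: bigsetU_measurable.
exact: leeD.
Qed.

Lemma disjoint_indic_sum (s : seq nat) (F : nat -> set X) x : uniq s ->
  (forall i j, i \in s -> j \in s -> i != j -> F i `&` F j = set0) ->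
  \sum_(i <- s) (\1_(F i) x : R) <= 1.
Proof.
move=> us dF; have [[i is_ Fi]|h] := pselect (exists2 i, i \in s & F i x).
  rewrite (bigD1_seq i)//= big_seq_cond big1 ?addr0.
    by rewrite indicE lern1 leq_b1.
  move=> j /andP[js ji]; rewrite indicE memNset// => Fj.
  have := dF _ _ js is_ ji; rewrite -subset0 => /(_ x); exact.
rewrite big_seq big1// => i is_; rewrite indicE memNset// => Fi.
by apply: h; exists i.
Qed.

End exhaustion.

Section outer_regularity.
Context {R : realType} {d : measure_display} {X : measurableMetricType d R}.
Variable mu : {measure set X -> \bar R}.
Hypotheses (hB : is_Borel X) (hfin : finite_on_bounded mu).
Variables (x0 : X) (r0 : R).
Let B0 := ball x0 r0.

Let mB0 : measurable B0. Proof. exact: measurable_mball. Qed.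

(** Approximation from outside by open sets, up to a small measure inside the ball
    [B0], where the measure is finite. *)
Let approx (A : set X) := forall e : R, 0 < e ->
  exists V, [/\ open V, A `<=` V & (mu ((V `\` A) `&` B0) <= e%:E)%E].

Let fI (A : set X) : measurable A -> (mu (A `&` B0) < +oo)%E.
Proof.
move=> mA; apply: le_lt_trans (hfin x0 r0).
by apply: le_mu => //; exact: measurableI.
Qed.

(** The open set [V n] is the union of the balls of radius [n.+1%:R^-1] centred in the
    closed set; their intersection is this set. *)
Let approx_openC U : open U -> approx (~` U).
Proof.
move=> oU e e0; pose V n := \bigcup_(y in ~` U) ball y (n.+1%:R^-1 : R).
have oV n : open (V n) by apply: bigcup_open => y _; exact: open_mball.
have mU : measurable U by exact: open_measurable_Borel.
have mV n : measurable (V n) by exact: open_measurable_Borel.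
have [||||n hn] := @measure_shrink _ _ _ mu (fun n => (V n `\` ~` U) `&` B0) e e0.
- by move=> n; apply: measurableI => //; apply: measurableD => //; exact: measurableC.
- move=> n m nm; apply/subsetPset => x [[[y Uy yx] Ux] Bx]; do 2!split => //.
  exists y => //; apply: le_ball yx.
  by rewrite lef_pV2 ?posrE// ler_nat.
- by apply: fI; apply: measurableD => //; exact: measurableC.
- apply/seteqP; split=> // x h.
  have [[_ nUx] _] := h 0%N I; have Ux : U x by exact: contrapT.
  move: (oU); rewrite openE => /(_ _ Ux) /nbhs_ballP[r /= rp rU].
  have [n nr] : exists n, n.+1%:R^-1 < r by have [n] := ltr_add_invr rp; rewrite add0r; exists n.
  have [[[y Uy yx] _] _] := h n I.
  by apply: Uy; apply: rU; apply: ball_sym; apply: le_ball yx; exact: ltW.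
exists (V n); split=> // y Uy; exists y => //; apply: ballxx.
by rewrite invr_gt0.
Qed.

Let approx_bigcup (A : nat -> set X) : (forall n, measurable (A n)) ->
  (forall n, approx (A n)) -> approx (\bigcup_n A n).
Proof.
move=> mA aA e e0.
have /choice[V hV] n : exists V, [/\ open V, A n `<=` V &
    (mu ((V `\` A n) `&` B0) <= (e / (2 ^ n.+1)%:R)%:E)%E].
  by apply: aA; rewrite divr_gt0// ltr0n expn_gt0.
have oV n : open (V n) by have [] := hV n.
have mV n : measurable (V n) by exact: open_measurable_Borel.
have mU : measurable (\bigcup_n A n) by exact: bigcup_measurable.
exists (\bigcup_n V n); split.
- exact: bigcup_open.
- by apply: subset_bigcup => n _; have [] := hV n.
apply: le_trans (epsilon_trick0 xpredT (ltW e0)).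
apply: (@le_trans _ _ (\sum_(n <oo) mu ((V n `\` A n) `&` B0))%E).
  apply: measure_sigma_subadditive.
  - by move=> n; apply: measurableI => //; exact: measurableD.
  - apply: measurableI => //; apply: measurableD => //.
    exact: bigcup_measurable.
  - move=> x [[[n _ Vx] nA] Bx]; exists n => //; do 2!split => //.
    by move=> Ax; apply: nA; exists n.
by apply: lee_nneseries => // n _; have [] := hV n.
Qed.

(** An infinite intersection of open sets need not be open, so only finitely many
    are kept; the others cost little because the union is exhausted inside [B0]. *)
Let approx_bigcupC (A : nat -> set X) : (forall n, measurable (A n)) ->
  (forall n, approx (~` A n)) -> approx (~` \bigcup_n A n).
Proof.
move=> mA aA e e0.
have e20 : 0 < e / 2 by rewrite divr_gt0.
have mU : measurable (\bigcup_n A n) by exact: bigcup_measurable.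
have [N hN] : exists N, (mu (((\bigcup_n A n) `&` B0) `\` \bigcup_(n < N) A n) <= (e / 2)%:E)%E.
  apply: measure_exhaust => //; [exact: measurableI|exact: fI].
have /choice[V hV] n : exists V, [/\ open V, ~` A n `<=` V &
    (mu ((V `\` ~` A n) `&` B0) <= (e / 2 / (2 ^ n.+1)%:R)%:E)%E].
  by apply: aA; rewrite divr_gt0// ltr0n expn_gt0.
have oV n : open (V n) by have [] := hV n.
have mV n : measurable (V n) by exact: open_measurable_Borel.
have oW : open (\bigcap_(n < N) V n).
  elim: (N) => [|k IH].
    by rewrite (_ : \bigcap_(n < 0) V n = setT); [exact: openT|apply/seteqP].
  have -> : \bigcap_(n < k.+1) V n = \bigcap_(n < k) V n `&` V k.
    apply/seteqP; split=> x.
      by move=> h; split; [move=> n /= nk; apply: h => /=; exact: ltnW|apply: h => /=].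
    move=> [h Vk] n /=; rewrite ltnS leq_eqVlt => /orP[/eqP->//|nk]; exact: h.
  exact: openI.
exists (\bigcap_(n < N) V n); split=> //.
  move=> x nA n _; have [_ + _] := hV n; apply=> Ax; apply: nA.
  by exists n.
have mVA n : measurable ((V n `\` ~` A n) `&` B0).
  by apply: measurableI => //; apply: measurableD => //; exact: measurableC.
rewrite [e]splitr EFinD.
pose D1 := ((\bigcup_n A n) `&` B0) `\` \bigcup_(n < N) A n.
pose D2 := \bigcup_n ((V n `\` ~` A n) `&` B0).
have mD1 : measurable D1.
  by apply: measurableD; [exact: measurableI|exact: bigcup_measurable].
have mD2 : measurable D2 by exact: bigcup_measurable.
apply: (@le_trans _ _ (mu (D1 `|` D2))).
  apply: le_mu.
  - apply: measurableI => //; apply: measurableD; last exact: measurableC.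
    exact: open_measurable_Borel.
  - exact: measurableU.
  - move=> x [[Vx nUx] Bx]; have Ux : (\bigcup_n A n) x by exact: contrapT.
    have [[n nN Ax]|nA] := pselect ((\bigcup_(n < N) A n) x); last by left.
    by right; exists n => //; do 2!split => //; exact: Vx.
apply: le_trans (measureU2 _ mD1 mD2) _; apply: leeD => //.
apply: le_trans (epsilon_trick0 xpredT (ltW e20)).
apply: (@le_trans _ _ (\sum_(n <oo) mu ((V n `\` ~` A n) `&` B0))%E).
  by apply: measure_sigma_subadditive.
by apply: lee_nneseries => // n _; have [] := hV n.
Qed.

(** The Borel sets [A] such that both [A] and its complement are approximated from
    outside by open sets, up to a small measure inside the fixed ball, form a
    sigma-algebra; it contains the open sets, whose complements are intersections of
    countably many open neighbourhoods. *)
Lemma outer_regular (A : set X) (e : R) : measurable A -> A `<=` B0 -> 0 < e ->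
  exists V, [/\ open V, A `<=` V & (mu V <= mu A + e%:E)%E].
Proof.
move=> mA AB e0.
pose G := [set A : set X | [/\ measurable A, approx A & approx (~` A)]].
have : <<s (@open X) >> `<=` G.
  apply: smallest_sub; last first.
    move=> U oU; split; [exact: open_measurable_Borel| |exact: approx_openC].
    move=> e' e0'; exists U; split => //.
    by rewrite setDv set0I measure0 lee_fin ltW.
  split.
  - split=> //.
      move=> e' e0'; exists set0; split; [exact: open0|by []|].
      by rewrite setDv set0I measure0 lee_fin ltW.
    rewrite setC0 => e' e0'; exists setT; split; [exact: openT|by []|].
    by rewrite setDv set0I measure0 lee_fin ltW.
  - move=> D [mD aD aDC]; rewrite setTD; split=> //; first exact: measurableC.
    by rewrite setCK.
  - move=> F hF; have mF n : measurable (F n) by have [] := hF n.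
    split; first exact: bigcup_measurable.
      by apply: approx_bigcup => // n; have [] := hF n.
    by apply: approx_bigcupC => // n; have [] := hF n.
rewrite -hB => /(_ A mA) [_ /(_ e e0)[V [oV AV VA]] _].
have mV : measurable V by exact: open_measurable_Borel.
exists (V `&` B0); split.
- by apply: openI => //; exact: open_mball.
- by move=> x Ax; split; [exact: AV|exact: AB].
apply: le_trans (leeD (lexx _) VA).
have mD : measurable ((V `\` A) `&` B0) by apply: measurableI => //; exact: measurableD.
apply: le_trans (measureU2 _ mA mD); apply: le_mu.
- exact: measurableI.
- exact: measurableU.
- move=> x [Vx Bx]; have [Ax|nA] := pselect (A x); first by left.
  by right.
Qed.

End outer_regularity.

(** * Coverings by balls *)

Section countable_nets.
Context {R : realType} {X : metricType R}.

(** Iterating the doubling property covers each ball [ball x0 n] by countably many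
    balls of radius [n / 2 ^+ k]; their centres form a dense set. *)
Lemma countable_net (x0 : X) :
  (exists N : nat, forall (x : X) (r : R), 0 < r ->
     exists c : 'I_N -> X, ball x r `<=` \bigcup_i ball (c i) (r / 2)) ->
  exists D : nat -> X, forall x (e : R), 0 < e -> exists n, ball (D n) e x.
Proof.
move=> [N HN].
have cov k (x : X) (r : R) : 0 < r -> exists2 C : set X, countable C &
    ball x r `<=` \bigcup_(c in C) ball c (r / 2 ^+ k).
  elim: k x r => [|k IH] x r r0.
    by exists [set x] => //; rewrite expr0 divr1 => y xy; exists x.
  have [c hc] := HN x r r0.
  have r20 : 0 < r / 2 by rewrite divr_gt0.
  have /choice[C hC] i : exists C : set X, countable C /\
      ball (c i) (r / 2) `<=` \bigcup_(c in C) ball c (r / 2 / 2 ^+ k).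
    by have [C cC h] := IH (c i) _ r20; exists C.
  exists (\bigcup_i C i); first by apply: bigcup_countable => // i _; have [] := hC i.
  move=> y /hc[i _ iy]; have [_ /(_ _ iy)[z Cz zy]] := hC i.
  exists z; first by exists i.
  by rewrite exprS invfM mulrA.
have /choice[C hC] (p : nat * nat) : exists C : set X, countable C /\
    ball x0 p.1.+1%:R `<=` \bigcup_(c in C) ball c (p.1.+1%:R / 2 ^+ p.2).
  by have [//|C cC h] := cov p.2 x0 p.1.+1%:R; exists C.
have cD : countable (\bigcup_p C p) by apply: bigcup_countable => // p _; have [] := hC p.
have Dd x (e : R) : 0 < e -> exists2 z, (\bigcup_p C p) z & ball z e x.
  move=> e0.
  have [n xn] : exists n, mdist x0 x < n.+1%:R.
    exists (Num.truncn (mdist x0 x)); apply: truncnS_gt.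
  have [k nk] : exists k, n.+1%:R / 2 ^+ k < e.
    have [k] := ltr_add_invr (divr_gt0 e0 (ltr0Sn R n)).
    rewrite add0r => h; exists k.+1.
    rewrite -ltr_pdivlMl// mulrC; apply: le_lt_trans h.
    rewrite lef_pV2 ?posrE ?exprn_gt0// -natrX ler_nat ltnW//.
    exact: ltn_expl.
  have [_ /(_ x)] := hC (n, k).
  move=> /(_ ltac:(exact/ballP)) [z Cz zx]; exists z; first by exists (n, k).
  by apply: le_ball zx; exact: ltW.
have /countable_injP[f finj] := cD.
have /choice[D hD] n : exists z, forall y, (\bigcup_p C p) y -> f y = n -> z = y.
  have [[y [Cy fy]]|h] := pselect (exists y, (\bigcup_p C p) y /\ f y = n).
    exists y => y' Cy' fy'; apply: finj; rewrite ?inE//; congruence.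
  by exists x0 => y Cy fy; exfalso; apply: h; exists y.
exists D => x e e0; have [z Cz zx] := Dd x e e0.
by exists (f z); rewrite (hD _ z Cz).
Qed.

(** For each point of the net and each radius [k.+1%:R^-1], one centre is chosen in
    [F] that is close to this point and whose own radius is more than four times
    larger, if any exists. *)
Lemma countable_subcover (D : nat -> X) (F : set X) (s : X -> R) :
  (forall x (e : R), 0 < e -> exists n, ball (D n) e x) ->
  (forall x, F x -> 0 < s x) -> F !=set0 ->
  exists z : nat -> X, (forall n, F (z n)) /\
    F `<=` \bigcup_n ball (z n) (s (z n) / 2).
Proof.
move=> hD s0 [x0 Fx0].
pose P (p : nat * nat) x := [/\ F x, ball (D p.1) (p.2.+1%:R^-1) x &
  p.2.+1%:R^-1 < s x / 4].
have /choice[w hw] (p : nat * nat) : exists z, F z /\ ((exists y, P p y) -> P p z).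
  have [[y Py]|h] := pselect (exists y, P p y).
    by exists y; split => //; case: Py.
  by exists x0; split => // -[y Py]; exfalso; apply: h; exists y.
exists (fun n => odflt x0 (omap w (unpickle n))); split.
  by move=> n; case: unpickle => //= p; have [] := hw p.
move=> x Fx.
have [k hk] := ltr_add_invr (divr_gt0 (s0 _ Fx) (ltr0Sn R 3)).
have [n nx] := hD x k.+1%:R^-1 ltac:(by rewrite invr_gt0).
exists (pickle (n, k)) => //; rewrite pickleK /=.
have [Fw Pw] := hw (n, k).
have [_ /ballP Dw sw] : P (n, k) (w (n, k)).
  by apply: Pw; exists x; split => //; rewrite add0r in hk.
move: Dw sw nx => /=; set e := _^-1 => Dw sw /ballP Dx; apply/ballP.
apply: le_lt_trans (metric_triangle _ (D n) _) _.
by rewrite metric_sym; lra.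
Qed.

End countable_nets.

Section vitali.
Context {R : realType} {X : metricType R}.
Variables (c : nat -> X) (r : nat -> R).

(** Greedy selection: keep the largest ball, discard those that meet it. *)
Lemma finite_vitali (l : seq nat) : (forall i, i \in l -> 0 < r i) ->
  exists D : seq nat, [/\ uniq D, {subset D <= l},
    (forall i j, i \in D -> j \in D -> i != j ->
       ball (c i) (r i) `&` ball (c j) (r j) = set0) &
    forall i, i \in l -> exists2 j, j \in D &
      r i <= r j /\ ball (c i) (r i) `&` ball (c j) (r j) !=set0].
Proof.
have [n] := ubnP (size l); elim: n l => // n IH l.
have [->|l0] := eqVneq l [::]; first by move=> _ _; exists [::]; split.
rewrite ltnS => ln lr.
have [j jl jmax] : exists2 j, j \in l & forall i, i \in l -> r i <= r j.
  elim: (l) l0 => // a l' IHl' _; have [->|l'0] := eqVneq l' [::].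
    by exists a; rewrite ?mem_head// => i; rewrite inE => /eqP ->.
  have [k kl kmax] := IHl' l'0; have [ak|/ltW ka] := leP (r a) (r k).
    exists k; first by rewrite inE kl orbT.
    by move=> i; rewrite inE => /orP[/eqP->//|/kmax].
  exists a; rewrite ?mem_head// => i; rewrite inE => /orP[/eqP->//|/kmax h].
  exact: le_trans h ka.
pose meets i := `[< ball (c i) (r i) `&` ball (c j) (r j) !=set0 >].
pose l' := [seq i <- l | ~~ meets i].
have jj : meets j.
  by apply/asboolP; exists (c j); split; apply: ballxx; exact: lr.
have l'l : (size l' < n)%N.
  apply: leq_trans ln; rewrite size_filter -(count_predC meets l) -addn1 addnC.
  by rewrite leq_add2r -has_count; apply/hasP; exists j.
have [|D [uD Dl Dd Dc]] := IH l' l'l.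
  by move=> i; rewrite mem_filter => /andP[_ /lr].
exists (j :: D); split.
- rewrite /= uD andbT; apply/negP => /Dl; rewrite mem_filter jj//.
- by move=> i; rewrite inE => /orP[/eqP->//|/Dl]; rewrite mem_filter => /andP[].
- have Dj i : i \in D -> ball (c i) (r i) `&` ball (c j) (r j) = set0.
    move=> /Dl; rewrite mem_filter => /andP[/asboolPn h _].
    by apply/seteqP; split=> // y yy; apply: h; exists y.
  move=> i k; rewrite !inE => /orP[/eqP->|iD] /orP[/eqP->|kD]; rewrite ?eqxx//.
  + by move=> _; rewrite setIC; exact: Dj.
  + by move=> _; exact: Dj.
  + exact: Dd.
- move=> i il; have [mi|mi] := boolP (meets i).
    by exists j; rewrite ?mem_head//; split; [exact: jmax|exact/asboolP].
  have [|k kD h] := Dc i; first by rewrite mem_filter mi.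
  by exists k => //; rewrite inE kD orbT.
Qed.

End vitali.

(** * Stopping balls *)

Section stopping.
Context {R : realType} {d : measure_display} {X : measurableMetricType d R}.
Variable mu : {measure set X -> \bar R}.
Hypotheses (hB : is_Borel X) (hG : geometrically_doubling X).
Hypothesis hfin : finite_on_bounded mu.
Variable h : X -> R.
Hypotheses (mh : measurable_fun setT h) (h0 : forall x, 0 <= h x).
Variable t : R.
Hypothesis t0 : 0 < t.
Let I D := (\int[mu]_(x in D) (h x)%:E)%E.
Hypothesis hI : (I setT < t%:E * mu setT)%E.

Let mb x r : measurable (ball x r : set X). Proof. exact: measurable_mball. Qed.

Let mhE D : measurable_fun D (fun x => (h x)%:E).
Proof. by apply/measurable_EFinP; exact: measurable_funTS. Qed.

Let le_I D D' : measurable D -> measurable D' -> D `<=` D' -> (I D <= I D')%E.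
Proof.
move=> mD mD' DD'; apply: ge0_subset_integral => //.
by move=> x _; rewrite lee_fin.
Qed.

Let good x r := (I (ball x r) <= t%:E * mu (ball x (4 * r)))%E.

(** The bad radii, those for which [good x r] fails, are bounded since the integral
    of [h] is less than [t * mu setT]; the stopping radius is their supremum, or, if
    there are none, a radius small enough for the ball to stay in [V]. *)
Lemma stopping_radius (V : set X) x : open V -> V x ->
  exists s, [/\ 0 < s, forall r, s < r -> good x r &
    ball x s `<=` V \/ exists r, [/\ 0 < r, s < 2 * r & ~ good x r]].
Proof.
move=> oV Vx; pose Z := [set r : R | 0 < r /\ ~ good x r].
have [[r1 [r10 br1]]|nZ] := pselect (exists r, Z r); last first.
  move: oV; rewrite openE => /(_ _ Vx) /nbhs_ballP[s /= s0 sV].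
  exists s; split=> //; last by left.
  move=> r sr; apply: contrapT => br; apply: nZ; exists r; split=> //.
  exact: lt_trans sr.
have [M hM] : exists M, forall r, Z r -> r <= M.
  apply: contrapT => nM; move: hI; apply/negP; rewrite -leNgt.
  (* unbounded bad radii would force the integral of h to be at least t * mu setT *)
  have cv : mu (ball x n%:R) @[n --> \oo] --> mu (\bigcup_n ball x n%:R).
    apply: nondecreasing_cvg_mu => //; first exact: bigcup_measurable.
    move=> n m nm; apply/subsetPset; apply: le_ball; rewrite ler_nat//.
  have UT : \bigcup_n ball x n%:R = [set: X].
    apply/seteqP; split=> // y _; exists (Num.truncn (mdist x y)).+1 => //.
    by apply/ballP; exact: truncnS_gt.
  rewrite UT in cv; rewrite muleC -lee_pdivlMr//.
  rewrite -(cvg_lim _ cv)//; apply: lime_le; first by apply: cvgP cv.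
  near=> n; rewrite lee_pdivlMr// muleC.
  have [r [[r00 br] nr]] : exists r, Z r /\ n%:R <= r.
    apply: contrapT => hn; apply: nM; exists n%:R => r Zr.
    by rewrite leNgt; apply/negP => nr; apply: hn; exists r; split => //; exact: ltW.
  apply: le_trans (le_I (mb x r) measurableT _) => //.
  apply/ltW; rewrite ltNge; apply/negP => le; apply: br.
  apply: (le_trans le); rewrite lee_pmul2l ?lte_fin//.
  by apply: le_mu => //; apply: le_ball; lra.
have hs : has_sup Z by split; [exists r1|exists M => r /hM].
have s0 : 0 < sup Z.
  by apply: (lt_le_trans r10); apply: ub_le_sup; [case: hs|].
exists (sup Z); split=> //.
- move=> r sr; apply: contrapT => br.
  have : r <= sup Z by apply: ub_le_sup; [case: hs|split => //; exact: lt_trans sr].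
  by rewrite leNgt sr.
- right; have [r [r00 br] rs] := sup_adherent (divr_gt0 s0 (ltr0Sn R 1)) hs.
  by exists r; split=> //; lra.
Unshelve. all: by end_near. Qed.

(** The balls that are not inside [V] have a bad concentric ball of more than half their
    radius.  Disjoint bad balls are selected; the others are inside their
    fourfold dilates, and badness bounds the measures of these dilates by the
    integrals of [h] over disjoint balls. *)
Let stop_union (J : seq nat) (z : nat -> X) (s r : nat -> R) (V : set X) :
  open V -> (forall j, j \in J -> ball (z j) (s j) `<=` V \/
     [/\ 0 < r j, s j < 2 * r j & ~ good (z j) (r j)]) ->
  (mu (\bigcup_(j in [set` J]) ball (z j) (s j)) <= mu V + (t^-1)%:E * I setT)%E.
Proof.
move=> oV hJ.
have mV : measurable V by exact: open_measurable_Borel.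
pose J' := [seq j <- J | `[< [/\ 0 < r j, s j < 2 * r j & ~ good (z j) (r j)] >]].
have J'P j : j \in J' -> [/\ 0 < r j, s j < 2 * r j & ~ good (z j) (r j)].
  by rewrite mem_filter => /andP[/asboolP].
(* Vitali on the bad balls: a stopping ball of radius s j < 2 * r j that meets the
   selected ball k through its bad ball lies within r k + r j + s j < 4 * r k *)
have [|D [uD DJ Dd Dc]] := @finite_vitali _ _ z r J'.
  by move=> i /J'P[].
pose W := \big[setU/set0]_(j <- D) ball (z j) (4 * r j).
have mW : measurable W by apply: bigsetU_measurable => j _.
apply: (@le_trans _ _ (mu (V `|` W))).
  apply: le_mu; [|exact: measurableU|].
    by apply: bigcup_measurable => j _.
  move=> x [j /= jJ xj]; have [jV|jr] := hJ j jJ; first by left; exact: jV.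
  right; have jJ' : j \in J' by rewrite mem_filter jJ andbT; apply/asboolP.
  have [k kD [rjk [y [/ballP yj /ballP yk]]]] := Dc j jJ'.
  rewrite /W -bigcup_seq; exists k => //; apply/ballP.
  move: xj => /ballP xj; have [_ sr _] := jr.
  apply: le_lt_trans (metric_triangle _ y _) _.
  have h1 := metric_triangle y (z j) x; rewrite (metric_sym y (z j)) in h1.
  by lra.
apply: le_trans (measureU2 _ mV mW) _; apply: leeD => //.
apply: (@le_trans _ _ (\sum_(j <- D) mu (ball (z j) (4 * r j)))%E).
  exact: measure_bigsetU_le.
rewrite -(@lee_pmul2l _ t%:E)// muleA -EFinM divff ?gt_eqF// mul1e.
rewrite ge0_sume_distrr//.
apply: (@le_trans _ _ (\sum_(j <- D) I (ball (z j) (r j)))%E).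
  rewrite big_seq [leRHS]big_seq; apply: lee_sum => j /DJ /J'P[_ _ /negP].
  by rewrite -ltNge => /ltW.
rewrite -[leRHS]mul1e; apply: (@overlap_integral _ _ _ mu D _ setT h 1) => //.
by move=> x; exact: disjoint_indic_sum.
Qed.

(** The radii come from [stopping_radius] with [V] an open neighbourhood of [F] of
    almost the same measure.  Halving the radii leaves room for countably many
    of these balls to cover [F], hence finitely many up to measure [e]. *)
Lemma stopping_cover (F : set X) (x0 : X) (r0 : R) (e : R) :
  measurable F -> F `<=` ball x0 r0 -> 0 < e ->
  exists (N : nat) (z : nat -> X) (s : nat -> R),
  [/\ forall j, 0 < s j,
     (mu (F `\` \bigcup_(j < N) ball (z j) (s j / 2)) <= e%:E)%E,
     (mu (\bigcup_(j < N) ball (z j) (s j)) <=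
        mu F + e%:E + (t^-1)%:E * I setT)%E &
     forall j r, s j < r ->
       (I (ball (z j) r) <= t%:E * mu (ball (z j) (4 * r)))%E].
Proof.
move=> mF FB e0; have [->|/set0P F0] := eqVneq F set0.
  have [s [s0 sg _]] := @stopping_radius setT x0 openT Logic.I.
  exists 0%N, (fun _ => x0), (fun _ => s); split=> //.
    by rewrite set0D measure0 lee_fin ltW.
  rewrite (_ : \bigcup_(j < 0) ball x0 s = set0); last first.
    by apply/seteqP; split=> // x [].
  rewrite !measure0 add0e; apply: adde_ge0; first by rewrite lee_fin ltW.
  apply: mule_ge0; first by rewrite lee_fin invr_ge0 ltW.
  by apply: integral_ge0 => x _; rewrite lee_fin.
have [V [oV FV VF]] := outer_regular hB hfin mF FB e0.
have /choice[s hs] x : exists s, F x -> [/\ 0 < s, forall r, s < r -> good x r &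
    ball x s `<=` V \/ exists r, [/\ 0 < r, s < 2 * r & ~ good x r]].
  have [Fx|nF] := pselect (F x); last by exists 0.
  by have [s hs] := stopping_radius oV (FV _ Fx); exists s.
have [D hD] := countable_net x0 hG.
have [|//|z [Fz Fcov]] := @countable_subcover _ _ D F s hD.
  by move=> x /hs[].
have fF : (mu F < +oo)%E by apply: le_lt_trans (hfin x0 r0); exact: le_mu.
have [N hN] := measure_exhaust e0 mF fF (fun n => mb _ _) Fcov.
exists N, z, (s \o z); split=> //.
- by move=> j; have [] := hs _ (Fz j).
- have /choice[r hr] j : exists r, ball (z j) (s (z j)) `<=` V \/
     [/\ 0 < r, s (z j) < 2 * r & ~ good (z j) r].
    have [_ _ [jV|[r hr]]] := hs _ (Fz j); first by exists 0; left.
    by exists r; right.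
  apply: le_trans (leeD VF (lexx _)).
  have := @stop_union (iota 0 N) z (s \o z) r V oV.
  rewrite (_ : [set` iota 0 N] = `I_N); last first.
    by apply/seteqP; split => k /=; rewrite mem_iota.
  by apply.
- by move=> j q jq; have [_ + _] := hs _ (Fz j); exact.
Qed.

End stopping.

(** * Doubling balls among the dilates of a ball *)

Section upper_doubling_growth.
Context {R : realType} {d : measure_display} {X : measurableMetricType d R}.
Variables (mu : {measure set X -> \bar R}) (lam : X -> R -> R) (Cl : R).
Hypotheses (hB : is_Borel X) (hfin : finite_on_bounded mu).
Hypotheses (lam0 : forall x r, 0 < r -> 0 < lam x r)
  (lam_nd : forall x r s, 0 < r -> r <= s -> lam x r <= lam x s)
  (lam_mu : forall x r, 0 < r -> (mu (ball x r) <= (lam x r)%:E)%E)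
  (lam_dbl : forall x r, 0 < r -> lam x r <= Cl * lam x (r / 2)).

Lemma doubling_ge1 (x : X) : 1 <= Cl.
Proof.
have l0 := lam0 x (ltr0Sn R 0).
have l1 : lam x (1 / 2) <= lam x 1 by apply: lam_nd; lra.
have l2 : 0 < lam x (1 / 2) by apply: lam0; lra.
by rewrite -(ler_pM2r l2) [leLHS]mul1r (le_trans l1)// lam_dbl.
Qed.

Lemma doubling_pow x r n : 0 < r -> lam x (2 ^+ n * r) <= Cl ^+ n * lam x r.
Proof.
move=> r0; have C1 := doubling_ge1 x; elim: n => [|n IH]; first by rewrite !expr0 !mul1r.
have -> : 2 ^+ n.+1 * r = 2 * (2 ^+ n * r) by rewrite exprS mulrA.
apply: (le_trans (lam_dbl x _)); first by rewrite !mulr_gt0 ?exprn_gt0.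
rewrite [2 * _]mulrC mulfK// exprS -mulrA ler_wpM2l//.
exact: le_trans ler01 C1.
Qed.

(** The ball is contained in a ball centred at [x], to which upper doubling applies. *)
Lemma mass_le_lam x z r s n : 0 < r -> 0 < s -> mdist x z <= s -> 2 * s <= 2 ^+ n * r ->
  fine (mu (ball z s)) <= Cl ^+ n * lam x r.
Proof.
move=> r0 s0 xz sr; apply: le_trans (doubling_pow x n r0).
rewrite -lee_fin fineK; last by rewrite ge0_fin_numE// hfin.
apply: le_trans (lam_mu x _); last by rewrite mulr_gt0 ?exprn_gt0.
apply: le_mu; [exact: measurable_mball..|].
by apply: subset_mball; apply: le_trans sr; lra.
Qed.

Variables (z : X) (s : R).
Hypothesis s0 : 0 < s.
Let M k := fine (mu (ball z (16 ^+ k * s))).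
Let beta := 2 * Cl ^+ 4.

Let p16 k : 0 < 16 ^+ k * s.
Proof. by apply: mulr_gt0 s0; apply: exprn_gt0. Qed.

Lemma annulus_mass_ge0 k : 0 <= M k. Proof. by rewrite fine_ge0. Qed.

Lemma annulus_mass_nd k l : (k <= l)%N -> M k <= M l.
Proof.
move=> kl; rewrite fine_le ?ge0_fin_numE ?hfin//.
apply: le_mu; [exact: measurable_mball..|].
apply: le_ball; apply: ler_wpM2r; first exact: ltW.
by rewrite ler_weXn2l ?ler1n.
Qed.

(** If no dilate were doubling, the measures would grow like [beta ^+ k], faster than
    the [(Cl ^+ 4) ^+ k] that upper doubling allows.  Below the first doubling dilate
    the measures grow by a factor [beta] at each step. *)
Lemma doubling_radius : exists K, M K.+1 <= beta * M K /\
  forall k, (k <= K)%N -> beta ^+ (K - k) * M k.+1 <= beta * M K.+1.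
Proof.
have C1 := doubling_ge1 z.
have C41 : 1 <= Cl ^+ 4 by rewrite exprn_ege1.
have b1 : 1 <= beta by rewrite /beta; lra.
have b0 : 0 < beta by lra.
have ex : exists K, (0 < K)%N && (M K.+1 <= beta * M K).
  apply: contrapT => nex.
  have gr k : (0 < k)%N -> beta * M k < M k.+1.
    by move=> k0; rewrite ltNge; apply/negP => h; apply: nex; exists k; rewrite k0.
  have M2 : 0 < M 2.
    by apply: le_lt_trans (gr 1%N isT); rewrite mulr_ge0 ?annulus_mass_ge0 ?ltW.
  have grj j : beta ^+ j * M 2 <= M j.+2.
    elim: j => [|j IH]; first by rewrite expr0 mul1r.
    rewrite exprS -mulrA; apply: le_trans (ltW (gr j.+2 isT)).
    by rewrite ler_pM2l.
  have up j : M j.+2 <= (Cl ^+ 4) ^+ j * (Cl ^+ 9 * lam z s).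
    rewrite mulrA -exprM -exprD.
    apply: (mass_le_lam s0 (p16 j.+2)); first by rewrite mdistxx; exact/ltW.
    rewrite mulrA; apply: ler_wpM2r; first exact: ltW.
    rewrite (_ : 16 = 2 ^+ 4 :> R); last by rewrite -natrX.
    rewrite -exprM -exprS; apply: ler_weXn2l; first by rewrite ler1n.
    by rewrite -[j.+2]addn2 mulnDr ltn_add2l.
  (* the powers of 2 would be bounded by Y *)
  pose Y := Cl ^+ 9 * lam z s / M 2.
  have Yb j : 2 ^+ j <= Y.
    rewrite /Y ler_pdivlMr// -(@ler_pM2l _ ((Cl ^+ 4) ^+ j)); last first.
      by rewrite exprn_gt0// (lt_le_trans ltr01).
    rewrite mulrA -exprMn (mulrC _ 2); exact: le_trans (grj j) (up j).
  have := Yb (Num.truncn Y).+1; apply/negP; rewrite -ltNge.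
  apply: (@lt_le_trans _ _ (Num.truncn Y).+1%:R); first exact: truncnS_gt.
  by rewrite -natrX ler_nat ltnW// ltn_expl.
have [K /andP[K0 KM] Kmin] := ex_minnP ex.
exists K; split=> // k kK.
have [j ->] : exists j, k = (K - j)%N by exists (K - k)%N; rewrite subKn.
elim: j {k kK} => [|j IH].
  by rewrite subn0 subnn expr0 mul1r ler_peMl ?annulus_mass_ge0.
have [jK|Kj] := ltnP j K; last first.
  move: IH; rewrite (_ : K - j = 0)%N; last by apply/eqP; rewrite subn_eq0.
  by rewrite (_ : K - j.+1 = 0)%N//; apply/eqP; rewrite subn_eq0 leqW.
have KjE : (K - j.+1).+1 = (K - j)%N by rewrite -subSn// subSS.
rewrite KjE subKn//; move: IH; rewrite subKn 1?ltnW// => IH.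
(* the step just below K is monotonicity: only earlier steps are not doubling *)
case: j jK IH KjE => [|j] jK IH KjE.
  rewrite subn0 expr1; apply: ler_wpM2l; first exact: ltW.
  exact: annulus_mass_nd.
apply: le_trans IH; rewrite exprSr -mulrA ler_wpM2l ?exprn_ge0 ?(ltW b0)//.
rewrite leNgt; apply/negP => /ltW h.
have := Kmin (K - j.+1)%N; rewrite subn_gt0 jK h => /(_ isT).
by rewrite leqNgt ltn_subrL /= K0.
Qed.

End upper_doubling_growth.

(** * Pointwise estimates of T on bounded functions *)

Section kernel_estimates.
Context {R : realType} {d : measure_display} {X : measurableMetricType d R}.
Variables (mu : {measure set X -> \bar R}) (lam : X -> R -> R).
Hypotheses (hB : is_Borel X) (hfin : finite_on_bounded mu).
Hypotheses (lam0 : forall x r, 0 < r -> 0 < lam x r)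
  (lam_nd : forall x r s, 0 < r -> r <= s -> lam x r <= lam x s).
Variables (K : X -> X -> R[i]) (C tau : R).
Hypotheses (C0 : 0 < C) (tau01 : 0 < tau <= 1).
Hypothesis Ksize : forall x y, x != y -> normc (K x y) <= C / lam x (mdist x y).
Hypothesis Ksmooth : forall x y y', x != y -> mdist y y' <= mdist x y / 2 ->
  normc (K x y - K x y') <=
  C * (mdist y y' `^ tau / (mdist x y `^ tau * lam x (mdist x y))).

Let tau0 : 0 < tau. Proof. by case/andP: tau01. Qed.

Lemma powR_small (e : R) : 0 < e ->
  exists2 del : R, 0 < del & forall r, 0 <= r -> r <= del -> r `^ tau <= e.
Proof.
move=> e0; exists (e `^ tau^-1); first exact: powR_gt0.
move=> r r0 rd; rewrite -[leRHS](powRr1 (ltW e0)) -(mulVf (lt0r_neq0 tau0)) powRrM.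
by apply: ge0_ler_powR; rewrite ?nnegrE ?powR_ge0// ltW.
Qed.

(** Continuity off the diagonal makes the kernel measurable in its second variable. *)
Lemma kernel_continuous x y (e : R) : x != y -> 0 < e ->
  exists2 del : R, 0 < del & forall y', mdist y y' < del ->
    normc (K x y' - K x y) <= e.
Proof.
move=> xy e0.
have d0 : 0 < mdist x y by rewrite mdist_gt0.
have p0 : 0 < mdist x y `^ tau * lam x (mdist x y).
  by rewrite mulr_gt0 ?powR_gt0 ?lam0.
have [del del0 hdel] := powR_small (mulr_gt0 (divr_gt0 e0 C0) p0).
exists (Num.min del (mdist x y / 2)); first by rewrite lt_min del0 divr_gt0.
move=> y'; rewrite lt_min => /andP[h1 /ltW h2].
rewrite normcB; apply: le_trans (Ksmooth xy h2) _.
rewrite -ler_pdivlMl// ler_pdivrMr// (mulrC C^-1).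
by apply: hdel; rewrite ?mdist_ge0 ?ltW.
Qed.

(** [F] stands for the real and imaginary parts. *)
Lemma measurable_kernel (F : R[i] -> R) x : (forall u v, `|F u - F v| <= normc (u - v)) ->
  measurable_fun [set y | y != x] (fun y => F (K x y)).
Proof.
move=> FL.
have mU : measurable [set y : X | y != x].
  apply: open_measurable_Borel => //; rewrite openE => y /= yx; apply/nbhs_ballP.
  exists (mdist y x) => /=; first by rewrite mdist_gt0.
  by move=> y' /ballP h; apply/negP => /eqP e; rewrite e ltxx in h.
apply: (measurability _ (RGenOInfty.measurableE R)) => //.
move=> _ /= [_ [a ->] <-]; apply: open_measurable_Borel => //.
rewrite openE => y [/= yx]; rewrite in_itv/= andbT => ay; apply/nbhs_ballP.
have e0 : 0 < (F (K x y) - a) / 2 by rewrite divr_gt0// subr_gt0.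
have xy : x != y by rewrite eq_sym.
have [del del0 hdel] := kernel_continuous xy e0.
exists (Num.min del (mdist y x)) => /=; first by rewrite lt_min del0 mdist_gt0.
move=> y' /ballP; rewrite lt_min => /andP[/hdel h1 h2]; split => /=.
  by apply/negP => /eqP e; rewrite e ltxx in h2.
rewrite in_itv/= andbT; have := le_trans (FL _ _) h1.
by rewrite ler_norml => /andP[]; lra.
Qed.

Lemma cmeasurable_kernel x (b : X -> R) : measurable_fun setT b -> b x = 0 ->
  cmeasurable (fun y => K x y * (b y)%:C).
Proof.
move=> mb bx.
have key (F : R[i] -> R) : (forall u v, `|F u - F v| <= normc (u - v)) ->
    measurable_fun setT (fun y => F (K x y) * b y).
  move=> FL.
  have mU : measurable [set y : X | y != x].
    apply: open_measurable_Borel => //; rewrite openE => y /= yx; apply/nbhs_ballP.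
    exists (mdist y x) => /=; first by rewrite mdist_gt0.
    by move=> y' /ballP h; apply/negP => /eqP e; rewrite e ltxx in h.
  have -> : (fun y => F (K x y) * b y) =
      ((fun y => F (K x y)) \_ [set y | y != x]) \* b.
    apply/funext => y /=; rewrite /patch; case: ifPn => // h.
    have -> : y = x by apply/eqP/negPn/negP => yx; move/negP: h; apply; exact/mem_set.
    by rewrite bx !mulr0.
  apply: measurable_funM => //.
  by apply/(measurable_restrictT _ mU); exact: measurable_kernel.
split.
- under eq_fun do rewrite ReMr; apply: key => u v.
  by rewrite -ReN -ReD; exact: normRe_le.
- under eq_fun do rewrite ImMr; apply: key => u v.
  by rewrite -ImN -ImD; exact: normIm_le.
Qed.

Variable T : (X -> R[i]) -> (X -> R[i]).
Hypothesis TK : forall f, test_function f ->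
  {ae mu, forall x, ~ csupport f x ->
    T f x = cintegral mu setT (fun y => K x y * f y)}.

Lemma csupport_ball (f : X -> R[i]) z r : (forall y, ~ ball z r y -> f y = 0) ->
  forall x, csupport f x -> mdist z x <= r.
Proof.
move=> f0 x cx; rewrite leNgt; apply/negP => rx.
have [|y [/= fy /ballP xy]] := cx (ball x (mdist z x - r)).
  by apply: nbhsx_ballx; rewrite subr_gt0.
move/eqP: fy; apply; apply: f0 => /ballP zy.
have := metric_triangle z y x; rewrite (metric_sym y x); lra.
Qed.

Section bounded_function.
Variables (b : X -> R) (z : X) (r B : R).
Hypotheses (r0 : 0 < r) (mb : measurable_fun setT b) (bB : forall y, `|b y| <= B)
  (b0 : forall y, ~ ball z r y -> b y = 0).
Let f y := (b y)%:C.
Let m := fine (\int[mu]_y `|b y|%:E)%E.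

Lemma bounded_test : test_function f.
Proof.
split.
- exact: cmeasurable_real.
- by exists B => x; rewrite normc_real.
- exists z, (2 * r) => x cx; apply/ballP.
  apply: (@le_lt_trans _ _ r); last by rewrite ltr_pMl ?ltr1n.
  apply: (csupport_ball _ cx) => y /b0 by0.
  by rewrite /f by0.
Qed.

Lemma bounded_mass : (\int[mu]_y `|b y|%:E)%E = m%:E.
Proof.
rewrite /m fineK// ge0_fin_numE; last by apply: integral_ge0.
have B0 : 0 <= B by apply: le_trans (bB z).
apply: (@le_lt_trans _ _ (\int[mu]_y (B%:E * (\1_(ball z r) y)%:E)))%E.
  apply: ge0_le_integral => //.
  - by apply/measurable_EFinP; exact: measurableT_comp.
  - by apply: measurable_funeM; apply/measurable_EFinP; exact: measurable_indic (measurable_mball _ _ hB).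
  move=> y _; rewrite -EFinM lee_fin indicE.
  have [zy|zy] := pselect (ball z r y); first by rewrite mem_set// mulr1.
  by rewrite memNset// mulr0 b0// normr0.
rewrite ge0_integralZl_EFin//; last first.
  by apply/measurable_EFinP; exact: measurable_indic (measurable_mball _ _ hB).
rewrite integral_indic//; last exact: measurable_mball.
by rewrite setIT lte_mul_pinfty ?lee_fin// hfin.
Qed.

Let integral_bound (G : X -> R[i]) (c : R) : cmeasurable (fun y => G y * f y) ->
  (forall y, ball z r y -> normc (G y) <= c) -> 0 <= c ->
  (absintegral mu setT (fun y => G y * f y)%R < +oo)%E /\
  normc (cintegral mu setT (fun y => G y * f y)) <= 2 * (c * m).
Proof.
move=> mG Gc c0.
have h : (absintegral mu setT (fun y => G y * f y)%R <= (c * m)%:E)%E.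
  rewrite EFinM -bounded_mass -ge0_integralZl_EFin//; last first.
    by apply/measurable_EFinP; exact: measurableT_comp.
  apply: ge0_le_integral => //.
  - by move=> y _; rewrite lee_fin normc_ge0.
  - exact: measurable_Enormc.
  - by apply: measurable_funeM; apply/measurable_EFinP; exact: measurableT_comp.
  move=> y _; rewrite -EFinM lee_fin normcM normc_real.
  have [zy|zy] := pselect (ball z r y); first by rewrite ler_wpM2r// Gc.
  by rewrite b0// normr0 !mulr0.
have h' : (absintegral mu setT (fun y => G y * f y)%R < +oo)%E.
  exact: le_lt_trans h (ltry _).
split=> //; apply: le_trans (normc_cintegral _ mG h') _ => //.
by rewrite ler_pM2l// -lee_fin fineK// ge0_fin_numE// absintegral_ge0.
Qed.

Let kernel_size x : 2 * r <= mdist z x -> forall y, ball z r y ->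
  normc (K x y) <= C / lam x (mdist z x / 2).
Proof.
move=> zx y /ballP zy.
have zx0 : 0 < mdist z x by apply: lt_le_trans zx; rewrite mulr_gt0.
have tri := metric_triangle z y x.
have hxy : mdist z x / 2 <= mdist x y by rewrite (metric_sym x y); lra.
have xy : x != y by rewrite -mdist_gt0; apply: lt_le_trans hxy; rewrite divr_gt0.
apply: le_trans (Ksize xy) _.
rewrite ler_pM2l// lef_pV2 ?posrE ?lam0 ?mdist_gt0 ?divr_gt0//.
by apply: lam_nd => //; rewrite divr_gt0.
Qed.

Let size_ge0 x : 2 * r <= mdist z x -> 0 <= C / lam x (mdist z x / 2).
Proof.
move=> zx; have zx0 : 0 < mdist z x by apply: lt_le_trans zx; rewrite mulr_gt0.
by apply: divr_ge0; apply: ltW => //; rewrite lam0// divr_gt0.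
Qed.

(** On the support of [b] the distance to [x] is at least half of [mdist z x]. *)
Lemma size_bound : {ae mu, forall x, 2 * r <= mdist z x ->
  normc (T f x) <= 2 * (C / lam x (mdist z x / 2) * m)}.
Proof.
have := TK bounded_test; apply: filterS => x Tx zx.
have zx0 : 0 < mdist z x by apply: lt_le_trans zx; rewrite mulr_gt0.
rewrite Tx; last first.
  move=> cx; have : mdist z x <= r.
    by apply: (csupport_ball _ cx) => y /b0 by0; rewrite /f by0.
  by apply/negP; rewrite -ltNge; apply: lt_le_trans zx; rewrite ltr_pMl ?ltr1n.
apply: (@integral_bound (K x) _ _ _ _).2.
- apply: cmeasurable_kernel => //; apply: b0 => /ballP; apply/negP; rewrite -leNgt.
  by apply: le_trans zx; rewrite ler_peMl ?ler1n ?(ltW r0).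
- exact: kernel_size.
- exact: size_ge0.
Qed.

(** As [b] has mean zero, [K x z] may be subtracted from the kernel. *)
Lemma smooth_bound : (\int[mu]_y (b y)%:E = 0)%E -> {ae mu, forall x, 2 * r <= mdist z x ->
  normc (T f x) <= 2 * (C * ((r / mdist z x) `^ tau / lam x (mdist z x)) * m)}.
Proof.
move=> ib; have := TK bounded_test; apply: filterS => x Tx zx.
have zx0 : 0 < mdist z x by apply: lt_le_trans zx; rewrite mulr_gt0.
have xz : x != z by rewrite -mdist_gt0 metric_sym.
have bx : b x = 0.
  apply: b0 => /ballP; apply/negP; rewrite -leNgt.
  by apply: le_trans zx; rewrite ler_peMl ?ler1n ?(ltW r0).
rewrite Tx; last first.
  move=> cx; have : mdist z x <= r.
    by apply: (csupport_ball _ cx) => y /b0 by0; rewrite /f by0.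
  by apply/negP; rewrite -ltNge; apply: lt_le_trans zx; rewrite ltr_pMl ?ltr1n.
have -> : cintegral mu setT (fun y => K x y * f y) =
          cintegral mu setT (fun y => (K x y - K x z) * f y).
  have m1 : cmeasurable (fun y => K x y * f y) by exact: cmeasurable_kernel.
  have m2 : cmeasurable (fun y => K x z * f y).
    by apply: cmeasurableM; [exact: cmeasurable_cst|exact: cmeasurable_real].
  have [fin1 _] := integral_bound m1 (kernel_size zx) (size_ge0 zx).
  have [fin2 _] := @integral_bound (fun _ => K x z) _ m2 (fun _ _ => lexx _) (normc_ge0 _).
  have [i1 i2] := cintegrableP measurableT m1 fin1.
  have [j1 j2] := cintegrableP measurableT m2 fin2.
  have ib' : mu.-integrable setT (EFin \o b).
    apply/integrableP; split; first exact/measurable_EFinP.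
    by rewrite bounded_mass ltry.
  have Rb : \int[mu]_(y in setT) b y = 0 by rewrite /Rintegral ib.
  have k1 : \int[mu]_(y in setT) complex.Re (K x z * f y) = 0.
    by under eq_Rintegral do rewrite ReMr; rewrite RintegralZl// Rb mulr0.
  have k2 : \int[mu]_(y in setT) complex.Im (K x z * f y) = 0.
    by under eq_Rintegral do rewrite ImMr; rewrite RintegralZl// Rb mulr0.
  rewrite /cintegral; congr (_ +i* _).
    under [RHS]eq_Rintegral do rewrite mulrBl ReD ReN.
    by rewrite RintegralB// k1 subr0.
  under [RHS]eq_Rintegral do rewrite mulrBl ImD ImN.
  by rewrite RintegralB// k2 subr0.
apply: (@integral_bound (fun y => K x y - K x z) _ _ _ _).2.
- under eq_fun do rewrite mulrBl; apply: cmeasurableB; first exact: cmeasurable_kernel.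
  by apply: cmeasurableM; [exact: cmeasurable_cst|exact: cmeasurable_real].
- move=> y /ballP zy; rewrite normcB.
  have h : mdist z y <= mdist x z / 2 by rewrite (metric_sym x z); lra.
  apply: le_trans (Ksmooth xz h) _; rewrite ler_pM2l// (metric_sym x z).
  rewrite invfM mulrA ler_wpM2r ?invr_ge0 ?(ltW (lam0 _ zx0))//.
  rewrite ler_pdivrMr ?powR_gt0// -powRM ?divr_ge0 ?mdist_ge0 ?(ltW r0)//.
  rewrite divfK ?gt_eqF//; apply: ge0_ler_powR; rewrite ?nnegrE ?mdist_ge0 ?(ltW r0)//.
  - exact: ltW.
  - exact: ltW.
- by rewrite mulr_ge0 ?(ltW C0)// divr_ge0 ?powR_ge0// ltW// lam0.
Qed.

End bounded_function.
End kernel_estimates.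

(** * Integrals over annuli *)

Section annuli.
Context {R : realType} {d : measure_display} {X : measurableMetricType d R}.
Variable mu : {measure set X -> \bar R}.
Hypotheses (hB : is_Borel X).
Variables (z : X) (s : R).
Hypothesis s0 : 0 < s.

Definition annulus k : set X := ball z (16 ^+ k.+1 * s) `\` ball z (16 ^+ k * s).

Lemma annulusP k x : annulus k x <-> 16 ^+ k * s <= mdist z x < 16 ^+ k.+1 * s.
Proof.
split.
  by move=> [/ballP h1 h2]; rewrite h1 andbT leNgt; apply/negP => h3; apply: h2; exact/ballP.
by move=> /andP[h1 h2]; split; [exact/ballP|move=> /ballP; rewrite ltNge h1].
Qed.

Lemma measurable_annulus k : measurable (annulus k).
Proof. by apply: measurableD; exact: measurable_mball. Qed.

Let pow_le k l : (k <= l)%N -> 16 ^+ k * s <= 16 ^+ l * s.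
Proof.
move=> kl; apply: ler_wpM2r; first exact: ltW.
by rewrite ler_weXn2l ?ler1n.
Qed.

Lemma annulus_trivIset : trivIset setT annulus.
Proof.
have key i j x : (i < j)%N -> annulus i x -> annulus j x -> False.
  move=> ij /annulusP/andP[_ h1] /annulusP/andP[h2 _].
  by have := lt_le_trans h1 (le_trans (pow_le ij) h2); rewrite ltxx.
move=> i j _ _ [x [Ai Aj]]; have [ij|ji|//] := ltngtP i j; exfalso.
  exact: key ij Ai Aj.
exact: key ji Aj Ai.
Qed.

Lemma annulus_bigcup : \bigcup_k annulus k = [set x | s <= mdist z x].
Proof.
apply/seteqP; split=> x.
  move=> [k _ /annulusP/andP[h _]]; apply: le_trans h.
  by have := pow_le (leq0n k); rewrite expr0 mul1r.
move=> /= sx.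
have ex : exists k, mdist z x < 16 ^+ k.+1 * s.
  exists (Num.truncn (mdist z x / s)).
  rewrite -ltr_pdivrMr//; apply: (@lt_le_trans _ _ (Num.truncn (mdist z x / s)).+1%:R).
    exact: truncnS_gt.
  by rewrite -natrX ler_nat; apply: ltnW; exact: ltn_expl.
have [k hk kmin] := ex_minnP ex.
exists k => //; apply/annulusP; rewrite hk andbT leNgt; apply/negP => h.
case: k h hk kmin => [|k] h _ kmin.
  by move: h; rewrite expr0 mul1r ltNge sx.
by have := kmin _ h; rewrite ltnn.
Qed.

Lemma absintegral_annuli (u : X -> R[i]) : cmeasurable u ->
  absintegral mu [set x | s <= mdist z x] u =
  (\sum_(0 <= k <oo) absintegral mu (annulus k) u)%E.
Proof.
move=> mu'; rewrite -annulus_bigcup; apply: ge0_integral_bigcup.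
- exact: measurable_annulus.
- by apply: measurable_funTS; exact: measurable_Enormc.
- by move=> x _; rewrite lee_fin normc_ge0.
- exact: annulus_trivIset.
Qed.

End annuli.

Section sup_bounds.
Context {R : realType} {d : measure_display} {X : measurableType d}.
Variable mu : {measure set X -> \bar R}.
Implicit Types (u v : X -> R[i]).

Lemma absintegral_le_sup u D (c M : R) : measurable D -> cmeasurable u -> 0 <= c ->
  {ae mu, forall x, D x -> normc (u x) <= c} -> (mu D <= M%:E)%E ->
  (absintegral mu D u <= (c * M)%:E)%E.
Proof.
move=> mD mu' c0 h DM; apply: (@le_trans _ _ (\int[mu]_(x in D) (cst c%:E) x)%E).
  apply: ae_ge0_le_integral => //.
  - by move=> x _; rewrite lee_fin normc_ge0.
  - by apply: measurable_funTS; exact: measurable_Enormc.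
by rewrite integral_cst// EFinM lee_wpmul2l.
Qed.

Lemma ae_absintegralD u v w D : measurable D -> cmeasurable u -> cmeasurable v ->
  cmeasurable w -> {ae mu, forall x, w x = u x + v x} ->
  (absintegral mu D w <= absintegral mu D u + absintegral mu D v)%E.
Proof.
move=> mD mu' mv mw h; apply: le_trans (absintegralD mu mD mu' mv).
apply: ae_ge0_le_integral => //.
- by move=> x _; rewrite lee_fin normc_ge0.
- by apply: measurable_funTS; exact: measurable_Enormc.
- by move=> x _; rewrite lee_fin normc_ge0.
- by apply: measurable_funTS; apply: measurable_Enormc; exact: cmeasurableD.
- by apply: filterS h => x -> _.
Qed.

(** Integrate [a <= e + a ^+ 2 / e]; this plays the role of the Cauchy-Schwarz
    inequality, with [e] to be chosen. *)
Lemma absintegral_L2mass u D (e : R) : measurable D -> cmeasurable u -> 0 < e ->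
  (absintegral mu D u <= e%:E * mu D + (e^-1)%:E * L2mass mu u)%E.
Proof.
move=> mD mu' e0.
have m2 : measurable_fun D (fun x => ((normc (u x)) ^+ 2)%:E).
  by apply: measurable_funTS; exact: measurable_Enormc2.
apply: (@le_trans _ _ (\int[mu]_(x in D) (e%:E + (e^-1)%:E * ((normc (u x)) ^+ 2)%:E))%E).
  apply: ge0_le_integral => //.
  - by move=> x _; rewrite lee_fin normc_ge0.
  - by apply: measurable_funTS; exact: measurable_Enormc.
  - by apply: emeasurable_funD => //; exact: measurable_funeM.
  move=> x _; rewrite -EFinM -EFinD lee_fin.
  have [h|/ltW h] := leP (normc (u x)) e.
    by rewrite (le_trans h)// lerDl mulr_ge0 ?sqr_ge0// invr_ge0 ltW.
  rewrite (@le_trans _ _ (e^-1 * normc (u x) ^+ 2))//; last by rewrite lerDr ltW.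
  by rewrite ler_pdivlMl// expr2 ler_wpM2r// normc_ge0.
rewrite ge0_integralD//; first last.
- exact: measurable_funeM.
- by move=> x _; rewrite -EFinM lee_fin mulr_ge0 ?sqr_ge0// invr_ge0 ltW.
- by move=> x _; rewrite lee_fin ltW.
rewrite integral_cst//; apply: leeD => //.
rewrite ge0_integralZl_EFin//; last by rewrite invr_ge0 ltW.
  rewrite lee_wpmul2l ?lee_fin ?invr_ge0 ?(ltW e0)//.
  apply: ge0_subset_integral => //; first exact: measurable_Enormc2.
  by move=> x _; rewrite lee_fin sqr_ge0.
by move=> x _; rewrite lee_fin sqr_ge0.
Qed.

Lemma absintegral_L2mass0 u D : measurable D -> cmeasurable u -> L2mass mu u = 0%E ->
  absintegral mu D u = 0%E.
Proof.
move=> mD mu' u0.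
have m2 := measurable_Enormc2 mu'.
have /(ae_eq_integral_abs mu measurableT m2) h : (\int[mu]_x `|((normc (u x)) ^+ 2)%:E| = 0)%E.
  by rewrite -u0; apply: eq_integral => x _; rewrite gee0_abs// lee_fin sqr_ge0.
rewrite -[RHS](@integral0 _ _ _ mu D); apply: ge0_ae_eq_integral => //.
- by apply: measurable_funTS; exact: measurable_Enormc.
- by move=> x _; rewrite lee_fin normc_ge0.
apply: filterS h => x /(_ I) /= [] /eqP; rewrite sqrf_eq0 => /eqP -> _ //.
Qed.

End sup_bounds.

(** * The estimate away from a stopping ball *)

Section geometric_sums.
Context {R : realType}.

Lemma geo_sum_le (q : R) n : 0 <= q < 1 -> \sum_(i < n) q ^+ i <= (1 - q)^-1.
Proof.
move=> /andP[q0 q1]; have p : 0 < 1 - q by rewrite subr_gt0.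
rewrite -[leRHS]mul1r ler_pdivlMr//.
elim: n => [|n IH]; first by rewrite big_ord0 mul0r.
by rewrite big_ord_recl/= expr0 mulrDl mul1r; under eq_bigr do rewrite exprS;
   rewrite -mulr_sumr -mulrA; have := ler_wpM2l q0 IH; lra.
Qed.

End geometric_sums.

Section local_estimate.
Context {R : realType} {d : measure_display} {X : measurableMetricType d R}.
Variables (mu : {measure set X -> \bar R}) (lam : X -> R -> R) (Cl : R).
Hypotheses (hB : is_Borel X) (hfin : finite_on_bounded mu).
Hypotheses (lam0 : forall x r, 0 < r -> 0 < lam x r)
  (lam_nd : forall x r s, 0 < r -> r <= s -> lam x r <= lam x s)
  (lam_mu : forall x r, 0 < r -> (mu (ball x r) <= (lam x r)%:E)%E)
  (lam_dbl : forall x r, 0 < r -> lam x r <= Cl * lam x (r / 2)).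
Variables (K : X -> X -> R[i]) (C tau : R).
Hypotheses (C0 : 0 < C) (tau01 : 0 < tau <= 1).
Hypothesis Ksize : forall x y, x != y -> normc (K x y) <= C / lam x (mdist x y).
Hypothesis Ksmooth : forall x y y', x != y -> mdist y y' <= mdist x y / 2 ->
  normc (K x y - K x y') <=
  C * (mdist y y' `^ tau / (mdist x y `^ tau * lam x (mdist x y))).
Variable T : (X -> R[i]) -> (X -> R[i]).
Hypothesis TK : forall f, test_function f ->
  {ae mu, forall x, ~ csupport f x ->
    T f x = cintegral mu setT (fun y => K x y * f y)}.
Hypothesis Tlin : linear_on_Lp mu 2%:E T.
Variable C2 : R.
Hypothesis C20 : 0 < C2.
Hypothesis TL2 : forall f, cLp mu 2%:E f ->
  cmeasurable (T f) /\ (L2mass mu (T f) <= C2%:E * L2mass mu f)%E.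

Let beta := 2 * Cl ^+ 4.
Let q := 16^-1 `^ tau.

(** The three terms account for [T g] and for [T p] on the dilate by 16 of the doubling
    ball, and for [T (g - p)] outside it. *)
Definition local_const : R := 4 * C * Cl ^+ 6 * beta + (beta + C2) +
  4 * C * Cl ^+ 5 / (1 - q).

Variables (z : X) (s : R) (s0 : 0 < s).
Let M k := fine (mu (ball z (16 ^+ k * s))).
Variables (k0 : nat).
Hypotheses (k0dbl : M k0.+1 <= beta * M k0)
  (k0gr : forall k, (k <= k0)%N -> beta ^+ (k0 - k) * M k.+1 <= beta * M k0.+1).
Let Rb : set X := ball z (16 ^+ k0 * s).
Variables (h : X -> R) (B : R) (E : set X).
Hypotheses (mh : measurable_fun setT h) (h0 : forall x, 0 <= h x)
  (hB' : forall x, h x <= B) (mE : measurable E) (EB : E `<=` ball z (s / 2)).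
Let m := fine (\int[mu]_(x in E) (h x)%:E)%E.
Let g x := h x * \1_E x.
Let p x := m / M k0 * \1_Rb x.
Let b x := g x - p x.

Let mbl x r : measurable (ball x r : set X). Proof. exact: measurable_mball. Qed.
Let p16 k : 0 < 16 ^+ k * s :> R.
Proof. by apply: mulr_gt0 s0; apply: exprn_gt0. Qed.
Let M0 k : 0 <= M k. Proof. by rewrite fine_ge0. Qed.
Let ME k : mu (ball z (16 ^+ k * s)) = (M k)%:E.
Proof. by rewrite fineK// ge0_fin_numE// hfin. Qed.
Let C1 : 1 <= Cl. Proof. exact: (doubling_ge1 lam0 lam_nd lam_dbl z). Qed.
Let Clp : 0 < Cl. Proof. exact: lt_le_trans ltr01 C1. Qed.
Let beta0 : 0 < beta. Proof. by rewrite mulr_gt0 ?exprn_gt0. Qed.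
Let q0 : 0 < q. Proof. by rewrite powR_gt0. Qed.
Let q1 : q < 1.
Proof.
have /andP[t0 _] := tau01.
suff : q < 1 `^ tau by rewrite powR1.
apply: gt0_ltr_powR; rewrite ?nnegrE//.
by rewrite invf_lt1// ltr1n.
Qed.

Lemma local_const_ge0 : 0 <= local_const.
Proof.
rewrite /local_const !addr_ge0// ?mulr_ge0 ?exprn_ge0 ?(ltW C0) ?(ltW Clp) ?(ltW beta0) ?(ltW C20)//.
by rewrite invr_ge0 subr_ge0 ltW.
Qed.

Let half_sub : ball z (s / 2) `<=` Rb.
Proof.
apply: le_ball; apply: (@le_trans _ _ s); first by rewrite ler_pdivrMr// ler_peMr ?ler1n// ltW.
rewrite -[leLHS]mul1r; apply: ler_wpM2r; first exact: ltW.
by apply: exprn_ege1; rewrite ler1n.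
Qed.

Let B0 : 0 <= B. Proof. exact: le_trans (h0 z) (hB' z). Qed.
Let mg : measurable_fun setT g.
Proof. by apply: measurable_funM => //; exact: measurable_indic. Qed.
Let mp : measurable_fun setT p.
Proof. by apply: measurable_funM => //; exact: (measurable_indic (mbl _ _)). Qed.
Let m0 : 0 <= m.
Proof. by rewrite fine_ge0// integral_ge0// => x _; rewrite lee_fin. Qed.
Let g0 x : 0 <= g x. Proof. by rewrite mulr_ge0. Qed.
Let gB x : `|g x| <= B.
Proof. by rewrite ger0_norm// /g indicE; case: (x \in E); rewrite ?mulr1 ?mulr0. Qed.
Let g_out y : ~ ball z (s / 2) y -> g y = 0.
Proof. by move=> zy; rewrite /g indicE memNset ?mulr0// => /EB. Qed.
Let s20 : 0 < s / 2. Proof. by rewrite divr_gt0. Qed.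

Let g_mass : fine (\int[mu]_y `|g y|%:E)%E = m.
Proof.
congr fine; rewrite [RHS]integral_mkcond; apply: eq_integral => y _.
rewrite ger0_norm// /g /patch indicE.
by case: (y \in E); rewrite ?mulr1 ?mulr0.
Qed.

Let g_int : (\int[mu]_y `|g y|%:E = m%:E)%E.
Proof. by rewrite (bounded_mass hB hfin mg gB g_out) g_mass. Qed.

Let p0 x : 0 <= p x. Proof. by rewrite mulr_ge0// divr_ge0. Qed.

Let p_int : (\int[mu]_y (p y)%:E)%E = (m / M k0 * M k0)%:E.
Proof.
under eq_integral do rewrite EFinM.
rewrite ge0_integralZl_EFin//; [|by apply/measurable_EFinP; exact: (measurable_indic (mbl _ _))|by rewrite divr_ge0].
by rewrite (integral_indic _ measurableT (mbl _ _)) setIT ME.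
Qed.

Let g_L2 : cLp mu 2%:E (fun x => (g x)%:C).
Proof.
apply/cLp2P; split; first exact: cmeasurable_real.
apply: (@le_lt_trans _ _ (B%:E * \int[mu]_y `|g y|%:E)%E); last first.
  by rewrite g_int lte_mul_pinfty ?lee_fin ?ltry.
rewrite -ge0_integralZl_EFin//; last by apply/measurable_EFinP; exact: measurableT_comp.
apply: ge0_le_integral => //.
- by move=> x _; rewrite lee_fin sqr_ge0.
- by apply: measurable_Enormc2; exact: cmeasurable_real.
- by apply: measurable_funeM; apply/measurable_EFinP; exact: measurableT_comp.
by move=> x _; rewrite -EFinM lee_fin normc_real expr2 ler_wpM2r.
Qed.

Let p_L2mass : L2mass mu (fun x => (p x)%:C) = ((m / M k0) ^+ 2 * M k0)%:E.
Proof.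
rewrite EFinM -ME -[in RHS](setIT (ball z (16 ^+ k0 * s))) -(integral_indic _ measurableT (mbl _ _)).
rewrite -ge0_integralZl_EFin ?sqr_ge0//; last by apply/measurable_EFinP; exact: (measurable_indic (mbl _ _)).
apply: eq_integral => x _; rewrite normc_real ger0_norm// /p exprMn EFinM; congr (_ * _%:E)%E.
by rewrite indicE; case: (x \in _); rewrite ?expr1n ?expr0n.
Qed.

Let p_L2 : cLp mu 2%:E (fun x => (p x)%:C).
Proof. by apply/cLp2P; split; [exact: cmeasurable_real|rewrite p_L2mass ltry]. Qed.

Let b_L2 : cLp mu 2%:E (fun x => (b x)%:C).
Proof.
have /cLp2P[m1 l1] := g_L2; have /cLp2P[m2 l2] := p_L2.
apply/cLp2P; split; first by apply: cmeasurable_real; exact: measurable_funB.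
have -> : (fun x => (b x)%:C) = (fun x => (g x)%:C + (-1) * (p x)%:C).
  by apply/funext => x; rewrite /b rmorphB/= mulN1r.
have m2' : cmeasurable (fun x => (-1) * (p x)%:C).
  by apply: cmeasurableM => //; exact: cmeasurable_cst.
apply: le_lt_trans (L2massD mu m1 m2') _; rewrite L2massZ// normcN normc1 expr1n mul1e.
by rewrite lte_add_pinfty// lte_mul_pinfty.
Qed.

Let Tb_split : {ae mu, forall x, T (fun x => (b x)%:C) x =
   T (fun x => (g x)%:C) x + (-1) * T (fun x => (p x)%:C) x}.
Proof.
have := Tlin (-1) p_L2 g_L2; apply: filterS => x.
rewrite (_ : (fun y => -1 * (p y)%:C + (g y)%:C) = (fun x => (b x)%:C)); last first.
  by apply/funext => y; rewrite /b rmorphB/= mulN1r addrC.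
by move=> ->; rewrite addrC.
Qed.

Let Am k : measurable (annulus z s k). Proof. exact: measurable_annulus. Qed.

Let A_mass k : (mu (annulus z s k) <= (M k.+1)%:E)%E.
Proof. by rewrite -ME; apply: le_mu => // x []. Qed.

(** The size estimate gives [m / M k0.+1] times [Cl ^+ (6 + 4 * (k0 - k))] on the annulus,
    whose measure is smaller than [M k0.+1] by a factor [beta ^+ (k0 - k)] up to
    [beta]; as [beta] is twice [Cl ^+ 4], the quotient decays geometrically. *)
Let near_g k : (k <= k0)%N -> 0 < M k0.+1 ->
  (absintegral mu (annulus z s k) (T (fun x => (g x)%:C)) <=
   (2 * C * Cl ^+ 6 * beta * m * (2^-1) ^+ (k0 - k))%:E)%E.
Proof.
move=> kk0 MK.
pose c := 2 * (C * Cl ^+ (6 + 4 * (k0 - k)) / M k0.+1 * m).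
have c0 : 0 <= c.
  apply: mulr_ge0 => //; apply: mulr_ge0 => //; apply: divr_ge0; last exact: ltW.
  by apply: mulr_ge0; [exact: ltW|exact/exprn_ge0/ltW].
apply: (@le_trans _ _ (c * M k.+1)%:E).
  apply: absintegral_le_sup => //; first by have [] := TL2 g_L2.
  have := size_bound hB hfin lam0 lam_nd C0 tau01 Ksize Ksmooth TK s20 mg gB g_out.
  apply: filterS => x + /annulusP/andP[h1 h2]; rewrite g_mass => hx.
  have sx : s <= mdist z x.
    apply: le_trans h1; rewrite -[leLHS]mul1r; apply: ler_wpM2r; first exact: ltW.
    by apply: exprn_ege1; rewrite ler1n.
  apply: le_trans (hx _) _; first by rewrite mulrC divfK.
  rewrite ler_pM2l// ler_wpM2r// -mulrA ler_pM2l// ler_pdivlMr// mulrC.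
  have x2 : 0 < 16 ^+ k * s / 2 by rewrite divr_gt0.
  have lx : lam x (16 ^+ k * s / 2) <= lam x (mdist z x / 2).
    by apply: lam_nd => //; rewrite ler_pM2r.
  have lx0 : 0 < lam x (16 ^+ k * s / 2) by exact: lam0.
  rewrite ler_pdivrMr; last exact: lt_le_trans lx.
  apply: (@le_trans _ _ (Cl ^+ (6 + 4 * (k0 - k)) * lam x (16 ^+ k * s / 2))).
    apply: (mass_le_lam hB hfin lam0 lam_nd lam_mu lam_dbl x2 (p16 k0.+1)).
      rewrite metric_sym; apply: ltW; apply: lt_le_trans h2 _.
      by apply: ler_wpM2r; [exact: ltW|rewrite ler_weXn2l ?ler1n].
    have -> : k0.+1 = (k0 - k + k).+1 by rewrite subnK.
    rewrite exprS exprD (exprD 2) exprM (_ : 2 ^+ 4 = 16 :> R); last by rewrite -natrX.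
    by rewrite le_eqVlt; apply/orP; left; apply/eqP; field.
  by rewrite ler_pM2l ?exprn_gt0.
rewrite lee_fin /c exprD exprM; set P := (Cl ^+ 4) ^+ (k0 - k).
have -> : 2 * (C * (Cl ^+ 6 * P) / M k0.+1 * m) * M k.+1 =
          2 * C * Cl ^+ 6 * m * (P * M k.+1 / M k0.+1) by ring.
have -> : 2 * C * Cl ^+ 6 * beta * m * 2^-1 ^+ (k0 - k) =
          2 * C * Cl ^+ 6 * m * (beta * 2^-1 ^+ (k0 - k)) by ring.
apply: ler_wpM2l; first by rewrite !mulr_ge0 ?exprn_ge0 ?(ltW C0) ?(ltW Clp).
rewrite ler_pdivrMr// mulrAC exprVn ler_pdivlMr ?exprn_gt0//.
by apply: le_trans (k0gr kk0); rewrite /beta exprMn mulrC mulrA.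
Qed.

(** The [L_2] bound, with [e] the value of [p] on [Rb]; this is where the doubling
    property of [Rb] is used. *)
Let near_p : 0 < m -> 0 < M k0 ->
  (absintegral mu (ball z (16 ^+ k0.+1 * s)) (T (fun x => (p x)%:C)) <=
   ((beta + C2) * m)%:E)%E.
Proof.
move=> mp0 Mp; have [mT lT] := TL2 p_L2.
have e0 : 0 < m / M k0 by rewrite divr_gt0.
apply: le_trans (absintegral_L2mass mu (mbl _ _) mT e0) _.
rewrite ME mulrDl EFinD; apply: leeD.
  by rewrite -EFinM lee_fin mulrAC ler_pdivrMr// mulrAC [leLHS]mulrC ler_wpM2r.
apply: (@le_trans _ _ (((m / M k0)^-1)%:E * (C2%:E * L2mass mu (fun x => (p x)%:C)))%E).
  by rewrite lee_wpmul2l// lee_fin invr_ge0 ltW.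
rewrite p_L2mass -!EFinM lee_fin le_eqVlt; apply/orP; left; apply/eqP.
by field; rewrite ?gt_eqF.
Qed.

(** Smoothness gives the decay [q ^+ (k - k0)] on top of the size estimate. *)
Let far k : (k0 < k)%N -> 0 < M k.+1 -> (\int[mu]_y (b y)%:E = 0)%E ->
  fine (\int[mu]_y `|b y|%:E)%E <= 2 * m ->
  (absintegral mu (annulus z s k) (T (fun x => (b x)%:C)) <=
   (4 * C * Cl ^+ 5 * m * q ^+ (k - k0))%:E)%E.
Proof.
move=> k0k Mp ib mb2.
have mb : measurable_fun setT b by exact: measurable_funB.
have bB y : `|b y| <= B + m / M k0.
  apply: le_trans (ler_normB _ _) _; apply: lerD => //.
  by rewrite ger0_norm// /p indicE ler_piMr ?divr_ge0// lern1 leq_b1.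
have b_out y : ~ ball z (16 ^+ k0 * s) y -> b y = 0.
  move=> ny; rewrite /b g_out ?sub0r; last by move/half_sub.
  by rewrite /p indicE memNset// mulr0 oppr0.
pose c := 2 * (C * (q ^+ (k - k0) / (M k.+1 / Cl ^+ 5)) * (2 * m)).
have c0 : 0 <= c.
  apply: mulr_ge0 => //; apply: mulr_ge0; last exact: mulr_ge0.
  apply: mulr_ge0; first exact: ltW.
  apply: divr_ge0; first exact/exprn_ge0/ltW.
  by apply: divr_ge0 => //; exact/exprn_ge0/ltW.
apply: (@le_trans _ _ (c * M k.+1)%:E); last first.
  rewrite lee_fin /c le_eqVlt; apply/orP; left; apply/eqP.
  by field; rewrite !gt_eqF.
apply: absintegral_le_sup => //; first by have [] := TL2 b_L2.
have := smooth_bound hB hfin lam0 lam_nd C0 tau01 Ksize Ksmooth TK (p16 k0) mb bB b_out ib.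
apply: filterS => x + /annulusP/andP[h1 h2]; move=> hx.
have d0 : 0 < mdist z x by exact: lt_le_trans (p16 k) h1.
apply: le_trans (hx _) _.
  apply: le_trans h1; apply: (@le_trans _ _ (16 ^+ k0.+1 * s)).
    by rewrite exprS -mulrA; apply: ler_wpM2r; [exact: ltW|rewrite ler_nat].
  by apply: ler_wpM2r; [exact: ltW|rewrite ler_weXn2l ?ler1n].
rewrite ler_pM2l//; apply: ler_pM => //.
- rewrite mulr_ge0 ?(ltW C0)// divr_ge0 ?powR_ge0// ltW// lam0//.
- by rewrite fine_ge0// integral_ge0.
rewrite ler_pM2l//; apply: ler_pM.
- exact: powR_ge0.
- by rewrite invr_ge0 ltW// lam0.
- rewrite /q -[leRHS]powR_mulrn ?powR_ge0// -powRrM [tau * _]mulrC powRrM.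
  apply: ge0_ler_powR; rewrite ?nnegrE ?powR_ge0 ?divr_ge0 ?(ltW d0) ?(ltW (p16 k0))//.
    by have /andP[/ltW] := tau01.
  rewrite powR_mulrn ?invr_ge0// exprVn ler_pdivrMr// ler_pdivlMl ?exprn_gt0//.
  apply: le_trans h1; rewrite mulrA -exprD subnK//; exact: ltnW.
rewrite lef_pV2 ?posrE ?lam0 ?divr_gt0 ?exprn_gt0//.
rewrite ler_pdivrMr ?exprn_gt0// mulrC.
apply: (@le_trans _ _ (Cl ^+ 5 * lam x (16 ^+ k * s))).
  apply: (mass_le_lam hB hfin lam0 lam_nd lam_mu lam_dbl (p16 k) (p16 k.+1)).
    by rewrite metric_sym ltW.
  by rewrite exprS !mulrA; do 2 (apply: ler_wpM2r; first by rewrite ?exprn_ge0// ltW); rewrite -natrX -natrM.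
by rewrite ler_pM2l ?exprn_gt0// lam_nd.
Qed.

Let g_small : (L2mass mu (fun x => (g x)%:C) <= (B * m)%:E)%E.
Proof.
rewrite EFinM -g_int -ge0_integralZl_EFin//; last by apply/measurable_EFinP; exact: measurableT_comp.
apply: ge0_le_integral => //.
- by move=> x _; rewrite lee_fin sqr_ge0.
- by apply: measurable_Enormc2; exact: cmeasurable_real.
- by apply: measurable_funeM; apply/measurable_EFinP; exact: measurableT_comp.
by move=> x _; rewrite -EFinM lee_fin normc_real expr2 ler_wpM2r.
Qed.

(** When [m = 0] the value of [p] is 0 and [g] vanishes almost everywhere, whatever
    [M k0] is. *)
Let null_case : m = 0 ->
  absintegral mu [set x | s <= mdist z x] (T (fun x => (b x)%:C)) = 0%E.
Proof.
move=> m00; have [mT lT] := TL2 b_L2.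
apply: absintegral_L2mass0 => //.
  by rewrite -annulus_bigcup//; apply: bigcup_measurable.
apply/eqP; rewrite eq_le L2mass_ge0 andbT; apply: le_trans lT _.
have -> : (fun x => (b x)%:C) = (fun x => (g x)%:C).
  by apply/funext => x; rewrite /b /p m00 mul0r mul0r subr0.
rewrite (_ : L2mass mu _ = 0%E) ?mule0//.
by apply/eqP; rewrite eq_le L2mass_ge0 andbT; move: g_small; rewrite m00 mulr0.
Qed.

(** Otherwise [E], contained in the doubling ball, is a null set. *)
Let Mk0_gt0 : 0 < m -> 0 < M k0.
Proof.
move=> mp0; rewrite lt_neqAle M0 andbT; apply/eqP => e.
have E0 : mu E = 0%E.
  apply/eqP; rewrite eq_le measure_ge0 andbT [e in (_ <= e)%E](_ : _ = (M k0)%:E); last by rewrite -e.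
  rewrite -ME; apply: le_mu => //; exact: subset_trans EB half_sub.
move: mp0; rewrite /m null_set_integral ?ltxx//.
by apply/measurable_EFinP; exact: measurable_funTS.
Qed.

Let b_int : 0 < m -> (\int[mu]_y (b y)%:E = 0)%E /\
  fine (\int[mu]_y `|b y|%:E)%E <= 2 * m.
Proof.
move=> mp0; have Mp := Mk0_gt0 mp0.
have pE : (\int[mu]_y (p y)%:E = m%:E)%E by rewrite p_int divfK// gt_eqF.
have gE : (\int[mu]_y (g y)%:E = m%:E)%E.
  by rewrite -g_int; apply: eq_integral => y _; rewrite ger0_norm.
have ig : mu.-integrable setT (EFin \o g).
  apply/integrableP; split; first exact/measurable_EFinP.
  by rewrite g_int ltry.
have ip : mu.-integrable setT (EFin \o p).
  apply/integrableP; split; first exact/measurable_EFinP.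
  rewrite (_ : (\int[mu]_x `|(EFin \o p) x|)%E = m%:E) ?ltry//.
  by rewrite -pE; apply: eq_integral => y _; rewrite gee0_abs// lee_fin.
split.
  rewrite (_ : (fun y => (b y)%:E) = (fun y => (EFin \o g) y - (EFin \o p) y)%E); last first.
    by apply/funext => y; rewrite /= -EFinB.
  by rewrite integralB// gE pE subee.
have h1 : (\int[mu]_y `|b y|%:E <= (2 * m)%:E)%E.
  apply: (@le_trans _ _ (\int[mu]_y ((g y)%:E + (p y)%:E))%E).
    apply: ge0_le_integral => //.
    - by apply/measurable_EFinP; apply: measurableT_comp => //; exact: measurable_funB.
    - by apply: emeasurable_funD; exact/measurable_EFinP.
    move=> y _; rewrite -EFinD lee_fin; apply: le_trans (ler_normB _ _) _.
    by rewrite !ger0_norm.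
  rewrite ge0_integralD//; try exact/measurable_EFinP.
  - by rewrite gE pE -EFinD mulr_natl mulr2n.
  - by move=> y _; rewrite lee_fin.
  - by move=> y _; rewrite lee_fin.
rewrite -lee_fin fineK// ge0_fin_numE; last by apply: integral_ge0.
exact: le_lt_trans h1 (ltry _).
Qed.

(** Let [g] be [h] on [E], of mass [m], and [p] the constant [m / M k0] on the
    doubling ball [Rb].  The region is cut into annuli around [z]; [T g] and [T p] are
    estimated separately on the annuli inside the dilate of [Rb] by 16, and together
    on the others. *)
Lemma local_estimate :
  (absintegral mu [set x | (s <= mdist z x)%R] (T (fun x => (b x)%:C)) <=
   (local_const * m)%:E)%E.
Proof.
have [m00|mN0] := eqVneq m 0; first by rewrite null_case// m00 mulr0.
have mp0 : 0 < m by rewrite lt_neqAle eq_sym mN0.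
have Mp := Mk0_gt0 mp0; have [ib mb2] := b_int mp0.
have Mnd k : (k0 <= k)%N -> 0 < M k.
  by move=> h1; apply: lt_le_trans Mp _; exact: annulus_mass_nd.
have [mT _] := TL2 b_L2; have [mTg _] := TL2 g_L2; have [mTp _] := TL2 p_L2.
rewrite absintegral_annuli//.
apply: lime_le; first by apply: is_cvg_nneseries => k _ _; exact: absintegral_ge0.
apply: nearW => n.
(* more annuli, so that all those up to k0 are present *)
apply: (@le_trans _ _ (\sum_(0 <= k < k0.+1 + n) absintegral mu (annulus z s k) (T (fun x => (b x)%:C)))%E).
  rewrite [leRHS](big_cat_nat _ (n := n)) ?leq_addl//=.
  by rewrite leeDl// sume_ge0// => k _; exact: absintegral_ge0.
rewrite (big_cat_nat _ (n := k0.+1)) ?leq_addr//=.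
rewrite /local_const mulrDl EFinD; apply: leeD; last first.
  rewrite -[X in (\sum_(X <= _ < _) _)%R]add0n big_addn (addnC k0.+1) addnK big_mkord.
  apply: (@le_trans _ _ (\sum_(i < n) (4 * C * Cl ^+ 5 * m * q ^+ i)%:E)%E).
    apply: lee_sum => i _.
    have h1 : (k0 < i + k0.+1)%N by rewrite addnS ltnS leq_addl.
    have h2 := far h1 (Mnd _ (leqW (ltnW h1))) ib mb2.
    apply: le_trans h2 _; rewrite lee_fin; apply: ler_wpM2l.
      by rewrite !mulr_ge0 ?exprn_ge0 ?(ltW C0) ?(ltW Clp).
    by apply: ler_wiXn2l; rewrite ?(ltW q0) ?(ltW q1)// addnS -addSn addnK.
  rewrite sumEFin lee_fin -mulr_sumr (mulrAC _ _^-1 m).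
  apply: ler_wpM2l; last by apply: geo_sum_le; rewrite (ltW q0).
  by rewrite !mulr_ge0 ?exprn_ge0 ?(ltW C0) ?(ltW Clp).
apply: (@le_trans _ _ (\sum_(0 <= k < k0.+1)
    (absintegral mu (annulus z s k) (T (fun x => (g x)%:C)) +
     absintegral mu (annulus z s k) (T (fun x => (p x)%:C))))%E).
  apply: lee_sum => k _.
  have mNp : cmeasurable (fun x => -1 * T (fun x => (p x)%:C) x).
    by apply: cmeasurableM => //; exact: cmeasurable_cst.
  have h1 : absintegral mu (annulus z s k) (T (fun x => (p x)%:C)) =
     absintegral mu (annulus z s k) (fun x => -1 * T (fun x => (p x)%:C) x).
    by rewrite absintegralZ// normcN normc1 mul1e.
  by rewrite h1; apply: ae_absintegralD.
rewrite big_split/= mulrDl EFinD; apply: leeD.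
  apply: (@le_trans _ _ (\sum_(0 <= k < k0.+1)
      (2 * C * Cl ^+ 6 * beta * m * 2^-1 ^+ (k0 - k))%:E)%E).
    rewrite !big_mkord; apply: lee_sum => k _; apply: near_g; first by rewrite -ltnS.
    exact: Mnd.
  rewrite sumEFin lee_fin -mulr_sumr big_mkord.
  (* the geometric sum is read from the annulus k0 inwards *)
  rewrite (reindex_inj rev_ord_inj)/=.
  rewrite (eq_bigr (fun i : 'I_k0.+1 => (2^-1 : R) ^+ i)); last first.
    by move=> i _; rewrite subSS subKn// -ltnS.
  have h1 : \sum_(i < k0.+1) (2^-1 : R) ^+ i <= (1 - 2^-1)^-1.
    by apply: geo_sum_le; rewrite invr_ge0 ler0n/= invf_lt1// ltr1n.
  have h2 : (1 - 2^-1)^-1 = 2 :> R by field.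
  rewrite h2 in h1.
  have h3 : 0 <= 2 * C * Cl ^+ 6 * beta * m.
    by rewrite !mulr_ge0 ?exprn_ge0 ?(ltW C0) ?(ltW Clp) ?(ltW beta0).
  by apply: le_trans (ler_wpM2l h3 h1) _; rewrite le_eqVlt; apply/orP; left; apply/eqP; ring.
apply: le_trans (near_p mp0 Mp).
rewrite -[leRHS]mul1e; apply: overlap_integral => //.
- exact: measurable_normc.
- by move=> x; exact: normc_ge0.
- move=> k; rewrite mem_iota add0n subn0 => /andP[_ kk]; split=> //.
  move=> x /annulusP/andP[_ h2]; apply/ballP; apply: lt_le_trans h2 _.
  by apply: ler_wpM2r; [exact: ltW|rewrite ler_weXn2l ?ler1n].
- move=> x; apply: disjoint_indic_sum; first exact: iota_uniq.
  move=> i j _ _ ij; have /trivIsetP := @annulus_trivIset _ _ _ z s s0.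
  by apply.
Qed.

End local_estimate.

(** * L_2 norm of a sum of averages *)

Section almost_orthogonality.
Context {R : realType} {d : measure_display} {X : measurableType d}.
Variable mu : {measure set X -> \bar R}.
Variables (N : nat) (a m rho : nat -> R) (D : nat -> set X) (L : R).
Hypotheses (a0 : forall j, 0 <= a j) (m0 : forall j, 0 <= m j) (L0 : 0 <= L).
Hypotheses (mD : forall j, measurable (D j)) (fD : forall j, (mu (D j) < +oo)%E).
Hypothesis am : forall j, a j * fine (mu (D j)) <= m j.
Hypothesis pack : forall i, (i < N)%N ->
  \sum_(j < N | (rho j <= rho i) && `[< D i `&` D j !=set0 >]) m j <=
  L * fine (mu (D i)).

(** Each product [x i * x j] appears in the double sum, the index with the larger value
    of [rho] first. *)
Lemma square_sum_le (x : nat -> R) : (forall j, 0 <= x j) ->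
  (\sum_(i < N) x i) ^+ 2 <=
  2 * \sum_(i < N) \sum_(j < N | rho j <= rho i) x i * x j.
Proof.
move=> x0; rewrite expr2 mulr_suml.
have -> : \sum_(i < N) x i * \sum_(j < N) x j = \sum_(i < N) \sum_(j < N) x i * x j.
  by apply: eq_bigr => i _; rewrite mulr_sumr.
rewrite mulr_natl mulr2n [X in _ <= _ + X](exchange_big_dep xpredT)//= -big_split/=.
apply: ler_sum => i _; rewrite [X in _ <= X + _]big_mkcond [X in _ <= _ + X]big_mkcond -big_split/=.
apply: ler_sum => j _; case: (leP (rho j) (rho i)) => [_|/ltW ->]; last by rewrite add0r mulrC.
by rewrite lerDl; case: ifP => // _; rewrite mulr_ge0.
Qed.

(** Expand the square and keep the products [a i * a j] with [rho j <= rho i].  Only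
    sets [D j] that meet [D i] contribute, with total at most
    [a i * (L * mu (D i)) <= L * m i] by packing. *)
Lemma almost_orthogonal :
  (\int[mu]_y ((\sum_(j < N) a j * \1_(D j) y) ^+ 2)%:E <=
   (2 * L * \sum_(j < N) m j)%:E)%E.
Proof.
have fDI i j : mu (D i `&` D j) = (fine (mu (D i `&` D j)))%:E.
  rewrite fineK// ge0_fin_numE//; apply: le_lt_trans (fD i).
  by apply: le_mu => //; exact: measurableI.
pose P i j := (rho j <= rho i) && `[< D i `&` D j !=set0 >].
have mP i j : measurable_fun setT (fun y => (a i * a j * \1_(D i `&` D j) y)%:E).
  apply/measurable_EFinP/measurable_funM => //; apply: measurable_indic.
  exact: measurableI.
apply: (@le_trans _ _ (\int[mu]_y (2%:E * \sum_(i < N) \sum_(j < N | P i j)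
    (a i * a j * \1_(D i `&` D j) y)%:E))%E).
  apply: ge0_le_integral => //.
  - by move=> y _; rewrite lee_fin sqr_ge0.
  - apply/measurable_EFinP/measurable_funX; apply: measurable_sum => j.
    by apply: measurable_funM => //; exact: measurable_indic.
  - apply: measurable_funeM; apply: emeasurable_sum => i.
    by under eq_fun do rewrite big_mkcond/=; apply: emeasurable_sum => j; case: (P i j).
  move=> y _; rewrite [X in (2%:E * X)%E](_ : _ = (\sum_(i < N) \sum_(j < N | P i j)
      (a i * a j * \1_(D i `&` D j) y))%:E); last first.
    by rewrite -sumEFin; apply: eq_bigr => i _; rewrite sumEFin.
  rewrite -EFinM lee_fin.
  apply: le_trans (@square_sum_le (fun j => a j * \1_(D j) y) _) _.
    by move=> j; rewrite mulr_ge0.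
  rewrite ler_pM2l//; apply: ler_sum => i _; rewrite big_mkcond [leRHS]big_mkcond.
  apply: ler_sum => j _; rewrite /P; case: ifP => //= _.
  rewrite !indicE in_setI; case: asboolP => h.
    rewrite le_eqVlt; apply/orP; left; apply/eqP.
    by case: (y \in D i); case: (y \in D j); rewrite /= ?mulr1 ?mulr0 ?mul0r.
  case: (boolP (y \in D i)) => [/set_mem yi|_]; last by rewrite mulr0 mul0r.
  case: (boolP (y \in D j)) => [/set_mem yj|_]; last by rewrite !mulr0.
  by exfalso; apply: h; exists y.
rewrite ge0_integralZl_EFin//; last 2 first.
- by move=> y _; apply: sume_ge0 => i _; apply: sume_ge0 => j _; rewrite lee_fin !mulr_ge0.
- apply: emeasurable_sum => i.
  by under eq_fun do rewrite big_mkcond/=; apply: emeasurable_sum => j; case: (P i j).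
rewrite -mulrA EFinM; apply: lee_wpmul2l => //.
rewrite ge0_integral_sum//; last 2 first.
- move=> i; under eq_fun do rewrite big_mkcond/=.
  by apply: emeasurable_sum => j; case: (P i j).
- by move=> i y _; apply: sume_ge0 => j _; rewrite lee_fin !mulr_ge0.
rewrite mulr_sumr -sumEFin; apply: lee_sum => i _.
under eq_integral do rewrite big_mkcond/=.
rewrite ge0_integral_sum//; last 2 first.
- by move=> j; case: (P i j).
- by move=> j y _; case: ifP => // _; rewrite lee_fin !mulr_ge0.
apply: (@le_trans _ _ (\sum_(j < N) (if P i j then a i * m j else 0)%:E)%E).
  apply: lee_sum => j _; case: ifP => _; last by rewrite integral0.
  under eq_integral do rewrite EFinM.
  rewrite ge0_integralZl_EFin ?mulr_ge0//; last first.
    by apply/measurable_EFinP/measurable_indic; exact: measurableI.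
  rewrite integral_indic//; last exact: measurableI.
  rewrite setIT fDI -EFinM lee_fin -mulrA ler_wpM2l//.
  apply: le_trans (am j); rewrite ler_wpM2l// fine_le//.
  + by rewrite fDI.
  + by rewrite ge0_fin_numE.
  + by apply: le_mu => //; exact: measurableI.
rewrite sumEFin lee_fin -big_mkcond/= -mulr_sumr.
apply: le_trans (ler_wpM2l (a0 i) (pack (ltn_ord i))) _.
by rewrite mulrCA ler_wpM2l.
Qed.

End almost_orthogonality.

(** * Linear operators on L_2 *)

Section L2_operators.
Context {R : realType} {d : measure_display} {X : measurableMetricType d R}.
Variable (mu : {measure set X -> \bar R}).

Lemma cLp2D (f g : X -> R[i]) : cLp mu 2%:E f -> cLp mu 2%:E g ->
  cLp mu 2%:E (fun x => f x + g x).
Proof.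
move=> /cLp2P[m1 l1] /cLp2P[m2 l2]; apply/cLp2P; split; first exact: cmeasurableD.
by apply: le_lt_trans (L2massD mu m1 m2) _; rewrite lte_add_pinfty// lte_mul_pinfty.
Qed.

Lemma cLp2Z (a : R[i]) (f : X -> R[i]) : cLp mu 2%:E f -> cLp mu 2%:E (fun x => a * f x).
Proof.
move=> /cLp2P[m1 l1]; apply/cLp2P; split.
  by apply: cmeasurableM => //; exact: cmeasurable_cst.
by rewrite L2massZ// lte_mul_pinfty ?lee_fin ?sqr_ge0.
Qed.

Lemma cLp2_0 : cLp mu 2%:E (fun _ : X => 0 : R[i]).
Proof.
apply/cLp2P; split; first exact: cmeasurable_cst.
rewrite /L2mass; under eq_integral do rewrite normc0 expr0n/=.
by rewrite integral0 ltry.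
Qed.

Lemma cLp2_bounded (hB : is_Borel X) (hfin : finite_on_bounded mu) (b : X -> R)
  (z : X) (r B : R) : measurable_fun setT b -> (forall y, `|b y| <= B) ->
  (forall y, ~ ball z r y -> b y = 0) -> cLp mu 2%:E (fun x => (b x)%:C).
Proof.
move=> mb bB b0; have B0 : 0 <= B by apply: le_trans (bB z).
apply/cLp2P; split; first exact: cmeasurable_real.
apply: (@le_lt_trans _ _ (B%:E * \int[mu]_y `|b y|%:E)%E); last first.
  by rewrite (bounded_mass hB hfin mb bB b0) lte_mul_pinfty ?lee_fin ?ltry.
rewrite -ge0_integralZl_EFin//; last by apply/measurable_EFinP; exact: measurableT_comp.
apply: ge0_le_integral => //.
- by move=> x _; rewrite lee_fin sqr_ge0.
- by apply: measurable_Enormc2; exact: cmeasurable_real.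
- by apply: measurable_funeM; apply/measurable_EFinP; exact: measurableT_comp.
by move=> x _; rewrite -EFinM lee_fin normc_real expr2 ler_wpM2r.
Qed.

Variable T : (X -> R[i]) -> (X -> R[i]).
Hypothesis Tlin : linear_on_Lp mu 2%:E T.

Lemma linear_L2D (f g : X -> R[i]) : cLp mu 2%:E f -> cLp mu 2%:E g ->
  {ae mu, forall x, T (fun y => f y + g y) x = T f x + T g x}.
Proof.
move=> f2 g2; have := Tlin 1 f2 g2; apply: filterS => x.
by rewrite mul1r => <-; congr T; apply/funext => y; rewrite mul1r.
Qed.

Lemma linear_L2_0 : {ae mu, forall x, T (fun=> 0) x = 0}.
Proof.
have := linear_L2D cLp2_0 cLp2_0; apply: filterS => x.
rewrite (_ : (fun y => 0 + 0) = (fun=> 0)); last by apply/funext => y; rewrite addr0.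
by move=> h; apply: (addIr (T (fun=> 0) x)); rewrite add0r.
Qed.

Lemma linear_L2_sum (N : nat) (u : nat -> X -> R[i]) :
  (forall j, cLp mu 2%:E (u j)) ->
  cLp mu 2%:E (fun y => \sum_(j < N) u j y) /\
  {ae mu, forall x, T (fun y => \sum_(j < N) u j y) x = \sum_(j < N) T (u j) x}.
Proof.
move=> u2; elim: N => [|N [IH1 IH2]].
  rewrite (_ : (fun y => \sum_(j < 0) u j y) = (fun=> 0)); last first.
    by apply/funext => y; rewrite big_ord0.
  split; first exact: cLp2_0.
  by apply: filterS linear_L2_0 => x ->; rewrite big_ord0.
rewrite (_ : (fun y => \sum_(j < N.+1) u j y) =
             (fun y => \sum_(j < N) u j y + u N y)); last first.
  by apply/funext => y; rewrite big_ord_recr.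
split; first exact: cLp2D.
apply: filterS2 IH2 (linear_L2D IH1 (u2 N)) => x h1 ->.
by rewrite h1 big_ord_recr.
Qed.

Lemma absintegral_sum D (N : nat) (u : nat -> X -> R[i]) : measurable D ->
  (forall j, cmeasurable (u j)) ->
  (absintegral mu D (fun x => \sum_(j < N) u j x)%R <=
   \sum_(j < N) absintegral mu D (u j))%E.
Proof.
move=> mD mU; elim: N => [|N IH].
  rewrite big_ord0 /absintegral; under eq_integral do rewrite big_ord0 normc0.
  by rewrite integral0.
rewrite big_ord_recr/=; apply: le_trans (leeD IH (lexx _)).
rewrite (_ : (fun y => \sum_(j < N.+1) u j y) =
             (fun y => \sum_(j < N) u j y + u N y)); last first.
  by apply/funext => y; rewrite big_ord_recr.
by apply: absintegralD => //; apply: cmeasurable_sum.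
Qed.

End L2_operators.

(** * Weak type estimate for nonnegative bounded functions *)

Section weak_type_nonneg.
Context {R : realType} {d : measure_display} {X : measurableMetricType d R}.
Variables (mu : {measure set X -> \bar R}) (lam : X -> R -> R) (Cl : R).
Hypotheses (hB : is_Borel X) (hG : geometrically_doubling X).
Hypothesis hfin : finite_on_bounded mu.
Hypotheses (lam0 : forall x r, 0 < r -> 0 < lam x r)
  (lam_nd : forall x r s, 0 < r -> r <= s -> lam x r <= lam x s)
  (lam_mu : forall x r, 0 < r -> (mu (ball x r) <= (lam x r)%:E)%E)
  (lam_dbl : forall x r, 0 < r -> lam x r <= Cl * lam x (r / 2)).
Variables (K : X -> X -> R[i]) (C tau : R).
Hypotheses (C0 : 0 < C) (tau01 : 0 < tau <= 1).
Hypothesis Ksize : forall x y, x != y -> normc (K x y) <= C / lam x (mdist x y).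
Hypothesis Ksmooth : forall x y y', x != y -> mdist y y' <= mdist x y / 2 ->
  normc (K x y - K x y') <=
  C * (mdist y y' `^ tau / (mdist x y `^ tau * lam x (mdist x y))).
Variable T : (X -> R[i]) -> (X -> R[i]).
Hypothesis TK : forall f, test_function f ->
  {ae mu, forall x, ~ csupport f x ->
    T f x = cintegral mu setT (fun y => K x y * f y)}.
Hypothesis Tlin : linear_on_Lp mu 2%:E T.
Variable C2 : R.
Hypothesis C20 : 0 < C2.
Hypothesis TL2 : forall f, cLp mu 2%:E f ->
  cmeasurable (T f) /\ (L2mass mu (T f) <= C2%:E * L2mass mu f)%E.

Let beta := 2 * Cl ^+ 4.
Let lc := local_const Cl C tau C2.

(** The first term is for the union of the stopping balls, the second for the part of
    [f] that is in [L_2], the third for the pieces with vanishing mean. *)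
Definition weak_const : R := 2 + C2 * (2 + 4 * beta) + lc.

Variables (f : X -> R) (B : R) (x0 : X) (r0 : R) (t : R).
Hypotheses (mf : measurable_fun setT f) (f0 : forall x, 0 <= f x)
  (fB : forall x, f x <= B) (f_out : forall x, ~ ball x0 r0 x -> f x = 0).
Hypothesis t0 : 0 < t.

Let I := fine (\int[mu]_x (f x)%:E)%E.
Let B0 : 0 <= B. Proof. exact: le_trans (f0 x0) (fB x0). Qed.
Let IE : (\int[mu]_x (f x)%:E = I%:E)%E.
Proof.
have fB' y : `|f y| <= B by rewrite ger0_norm.
have := bounded_mass hB hfin mf fB' f_out.
have -> : (\int[mu]_y `|f y|%:E = \int[mu]_y (f y)%:E)%E.
  by apply: eq_integral => y _; rewrite ger0_norm.
by [].
Qed.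
Let I0 : 0 <= I.
Proof. by rewrite fine_ge0// integral_ge0// => x _; rewrite lee_fin. Qed.

Let C1 : 1 <= Cl. Proof. exact: (doubling_ge1 lam0 lam_nd lam_dbl x0). Qed.
Let beta0 : 0 < beta.
Proof. by rewrite mulr_gt0// exprn_gt0// (lt_le_trans ltr01). Qed.
Let lc0 : 0 <= lc.
Proof. exact: (local_const_ge0 lam0 lam_nd lam_dbl C0 tau01 C20 x0). Qed.

Let tb0 : 0 <= t * beta. Proof. exact: mulr_ge0 (ltW t0) (ltW beta0). Qed.

Let bad_level := [set x | 3 * t < normc (T (fun x => (f x)%:C) x)].

Let f_L2 : cLp mu 2%:E (fun x => (f x)%:C).
Proof.
have fB' y : `|f y| <= B by rewrite ger0_norm.
exact: (cLp2_bounded hB hfin mf fB' f_out).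
Qed.

Let mbad : measurable bad_level.
Proof. by apply: measurable_normc_gt; have [] := TL2 f_L2. Qed.

Section stopped.
Variables (e : R) (N : nat) (z : nat -> X) (s : nat -> R).
Let F := [set x | t < f x].
Let h x := f x * \1_F x.
Hypotheses (e0 : 0 < e) (s0 : forall j, 0 < s j).
Hypothesis cover : (mu (F `\` \bigcup_(j < N) ball (z j) (s j / 2)) <= e%:E)%E.
Let U := \bigcup_(j < N) ball (z j) (s j).
Hypothesis Usmall : (mu U <= mu F + e%:E + (t^-1)%:E * I%:E)%E.
Hypothesis stop : forall j r, s j < r ->
  (\int[mu]_(x in ball (z j) r) (h x)%:E <= t%:E * mu (ball (z j) (4 * r)))%E.
Variable k : nat -> nat.
Let M j l := fine (mu (ball (z j) (16 ^+ l * s j))).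
Hypothesis kP : forall j, M j (k j).+1 <= beta * M j (k j) /\
  forall l, (l <= k j)%N -> beta ^+ (k j - l) * M j l.+1 <= beta * M j (k j).+1.

Let mbl x r : measurable (ball x r : set X). Proof. exact: measurable_mball. Qed.
Let mF : measurable F.
Proof.
rewrite -[X in measurable X]setTI.
have -> : F = f @^-1` `]t, +oo[.
  by apply/seteqP; split => x /=; rewrite in_itv/= andbT.
by apply: mf => //; exact: measurable_itv.
Qed.
Let mh : measurable_fun setT h.
Proof. by apply: measurable_funM => //; exact: measurable_indic. Qed.
Let h0 x : 0 <= h x. Proof. by rewrite mulr_ge0. Qed.
Let hf x : h x <= f x.
Proof. by rewrite /h indicE ler_piMr// lern1 leq_b1. Qed.
Let hBd x : h x <= B. Proof. exact: le_trans (hf x) (fB x). Qed.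
Let mU : measurable U. Proof. exact: bigcup_measurable. Qed.

Let G j := F `&` ball (z j) (s j / 2).
Let E := seqDU G.
Let mG j : measurable (G j). Proof. exact: measurableI. Qed.
Let mE j : measurable (E j).
Proof. by apply: measurableD => //; exact: bigsetU_measurable. Qed.
Let EG j : E j `<=` G j. Proof. by move=> x []. Qed.
Let Edisj i j : i != j -> E i `&` E j = set0.
Proof. by move=> ij; have /trivIsetP := trivIset_seqDU G; apply. Qed.

Let m j := fine (\int[mu]_(x in E j) (h x)%:E)%E.
Let g j x := h x * \1_(E j) x.
Let p j x := m j / M j (k j) * \1_(ball (z j) (16 ^+ k j * s j)) x.
Let b j x := g j x - p j x.

Let int_h_le D : measurable D -> (\int[mu]_(x in D) (h x)%:E <= I%:E)%E.
Proof.
move=> mD; rewrite -IE; apply: (@le_trans _ _ (\int[mu]_(x in D) (f x)%:E)%E).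
  apply: ge0_le_integral => //.
  - by move=> x _; rewrite lee_fin.
  - by apply/measurable_EFinP; exact: measurable_funTS.
  - by apply/measurable_EFinP; exact: measurable_funTS.
  - by move=> x _; rewrite lee_fin.
apply: ge0_subset_integral => //; first exact/measurable_EFinP.
by move=> x _; rewrite lee_fin.
Qed.

Let m_int j : (\int[mu]_(x in E j) (h x)%:E = (m j)%:E)%E.
Proof.
rewrite fineK// ge0_fin_numE; last by apply: integral_ge0 => x _; rewrite lee_fin.
exact: le_lt_trans (int_h_le (mE j)) (ltry _).
Qed.
Let m0 j : 0 <= m j.
Proof. by rewrite fine_ge0// integral_ge0// => x _; rewrite lee_fin. Qed.
Let M0 j l : 0 <= M j l. Proof. by rewrite fine_ge0. Qed.

Let sum_m (P : pred nat) D : measurable D ->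
  (forall j, P j -> E j `<=` D) ->
  ((\sum_(j < N | P j) m j)%:E <= \int[mu]_(x in D) (h x)%:E)%E.
Proof.
move=> mD PD; rewrite -sumEFin.
rewrite (eq_bigr (fun j : 'I_N => \int[mu]_(x in E j) (h x)%:E)%E); last first.
  by move=> j _; rewrite m_int.
rewrite -(big_mkord P (fun j => \int[mu]_(x in E j) (h x)%:E)%E) -big_filter.
rewrite -[leRHS]mul1e; apply: overlap_integral => //.
- by move=> i; rewrite mem_filter => /andP[Pi _]; split=> //; exact: PD.
- move=> x; apply: disjoint_indic_sum; first by rewrite filter_uniq// iota_uniq.
  by move=> i j _ _; exact: Edisj.
Qed.

Let sum_m_le : \sum_(j < N) m j <= I.
Proof.
rewrite -lee_fin; apply: le_trans (@sum_m xpredT setT measurableT _) _ => //.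
exact: int_h_le.
Qed.

Let EB j : E j `<=` ball (z j) (s j / 2).
Proof. by move=> x /EG[]. Qed.

Let pr j l : 0 < 16 ^+ l * s j :> R.
Proof. by apply: mulr_gt0 (s0 j); apply: exprn_gt0. Qed.

Let s_le j : s j <= 16 ^+ k j * s j.
Proof.
rewrite -[leLHS]mul1r; apply: ler_wpM2r; first exact: ltW.
by apply: exprn_ege1; rewrite ler1n.
Qed.

Let ER j : E j `<=` ball (z j) (16 ^+ k j * s j).
Proof.
apply: subset_trans (@EB j) _; apply: le_ball; apply: le_trans (s_le j).
by rewrite ler_pdivrMr// ler_peMr ?ler1n// ltW.
Qed.

(** [almost_orthogonal] applies with [L = t * beta]: pieces whose doubling ball is not
    larger than the [i]-th and meets it are inside the ball of three times its
    radius, where the stopping condition and the doubling property bound their mass. *)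
Let averages_L2 :
  (\int[mu]_y ((\sum_(j < N) p j y) ^+ 2)%:E <= (2 * (t * beta) * I)%:E)%E.
Proof.
apply: (@le_trans _ _ (2 * (t * beta) * \sum_(j < N) m j)%:E); last first.
  by rewrite lee_fin; apply: ler_wpM2l => //; exact: mulr_ge0.
apply: (@almost_orthogonal _ _ _ mu N (fun j => m j / M j (k j)) m
  (fun j => 16 ^+ k j * s j) (fun j => ball (z j) (16 ^+ k j * s j)) (t * beta)) => //.
- by move=> j; rewrite divr_ge0.
- move=> j; rewrite -/(M j (k j)).
  by have [->|?] := eqVneq (M j (k j)) 0; [rewrite mulr0|rewrite divfK].
move=> i iN; set rho := 16 ^+ k i * s i.
rewrite -lee_fin; apply: le_trans (@sum_m (fun j => (16 ^+ k j * s j <= rho) &&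
    `[< ball (z i) rho `&` ball (z j) (16 ^+ k j * s j) !=set0 >])
  (ball (z i) (3 * rho)) (mbl _ _) _) _.
  move=> j /andP[rji /asboolP[y [/ballP y1 /ballP y2]]].
  apply: subset_trans (@ER j) _; apply: subset_mball.
  have := metric_triangle (z i) y (z j); rewrite (metric_sym y (z j)) -/rho in rji y1 *.
  by move=> h1; lra.
apply: le_trans (stop _) _.
  by have := s_le i; have := pr i (k i); rewrite -/rho; lra.
have fb : mu (ball (z i) (16 ^+ (k i).+1 * s i)) = (M i (k i).+1)%:E.
  by rewrite fineK// ge0_fin_numE// hfin.
apply: (@le_trans _ _ (t%:E * (M i (k i).+1)%:E)%E).
  rewrite lee_wpmul2l ?lee_fin ?(ltW t0)// -fb; apply: le_mu => //; apply: le_ball.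
  by rewrite exprS -mulrA -/rho; have := pr i (k i); rewrite -/rho; lra.
rewrite -EFinM lee_fin -mulrA ler_wpM2l ?(ltW t0)//.
by have [+ _] := kP i.
Qed.

Let f1 x := f x * \1_(~` F) x.
Let W := \bigcup_(j < N) E j.
Let err x := h x * \1_(~` W) x.
Let gg x := f1 x + \sum_(j < N) p j x.

Let W_err x : h x = \sum_(j < N) g j x + err x.
Proof.
rewrite /err indicE in_setC.
have [[j /= jN Ej]|nW] := pselect (W x).
  rewrite mem_set; last by exists j.
  rewrite mulr0 addr0 (bigD1 (Ordinal jN))//= {1}/g indicE mem_set// mulr1 big1 ?addr0//.
  move=> i; rewrite -val_eqE /= => ij; rewrite /g indicE memNset ?mulr0// => Ei.
  have := Edisj ij; rewrite -subset0 => /(_ x); exact.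
rewrite memNset//= mulr1 big1 ?add0r// => j _; rewrite /g indicE memNset ?mulr0// => Ej.
by apply: nW; exists j => //=.
Qed.

Let decomposition x : f x = gg x + \sum_(j < N) b j x + err x.
Proof.
have hs := W_err x.
have -> : \sum_(j < N) b j x = \sum_(j < N) g j x - \sum_(j < N) p j x.
  by rewrite /b sumrB.
have -> : gg x + (\sum_(j < N) g j x - \sum_(j < N) p j x) + err x =
  f1 x + (\sum_(j < N) g j x + err x) by rewrite /gg; ring.
rewrite -hs /f1 /h !indicE in_setC.
by case: (x \in F); rewrite /= ?mulr1 ?mulr0 ?add0r ?addr0.
Qed.

Let absB j y : `|b j y| <= B + m j / M j (k j).
Proof.
apply: le_trans (ler_normB _ _) _; apply: lerD.
  have g0 : 0 <= g j y by exact: mulr_ge0.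
  by rewrite ger0_norm // /g indicE; apply: le_trans (hBd y); rewrite ler_piMr// lern1 leq_b1.
have c0 : 0 <= m j / M j (k j) by exact: divr_ge0.
have p0 : 0 <= p j y by exact: mulr_ge0.
by rewrite ger0_norm// /p indicE ler_piMr// lern1 leq_b1.
Qed.

Let mg j : measurable_fun setT (g j).
Proof. by apply: measurable_funM => //; exact: measurable_indic. Qed.
Let mp j : measurable_fun setT (p j).
Proof. by apply: measurable_funM => //; exact: (measurable_indic (mbl _ _)). Qed.
Let mb j : measurable_fun setT (b j).
Proof. exact: measurable_funB. Qed.
Let msp : measurable_fun setT (fun x => \sum_(j < N) p j x).
Proof. by apply: measurable_sum => j; exact: mp. Qed.
Let mf1 : measurable_fun setT f1.
Proof. by apply: measurable_funM => //; apply: measurable_indic; exact: measurableC. Qed.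
Let mgg : measurable_fun setT gg.
Proof. exact: measurable_funD. Qed.
Let mW : measurable W. Proof. exact: bigcup_measurable. Qed.
Let merr : measurable_fun setT err.
Proof. by apply: measurable_funM => //; apply: measurable_indic; exact: measurableC. Qed.

Let b_L2 j : cLp mu 2%:E (fun x => (b j x)%:C).
Proof.
apply: (cLp2_bounded hB hfin (mb j) (@absB j) (z := z j) (r := 16 ^+ k j * s j)).
move=> y ny; rewrite /b /g /p !indicE !memNset ?mulr0 ?subr0//.
by move/ER.
Qed.

Let f1_L2 : (L2mass mu (fun x => (f1 x)%:C) <= (t * I)%:E)%E.
Proof.
rewrite EFinM -IE -ge0_integralZl_EFin ?(ltW t0)//; last 2 first.
- by move=> x _; rewrite lee_fin.
- exact/measurable_EFinP.
apply: ge0_le_integral => //.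
- by move=> x _; rewrite lee_fin sqr_ge0.
- by apply: measurable_Enormc2; exact: cmeasurable_real.
- by apply: measurable_funeM; exact/measurable_EFinP.
move=> x _; rewrite -EFinM lee_fin normc_real /f1 indicE in_setC.
case: (boolP (x \in F)) => [_|]; first by rewrite mulr0 normr0 expr0n/= mulr_ge0// ltW.
rewrite notin_setE => /negP; rewrite -leNgt mulr1 ger0_norm// expr2 => ft.
by rewrite ler_wpM2r.
Qed.

Let gg_mass : cLp mu 2%:E (fun x => (gg x)%:C) /\
  (L2mass mu (fun x => (gg x)%:C) <= (t * ((2 + 4 * beta) * I))%:E)%E.
Proof.
have h1 : (L2mass mu (fun x => (gg x)%:C) <= (t * ((2 + 4 * beta) * I))%:E)%E.
  have -> : (fun x => (gg x)%:C) =
      (fun x => (f1 x)%:C + (\sum_(j < N) p j x)%:C).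
    by apply/funext => x; rewrite -rmorphD.
  apply: le_trans (L2massD mu _ _) _; [exact: cmeasurable_real|exact: cmeasurable_real|].
  have -> : ((t * ((2 + 4 * beta) * I))%:E =
      2%:E * (t * I)%:E + 2%:E * (2 * (t * beta) * I)%:E)%E.
    by rewrite -!EFinM -EFinD; congr EFin; ring.
  apply: leeD; apply: lee_wpmul2l => //.
  rewrite /L2mass; under eq_integral do rewrite normc_real real_normK ?num_real//.
  exact: averages_L2.
split=> //; apply/cLp2P; split; first exact: cmeasurable_real.
exact: le_lt_trans h1 (ltry _).
Qed.

Let err_mass : cLp mu 2%:E (fun x => (err x)%:C) /\
  (L2mass mu (fun x => (err x)%:C) <= (B ^+ 2 * e)%:E)%E.
Proof.
have mFW : measurable (F `\` W) by exact: measurableD.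
have h1 : (L2mass mu (fun x => (err x)%:C) <= (B ^+ 2 * e)%:E)%E.
  apply: (@le_trans _ _ ((B ^+ 2)%:E * \int[mu]_x (\1_(F `\` W) x)%:E)%E).
    rewrite -ge0_integralZl_EFin ?sqr_ge0//; last first.
      by apply/measurable_EFinP; exact: measurable_indic.
    apply: ge0_le_integral => //.
    - by move=> x _; rewrite lee_fin sqr_ge0.
    - by apply: measurable_Enormc2; exact: cmeasurable_real.
    - by apply: measurable_funeM; apply/measurable_EFinP; exact: measurable_indic.
    move=> x _; rewrite -EFinM lee_fin normc_real real_normK ?num_real//.
    rewrite /err /h !indicE in_setD in_setC.
    case: (x \in F); case: (x \in W); rewrite /= ?mulr1 ?mulr0 ?mul0r ?expr0n//=.
    by rewrite ler_sqr ?nnegrE.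
  rewrite integral_indic// setIT (EFinM _ e).
  apply: lee_wpmul2l; first by rewrite lee_fin sqr_ge0.
  apply: le_trans cover; apply: le_mu => //.
    by apply: measurableD => //; exact: bigcup_measurable.
  move=> x [Fx nW]; split=> // -[j /= jN zx]; apply: nW.
  have : (\bigcup_(i < N) G i) x by exists j.
  by rewrite bigcup_mkord bigsetU_seqDU -bigcup_mkord.
split=> //; apply/cLp2P; split; first exact: cmeasurable_real.
exact: le_lt_trans h1 (ltry _).
Qed.

Let Tf_split : {ae mu, forall x, T (fun x => (f x)%:C) x =
  T (fun x => (gg x)%:C) x + \sum_(j < N) T (fun x => (b j x)%:C) x +
  T (fun x => (err x)%:C) x}.
Proof.
have [gg2 _] := gg_mass; have [err2 _] := err_mass.
have [sb2 sbE] := linear_L2_sum Tlin N b_L2.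
have e1 := linear_L2D Tlin gg2 sb2.
have e2 := linear_L2D Tlin (cLp2D gg2 sb2) err2.
have fE : (fun x => (f x)%:C) = (fun x => (gg x)%:C + \sum_(j < N) (b j x)%:C + (err x)%:C).
  apply/funext => x; rewrite decomposition !rmorphD/=; congr (_ + _ + _).
  by rewrite rmorph_sum.
apply: filterS3 sbE e1 e2 => x h1 h2 h3.
by rewrite fE h3 h2 h1.
Qed.

Let far_from_stopped : (t%:E * mu (~` U `&` [set x | (t < normc
    (\sum_(j < N) T (fun x => (b j x)%:C) x))%R]) <= (lc * I)%:E)%E.
Proof.
have mT j : cmeasurable (T (fun x => (b j x)%:C)) by have [] := TL2 (b_L2 j).
have mCU : measurable (~` U) by exact: measurableC.
have msT : cmeasurable (fun x => \sum_(j < N) T (fun x => (b j x)%:C) x).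
  exact: cmeasurable_sum.
apply: le_trans (absintegral_lt mu mCU msT t0) _.
apply: le_trans (absintegral_sum mu N mCU mT) _.
apply: (@le_trans _ _ (\sum_(j < N) (lc * m j)%:E)%E); last first.
  by rewrite sumEFin lee_fin -mulr_sumr ler_wpM2l.
apply: lee_sum => j _.
have [k2 k3] := kP j.
apply: le_trans _ (local_estimate hB hfin lam0 lam_nd lam_mu lam_dbl C0 tau01 Ksize
  Ksmooth TK Tlin TL2 (s0 j) k2 k3 mh h0 hBd (mE j) (@EB j)).
apply: le_absintegral => //.
  by rewrite -annulus_bigcup//; apply: bigcup_measurable => i _; exact: measurable_annulus.
move=> x /= nU; rewrite leNgt; apply/negP => xz; apply: nU.
by exists j => //=; exact/ballP.
Qed.

(** The bad level set is covered by the stopping balls and the sets where [T] of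
    the good part [gg], of the sum of the [b j], and of the uncovered remainder [err]
    exceeds [t]. *)
Lemma stopped_bound :
  (t%:E * mu bad_level <= (weak_const * I + (t + C2 * B ^+ 2 / t) * e)%:E)%E.
Proof.
have [gg2 ggm] := gg_mass; have [err2 errm] := err_mass.
have [mTg lTg] := TL2 gg2; have [mTe lTe] := TL2 err2.
pose w x := \sum_(j < N) T (fun x => (b j x)%:C) x.
have mw : cmeasurable w.
  by apply: cmeasurable_sum => j; have [] := TL2 (b_L2 j).
pose Dg := [set x | t < normc (T (fun x => (gg x)%:C) x)].
pose Dw := ~` U `&` [set x | t < normc (w x)].
pose De := [set x | t < normc (T (fun x => (err x)%:C) x)].
have mDg : measurable Dg by exact: measurable_normc_gt.
have mDe : measurable De by exact: measurable_normc_gt.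
have mDw : measurable Dw.
  by apply: measurableI; [exact: measurableC|exact: measurable_normc_gt].
have h1 : (mu bad_level <= mu (((U `|` Dg) `|` Dw) `|` De))%E.
  apply: le_mu_ae => //; first by do 3 (apply: measurableU => //).
  apply: filterS Tf_split => x Tx; rewrite /bad_level /= Tx => lt3.
  have [Ux|nU] := pselect (U x); first by left; left; left.
  have [gx|/negP gx] := pselect (Dg x); first by left; left; right.
  have [ex|/negP ex] := pselect (De x); first by right.
  left; right; split=> //=; rewrite ltNge; apply/negP => wx.
  move: lt3; apply/negP; rewrite -leNgt; rewrite -leNgt in gx; rewrite -leNgt in ex.
  apply: le_trans (normc_triangle _ _) _; apply: le_trans (lerD (normc_triangle _ _) (lexx _)) _.
  have -> : 3 * t = t + t + t by ring.
  by apply: lerD => //; exact: lerD.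
have h2 : (mu bad_level <= mu U + mu Dg + mu Dw + mu De)%E.
  apply: (le_trans h1); apply: le_trans (measureU2 _ _ _) _ => //.
    by do 2 (apply: measurableU => //).
  apply: leeD => //; apply: le_trans (measureU2 _ _ _) _ => //.
    exact: measurableU.
  by apply: leeD => //; exact: measureU2.
have tp : (0 < t%:E)%E by rewrite lte_fin.
have square_div D c : (((t ^+ 2)%:E * mu D <= (t * c)%:E) -> t%:E * mu D <= c%:E)%E.
  by rewrite expr2 !EFinM -muleA lee_pmul2l.
have bF : (t%:E * mu F <= I%:E)%E.
  have := @absintegral_lt _ _ _ mu setT _ t measurableT (cmeasurable_real mf) t0.
  rewrite setTI; have -> : [set x | t < normc ((f x)%:C)] = F.
    by apply/funext => x; rewrite /F /mkset normc_real ger0_norm.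
  move=> h3; apply: (le_trans h3); rewrite -IE le_eqVlt; apply/orP; left; apply/eqP.
  by apply: eq_integral => x _; rewrite normc_real ger0_norm.
have bU : (t%:E * mu U <= (2 * I + t * e)%:E)%E.
  apply: le_trans (lee_wpmul2l (ltW tp) Usmall) _.
  have tI0 : (0 <= (t^-1)%:E * I%:E)%E.
    by rewrite -EFinM lee_fin mulr_ge0 ?invr_ge0 ?(ltW t0).
  have e0E : (0 <= e%:E)%E by rewrite lee_fin ltW.
  rewrite ge0_muleDr ?adde_ge0// ge0_muleDr//.
  rewrite -!EFinM mulrA divff ?gt_eqF// mul1r.
  have -> : (2 * I + t * e = I + t * e + I)%R by ring.
  by rewrite 2!EFinD; do 2 (apply: leeD => //).
have bg : (t%:E * mu Dg <= (C2 * (2 + 4 * beta) * I)%:E)%E.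
  apply: square_div; apply: le_trans (L2mass_lt mu mTg t0) _; apply: (le_trans lTg).
  apply: le_trans (lee_wpmul2l _ ggm) _; first by rewrite lee_fin ltW.
  by rewrite -EFinM lee_fin le_eqVlt; apply/orP; left; apply/eqP; ring.
have be : (t%:E * mu De <= (C2 * B ^+ 2 / t * e)%:E)%E.
  apply: square_div; apply: le_trans (L2mass_lt mu mTe t0) _; apply: (le_trans lTe).
  apply: le_trans (lee_wpmul2l _ errm) _; first by rewrite lee_fin ltW.
  rewrite -EFinM lee_fin le_eqVlt; apply/orP; left; apply/eqP.
  by field; rewrite gt_eqF.
apply: le_trans (lee_wpmul2l (ltW tp) h2) _.
rewrite !ge0_muleDr//; try by rewrite !adde_ge0.
have -> : weak_const * I + (t + C2 * B ^+ 2 / t) * e =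
  (2 * I + t * e) + C2 * (2 + 4 * beta) * I + lc * I + C2 * B ^+ 2 / t * e.
  by rewrite /weak_const; ring.
rewrite !EFinD; apply: leeD => //; apply: leeD; last exact: far_from_stopped.
exact: leeD.
Qed.

End stopped.

(** If the integral of [f] is at least [t * mu setT], the estimate is trivial;
    otherwise the stopping balls exist, and the error [e] of the covering tends to 0. *)
Lemma weak_nonneg :
  (t%:E * mu [set x | (3 * t < normc (T (fun x => (f x)%:C) x))%R] <=
   weak_const%:E * \int[mu]_x (f x)%:E)%E.
Proof.
rewrite IE -EFinM -/bad_level.
have w1 : 1 <= weak_const.
  rewrite /weak_const -addrA; apply: (@le_trans _ _ 2); first by rewrite ler1n.
  rewrite lerDl addr_ge0// mulr_ge0 ?(ltW C20)// addr_ge0// mulr_ge0// ltW//.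
have [small|big] := ltP I%:E (t%:E * mu setT)%E; last first.
  apply: (@le_trans _ _ (t%:E * mu setT)%E).
    by rewrite lee_wpmul2l ?lee_fin ?(ltW t0)//; exact: le_mu.
  by apply: (le_trans big); rewrite lee_fin ler_peMl.
apply/lee_addgt0Pr => eta eta0.
(* the coefficient of the covering error in stopped_bound *)
pose c := t + C2 * B ^+ 2 / t.
have c0 : 0 < c.
  by rewrite ltr_pwDl// divr_ge0 ?mulr_ge0 ?sqr_ge0 ?(ltW C20) ?(ltW t0).
pose F := [set x | t < f x].
have mF : measurable F.
  rewrite -[X in measurable X]setTI.
  have -> : F = f @^-1` `]t, +oo[.
    by apply/seteqP; split => x /=; rewrite in_itv/= andbT.
  by apply: mf => //; exact: measurable_itv.
have FB : F `<=` ball x0 r0.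
  move=> x Fx; apply: contrapT => /f_out fx; move: Fx; rewrite /F /= fx.
  by rewrite ltNge (ltW t0).
pose h x := f x * \1_F x.
have mh : measurable_fun setT h.
  by apply: measurable_funM => //; exact: measurable_indic.
have h0 x : 0 <= h x by rewrite mulr_ge0.
have hI : (\int[mu]_x (h x)%:E <= I%:E)%E.
  rewrite -IE; apply: ge0_le_integral => //.
  - by move=> x _; rewrite lee_fin.
  - exact/measurable_EFinP.
  - exact/measurable_EFinP.
  - by move=> x _; rewrite lee_fin /h indicE ler_piMr// lern1 leq_b1.
have e0 : 0 < eta / c by rewrite divr_gt0.
have [N [z [s [s0 cov Us st]]]] :=
  stopping_cover hB hG hfin mh h0 t0 (le_lt_trans hI small) mF FB e0.
have /choice[k kP] j := doubling_radius hB hfin lam0 lam_nd lam_mu lam_dbl (z j) (s0 j).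
have Us' : (mu (\bigcup_(j < N) ball (z j) (s j)) <=
    mu F + (eta / c)%:E + (t^-1)%:E * I%:E)%E.
  apply: (le_trans Us); apply: leeD => //; apply: lee_wpmul2l => //.
  by rewrite lee_fin invr_ge0 ltW.
have := stopped_bound e0 s0 cov Us' st kP.
by rewrite -/c (mulrC c) divfK ?gt_eqF// EFinD.
Qed.

End weak_type_nonneg.

(** * Weak type estimate for complex bounded functions *)

Section bounded_bounded_support.
Context {R : realType} {d : measure_display} {X : measurableMetricType d R}.
Variable mu : {measure set X -> \bar R}.
Hypotheses (hB : is_Borel X) (hfin : finite_on_bounded mu).

(** This class is used instead of the test functions because it only mentions the
    zeros of [f], not the closure of its support. *)
Definition bounded_supp (f : X -> R[i]) :=
  [/\ cmeasurable f, exists M : R, forall x, normc (f x) <= M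
    & exists x (r : R), forall y, ~ ball x r y -> f y = 0].

Lemma bounded_supp_majorant f : bounded_supp f -> exists B z (r : R),
  [/\ 0 <= B, 0 < r, (forall y, normc (f y) <= B * \1_(ball z r) y)
    & (mu (ball z r) < +oo)%E].
Proof.
move=> [mf [M fM] [z [r f0]]].
have M0 : 0 <= M by apply: le_trans (normc_ge0 _) (fM z).
exists M, z, (Num.max r 1); split=> //; first by rewrite lt_max ltr01 orbT.
move=> y; rewrite indicE; have [by_|by_] := boolP (y \in _); first by rewrite mulr1.
rewrite mulr0 f0 ?normc0// => ry; move: by_; rewrite notin_setE; apply.
by apply: le_ball ry; rewrite le_max lexx.
Qed.

Lemma bounded_supp_cLp f : bounded_supp f -> cLp mu 1%:E f /\ cLp mu 2%:E f.
Proof.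
move=> nf; have [mf _ _] := nf.
have [B [z [r [B0 r0 fB bf]]]] := bounded_supp_majorant nf.
have mbl : measurable (ball z r) by exact: measurable_mball.
have bound c : 0 <= c -> (\int[mu]_y (c%:E * (\1_(ball z r) y)%:E) < +oo)%E.
  move=> c0; rewrite ge0_integralZl_EFin//; last first.
    by apply/measurable_EFinP; exact: measurable_indic.
  by rewrite integral_indic// setIT lte_mul_pinfty.
split.
  apply/cLp1P; split=> //; apply: le_lt_trans (bound B B0).
  apply: ge0_le_integral => //.
  - by move=> x _; rewrite lee_fin normc_ge0.
  - exact: measurable_Enormc.
  - by apply: measurable_funeM; apply/measurable_EFinP; exact: measurable_indic.
  by move=> x _; rewrite -EFinM lee_fin.
apply/cLp2P; split=> //; apply: le_lt_trans (bound (B ^+ 2) _); last exact: sqr_ge0.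
apply: ge0_le_integral => //.
- by move=> x _; rewrite lee_fin sqr_ge0.
- exact: measurable_Enormc2.
- by apply: measurable_funeM; apply/measurable_EFinP; exact: measurable_indic.
move=> x _; rewrite -EFinM lee_fin; have := fB x; rewrite indicE.
case: (_ \in _); rewrite /= ?mulr1 ?mulr0 => h; first by rewrite ler_sqr ?nnegrE ?normc_ge0.
by rewrite (le_anti (introT andP (conj h (normc_ge0 _)))) expr0n.
Qed.

Lemma bounded_suppD f g : bounded_supp f -> bounded_supp g -> bounded_supp (fun x => f x + g x).
Proof.
move=> nf ng; have [mf _ _] := nf; have [mg _ _] := ng.
have [B [z [r [B0 r0 fB _]]]] := bounded_supp_majorant nf.
have [B' [z' [r' [B'0 r'0 gB _]]]] := bounded_supp_majorant ng.
split; first exact: cmeasurableD.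
  exists (B + B') => x; apply: le_trans (normc_triangle _ _) _; apply: lerD.
    by apply: le_trans (fB x) _; rewrite indicE ler_piMr// lern1 leq_b1.
  by apply: le_trans (gB x) _; rewrite indicE ler_piMr// lern1 leq_b1.
exists z, (r + (mdist z z' + r')) => y ny; apply: eq0_normc; apply/eqP.
rewrite eq_le normc_ge0 andbT; apply: le_trans (normc_triangle _ _) _.
rewrite -[leRHS]addr0; apply: lerD.
  apply: le_trans (fB y) _; rewrite indicE memNset ?mulr0// => zy.
  by apply: ny; apply: le_ball zy; rewrite lerDl addr_ge0 ?(ltW r'0)// mdist_ge0.
apply: le_trans (gB y) _; rewrite indicE memNset ?mulr0// => /ballP zy.
apply: ny; apply/ballP; have := metric_triangle z z' y => h; lra.
Qed.

Lemma bounded_suppZ a f : bounded_supp f -> bounded_supp (fun x => a * f x).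
Proof.
move=> [mf [M fM] [z [r f0]]]; split.
- by apply: cmeasurableM => //; exact: cmeasurable_cst.
- by exists (normc a * M) => x; rewrite normcM ler_wpM2l// normc_ge0.
by exists z, r => y /f0 ->; rewrite mulr0.
Qed.

End bounded_bounded_support.

Section weak_type_complex.
Context {R : realType} {d : measure_display} {X : measurableMetricType d R}.
Variable mu : {measure set X -> \bar R}.
Hypotheses (hB : is_Borel X) (hfin : finite_on_bounded mu).
Variable T : (X -> R[i]) -> (X -> R[i]).
Hypothesis Tlin : linear_on_Lp mu 2%:E T.
Hypothesis Tmeas : forall f, cLp mu 2%:E f -> cmeasurable (T f).
Variable W : R.
Hypothesis W0 : 0 < W.
Hypothesis Tweak : forall (u : X -> R) (B : R) (x0 : X) (r0 t : R),
  measurable_fun setT u -> (forall x, 0 <= u x) -> (forall x, u x <= B) ->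
  (forall x, ~ ball x0 r0 x -> u x = 0) -> 0 < t ->
  (t%:E * mu [set x | (3 * t < normc (T (fun x => (u x)%:C) x))%R] <=
   W%:E * \int[mu]_x (u x)%:E)%E.

Let ci (j : nat) : R[i] := 'i ^+ j.
Let part (f : X -> R[i]) (j : nat) (x : X) : R :=
  Num.max (complex.Re ((- 'i) ^+ j * f x)) 0.

Let maxB (a : R) : Num.max a 0 - Num.max (- a) 0 = a.
Proof.
have [a0|a0] := leP 0 a.
  by rewrite max_r ?subr0// oppr_le0.
by rewrite max_l ?sub0r ?opprK// oppr_ge0 ltW.
Qed.

(** The four parts are the positive parts of the real part of [f x] multiplied by the
    powers of [- 'i]. *)
Let sum_parts f x : f x = \sum_(j < 4) ci j * (part f j x)%:C.
Proof.
rewrite 4!big_ord_recr big_ord0 /= add0r /part /ci.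
case: (f x) => a b.
rewrite expr0 expr1 expr2 !exprS !expr0.
have -> : complex.Re (1 * (a +i* b)) = a by rewrite mul1r.
have -> : complex.Re (- 'i * 1 * (a +i* b)) = b.
  by rewrite mulr1 ReM /= !oppr0 mul0r sub0r mulN1r opprK.
have -> : complex.Re (- 'i * (- 'i * 1) * (a +i* b)) = - a.
  by rewrite mulr1 mulrNN -expr2 sqr_i mulN1r.
have -> : complex.Re (- 'i * (- 'i * (- 'i * 1)) * (a +i* b)) = - b.
  by rewrite mulr1 mulrA mulrNN -expr2 sqr_i mulN1r opprK ReM /= mul0r sub0r mul1r.
rewrite -expr2 mulr1 mulrA -expr2 sqr_i !mulN1r mul1r mulNr.
have -> (p q r s : R) : p%:C + 'i * q%:C - r%:C - 'i * s%:C = (p - r) +i* (q - s).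
  by apply/eqP; rewrite eq_complex /= ?mul0r ?mul1r ?subr0 ?add0r ?addr0 ?oppr0 ?sub0r ?eqxx.
by rewrite !maxB.
Qed.

Let normc_unit (a : R[i]) j : normc a = 1 -> normc (a ^+ j) = 1.
Proof.
by move=> a1; elim: j => [|j IH]; rewrite ?expr0 ?normc1// exprS normcM a1 IH mulr1.
Qed.

Let normc_i : normc ('i : R[i]) = 1.
Proof. by rewrite /= expr0n/= add0r expr1n sqrtr1. Qed.

Let normc_Ni : normc (- 'i : R[i]) = 1.
Proof. by rewrite /= oppr0 expr0n/= add0r sqrrN expr1n sqrtr1. Qed.

Let part_ge0 f j x : 0 <= part f j x.
Proof. by rewrite /part le_max lexx orbT. Qed.

Let part_le f j x : part f j x <= normc (f x).
Proof.
rewrite /part ge_max normc_ge0 andbT; apply: le_trans (ler_norm _) _.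
apply: le_trans (normRe_le _) _.
by rewrite normcM normc_unit ?mul1r// normc_Ni.
Qed.

Let measurable_part f j : cmeasurable f -> measurable_fun setT (part f j).
Proof.
move=> mf; apply: measurable_maxr => //.
have mj : cmeasurable (fun x => (- 'i) ^+ j * f x).
  by apply: cmeasurableM => //; exact: cmeasurable_cst.
by case: mj.
Qed.

Let bounded_supp_part f j : bounded_supp f -> bounded_supp (fun x => (part f j x)%:C).
Proof.
move=> [mf [M fM] [z [r f0]]]; split.
- by apply: cmeasurable_real; exact: measurable_part.
- exists M => x; rewrite normc_real ger0_norm//; exact: le_trans (part_le _ _ _) (fM x).
exists z, r => y /f0 fy; congr (_%:C); apply/eqP; rewrite eq_le part_ge0 andbT.
by apply: le_trans (part_le _ _ _) _; rewrite fy normc0.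
Qed.

Lemma linear_L2Z a f : cLp mu 2%:E f ->
  {ae mu, forall x, T (fun y => a * f y) x = a * T f x}.
Proof.
move=> f2; have := Tlin a f2 (cLp2_0 mu); apply: filterS2 (linear_L2_0 Tlin) => x ->.
rewrite addr0 => <-; congr T; apply/funext => y; by rewrite addr0.
Qed.

Let T_parts f : bounded_supp f ->
  {ae mu, forall x, T f x = \sum_(j < 4) ci j * T (fun y => (part f j y)%:C) x}.
Proof.
move=> nf.
have n2 j : cLp mu 2%:E (fun y => (part f j y)%:C).
  by have [] := bounded_supp_cLp hB hfin (bounded_supp_part j nf).
have [_ e1] := linear_L2_sum Tlin 4 (fun j => cLp2Z (ci j) (n2 j)).
have fE : f = (fun y => \sum_(j < 4) ci j * (part f j y)%:C).
  by apply/funext => y; exact: sum_parts.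
have e2 : {ae mu, forall x, forall j : nat,
    T (fun y => ci j * (part f j y)%:C) x = ci j * T (fun y => (part f j y)%:C) x}.
  by apply/ae_foralln => j; exact: linear_L2Z.
apply: filterS2 e1 e2 => x h1 h2; rewrite {1}fE h1.
by apply: eq_bigr => j _; rewrite h2.
Qed.

(** A bound for each of the four positive parts at height [s / 12] gives one for [f]
    at height [s], as [3 * (s / 12) * 4 = s]. *)
Lemma weak_bounded_supp f (s : R) : bounded_supp f -> 0 < s ->
  (s%:E * mu [set x | (s < normc (T f x))%R] <=
   (48 * W)%:E * absintegral mu setT f)%E.
Proof.
move=> nf s0; have [mf [M fM] [z [r f0]]] := nf.
pose u j x := T (fun y => (part f j y)%:C) x.
have n2 j : cLp mu 2%:E (fun y => (part f j y)%:C).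
  by have [] := bounded_supp_cLp hB hfin (bounded_supp_part j nf).
have mu_ j : cmeasurable (u j) by exact: Tmeas.
pose D j := [set x | 3 * (s / 12) < normc (u j x)].
have mD j : measurable (D j) by exact: measurable_normc_gt.
have mTf : cmeasurable (T f) by apply: Tmeas; have [] := bounded_supp_cLp hB hfin nf.
have s12 : 0 < s / 12 by rewrite divr_gt0.
have h1 : (mu [set x | (s < normc (T f x))%R] <= \sum_(0 <= j < 4) mu (D j))%E.
  apply: le_trans (measure_bigsetU_le mu (index_iota 0 4) mD).
  apply: le_mu_ae => //; first exact: measurable_normc_gt.
    exact: bigsetU_measurable.
  apply: filterS (T_parts nf) => x Tx /=; rewrite Tx => lts.
  rewrite big_mkord -bigcup_mkord; apply: contrapT => nD.
  suff : normc (\sum_(j < 4) ci j * u j x) <= s by rewrite leNgt lts.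
  apply: le_trans (normc_sum _ _) _.
  have -> : s = \sum_(j < 4) 3 * (s / 12).
    by rewrite sumr_const card_ord -mulr_natr; field.
  apply: ler_sum => j _; rewrite normcM normc_unit ?normc_i// mul1r leNgt.
  by apply/negP => Dj; apply: nD; exists j => /=.
have h2 j : ((s / 12)%:E * mu (D j) <= W%:E * absintegral mu setT f)%E.
  apply: le_trans (Tweak (u := part f j) (B := M) (x0 := z) (r0 := r) _ _ _ _ s12) _ => //.
  - exact: measurable_part.
  - by move=> x; exact: le_trans (part_le _ _ _) (fM x).
  - move=> x /f0 fx; apply/eqP; rewrite eq_le part_ge0 andbT.
    by apply: le_trans (part_le _ _ _) _; rewrite fx normc0.
  rewrite lee_wpmul2l ?lee_fin ?(ltW W0)//; apply: ge0_le_integral => //.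
  - by move=> x _; rewrite lee_fin.
  - by apply/measurable_EFinP; exact: measurable_part.
  - exact: measurable_Enormc.
  - by move=> x _; rewrite lee_fin.
have h3 : ((s / 12)%:E * mu [set x | (s < normc (T f x))%R] <=
    (4 * W)%:E * absintegral mu setT f)%E.
  apply: le_trans (lee_wpmul2l _ h1) _; first by rewrite lee_fin ltW.
  rewrite ge0_sume_distrr//.
  apply: (@le_trans _ _ (\sum_(0 <= j < 4) (W%:E * absintegral mu setT f))%E).
    by apply: lee_sum => j _.
  by rewrite sumr_const_nat subn0 (EFinM 4) -muleA mule_natl.
have -> : (s%:E = 12%:E * (s / 12)%:E)%E by rewrite -EFinM mulrC divfK.
have -> : ((48 * W)%:E = 12%:E * (4 * W)%:E)%E by rewrite -EFinM; congr EFin; ring.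
by rewrite -!muleA; apply: lee_wpmul2l => //; rewrite lee_fin.
Qed.

End weak_type_complex.

(** * Truncations *)

Section truncation.
Context {R : realType} {d : measure_display} {X : measurableMetricType d R}.
Variable mu : {measure set X -> \bar R}.
Hypotheses (hB : is_Borel X).

(** Dominated convergence. *)
Lemma tail_integral (g : X -> R) (D : nat -> set X) :
  measurable_fun setT g -> (forall x, 0 <= g x) ->
  (\int[mu]_x (g x)%:E < +oo)%E -> (forall n, measurable (D n)) ->
  (forall x, \forall n \near \oo, D n x) ->
  (\int[mu]_x (g x * \1_(~` D n) x)%:E)%E @[n --> \oo] --> 0%E.
Proof.
move=> mg g0 gI mD Dx; rewrite -(integral0 mu setT).
apply: (@dominated_cvg _ _ _ mu setT measurableT _ _ (fun x => (g x)%:E)).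
- move=> n; apply/measurable_EFinP; apply: measurable_funM => //.
  by apply: measurable_indic; exact: measurableC.
- move=> x _; apply: cvg_near_cst; apply: filterS (Dx x) => n Dn.
  by rewrite indicE memNset ?mulr0// => /(_ Dn).
- by [].
- apply/integrableP; split; first exact/measurable_EFinP.
  by under eq_integral do rewrite gee0_abs ?lee_fin//.
by move=> n x _; rewrite gee0_abs lee_fin ?mulr_ge0// indicE; rewrite ler_piMr ?lern1 ?leq_b1.
Qed.

Variable x0 : X.

Definition trunc_dom (f : X -> R[i]) (n : nat) : set X :=
  ~` [set x | n%:R < normc (f x)] `&` ball x0 n%:R.

Definition trunc f n (x : X) : R[i] := f x * (\1_(trunc_dom f n) x)%:C.

Lemma measurable_trunc_dom f n : cmeasurable f -> measurable (trunc_dom f n).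
Proof.
move=> mf; apply: measurableI; last exact: measurable_mball.
by apply: measurableC; exact: measurable_normc_gt.
Qed.

Lemma bounded_supp_trunc f n : cmeasurable f -> bounded_supp (trunc f n).
Proof.
move=> mf; split.
- apply: cmeasurableM => //; apply: cmeasurable_real.
  by apply: measurable_indic; exact: measurable_trunc_dom.
- exists n%:R => x; rewrite normcM normc_real indicE.
  case: (boolP (x \in _)) => [|_]; last by rewrite normr0 mulr0.
  by rewrite inE normr1 mulr1 => -[/negP]; rewrite -leNgt.
exists x0, n%:R => y ny; rewrite /trunc indicE memNset ?mulr0// => -[_]; exact: ny.
Qed.

Lemma trunc_dom_near f x : \forall n \near \oo, trunc_dom f n x.
Proof.
near=> n; split.
  apply/negP; rewrite -leNgt; near: n; exact: nbhs_infty_ger.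
by apply/ballP; near: n; exact: nbhs_infty_gtr.
Unshelve. all: by end_near. Qed.

Let normc_trunc f n x : normc (f x - trunc f n x) = normc (f x) * \1_(~` trunc_dom f n) x.
Proof.
rewrite /trunc !indicE in_setC; case: (_ \in _); rewrite /= ?mulr1 ?mulr0.
  by rewrite subrr normc0.
by rewrite subr0.
Qed.

Let normc_trunc2 f n x :
  normc (f x - trunc f n x) ^+ 2 = normc (f x) ^+ 2 * \1_(~` trunc_dom f n) x.
Proof.
by rewrite normc_trunc exprMn indicE; case: (_ \in _); rewrite ?expr1n ?expr0n.
Qed.

Lemma trunc_L1 f : cLp mu 1%:E f ->
  absintegral mu setT (fun x => f x - trunc f n x) @[n --> \oo] --> 0%E.
Proof.
move=> /cLp1P[mf fI].
under eq_fun => n.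
  rewrite /absintegral; under eq_integral do rewrite normc_trunc.
  over.
apply: tail_integral => //.
- exact: measurable_normc.
- by move=> x; exact: normc_ge0.
- by move=> n; exact: measurable_trunc_dom.
- by move=> x; exact: trunc_dom_near.
Qed.

Lemma trunc_L2 f : cLp mu 2%:E f ->
  L2mass mu (fun x => f x - trunc f n x) @[n --> \oo] --> 0%E.
Proof.
move=> /cLp2P[mf fI].
under eq_fun => n.
  rewrite /L2mass.
  under eq_integral do rewrite normc_trunc2.
  over.
apply: tail_integral => //.
- by apply: measurable_funX; exact: measurable_normc.
- by move=> x; exact: sqr_ge0.
- by move=> n; exact: measurable_trunc_dom.
- by move=> x; exact: trunc_dom_near.
Qed.

End truncation.

(** * Extension of the operator to L_1 *)

Section geometric.
Context {R : realType}.

Lemma geo_small (eta : R) : 0 < eta -> exists k, 2^-1 ^+ k <= eta.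
Proof.
move=> eta0; have h : 2^-1 ^+ k @[k --> \oo] --> (0 : R).
  by apply: cvg_expr; rewrite ger0_norm ?invr_ge0// invf_lt1 ?ltr1n.
have /cvgrPdist_le/(_ _ eta0)[k _ /(_ k (leqnn _))] := h.
by rewrite sub0r normrN ger0_norm ?exprn_ge0 ?invr_ge0//; exists k.
Qed.

(** Adding and subtracting [2 * 2^-1 ^+ n] to the sequence makes it nonincreasing and
    nondecreasing respectively. *)
Lemma geo_cvg (a : R ^nat) k :
  (forall l, (k <= l)%N -> `|a l.+1 - a l| <= 2^-1 ^+ l) ->
  exists2 L, a @ \oo --> L & `|L - a k| <= 2 * 2^-1 ^+ k.
Proof.
move=> ha; pose e l : R := 2^-1 ^+ l; pose c n := a (n + k)%N - 2 * e (n + k)%N.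
pose b n := a (n + k)%N + 2 * e (n + k)%N.
have e0 l : 0 <= e l by rewrite exprn_ge0 ?invr_ge0.
have eS l : e l.+1 = e l / 2 by rewrite /e exprS mulrC.
have cnd : nondecreasing_seq c.
  apply/nondecreasing_seqP => n; rewrite /c addSn eS.
  have := ha (n + k)%N (leq_addl _ _); rewrite -/(e _) ler_norml => /andP[]; lra.
have bni : nonincreasing_seq b.
  apply/nonincreasing_seqP => n; rewrite /b addSn eS.
  have := ha (n + k)%N (leq_addl _ _); rewrite -/(e _) ler_norml => /andP[]; lra.
have cb n : c n <= b 0%N.
  apply: le_trans (bni _ _ (leq0n n)).
  by rewrite /c /b; have := e0 (n + k)%N; lra.
have cc : cvgn c by apply: nondecreasing_is_cvgn => //; exists (b 0%N) => _ [n _ <-].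
exists (limn c).
  have ec : e n @[n --> \oo] --> (0 : R).
    by apply: cvg_expr; rewrite ger0_norm ?invr_ge0// invf_lt1 ?ltr1n.
  have h : c n + 2 * e (n + k)%N @[n --> \oo] --> limn c + 2 * 0.
    by apply: cvgD => //; apply: cvgMr; rewrite (cvg_shiftn k).
  rewrite mulr0 addr0 in h; rewrite -(cvg_shiftn k).
  apply: cvg_trans h; apply: near_eq_cvg; near=> n.
  by rewrite /c subrK.
have h1 : c 0%N <= limn c by exact: nondecreasing_cvgn_le.
have h2 : limn c <= b 0%N by apply: limr_le => //; near=> n; exact: cb.
move: h1 h2; rewrite /c /b add0n -/(e k) ler_norml => h1 h2; apply/andP; split; lra.
Unshelve. all: by end_near. Qed.

Lemma complex_geo_cvg (w : nat -> R[i]) k :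
  (forall l, (k <= l)%N -> normc (w l.+1 - w l) <= 2^-1 ^+ l) ->
  exists z : R[i], [/\ complex.Re (w l) @[l --> \oo] --> complex.Re z,
    complex.Im (w l) @[l --> \oo] --> complex.Im z
    & normc (z - w k) <= 4 * 2^-1 ^+ k].
Proof.
move=> hw.
have [|a ac ak] := @geo_cvg (fun l => complex.Re (w l)) k.
  by move=> l kl; rewrite -ReN -ReD; apply: le_trans (normRe_le _) (hw l kl).
have [|b bc bk] := @geo_cvg (fun l => complex.Im (w l)) k.
  by move=> l kl; rewrite -ImN -ImD; apply: le_trans (normIm_le _) (hw l kl).
exists (a +i* b); split=> //; apply: le_trans (normc_le _) _.
rewrite ReD ImD ReN ImN /=; lra.
Qed.

Lemma near_small (a : nat -> \bar R) (eta : R) : a n @[n --> \oo] --> 0%E ->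
  0 < eta -> \forall n \near \oo, (a n <= eta%:E)%E.
Proof.
move=> a0 eta0; have e0 : (0 < eta%:E)%E by rewrite lte_fin.
have h : \forall n \near \oo, (a n < eta%:E)%E.
  by apply: (a0 [set y | (y < eta%:E)%E]); exact: (open_ereal_lt' e0).
by apply: filterS h => n /ltW.
Qed.

End geometric.

Section extension.
Context {R : realType} {d : measure_display} {X : measurableMetricType d R}.
Variable mu : {measure set X -> \bar R}.
Hypotheses (hB : is_Borel X) (hfin : finite_on_bounded mu).
Variable T : (X -> R[i]) -> (X -> R[i]).
Hypothesis Tlin : linear_on_Lp mu 2%:E T.
Hypothesis Tmeas : forall f, cLp mu 2%:E f -> cmeasurable (T f).
Variable W : R.
Hypothesis W0 : 0 < W.
Hypothesis Tweak : forall f s, bounded_supp f -> 0 < s ->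
  (s%:E * mu [set x | (s < normc (T f x))%R] <= W%:E * absintegral mu setT f)%E.

Let N1 f := absintegral mu setT f.

Lemma N1_triangle f g h : cmeasurable f -> cmeasurable g -> cmeasurable h ->
  (N1 (fun x => f x - g x)%R <= N1 (fun x => h x - f x)%R + N1 (fun x => h x - g x)%R)%E.
Proof.
move=> mf mg mh.
have m1 := cmeasurableB mh mf; have m2 := cmeasurableB mh mg.
apply: (@le_trans _ _ (\int[mu]_x ((normc (h x - f x))%:E + (normc (h x - g x))%:E))%E).
  apply: ge0_le_integral => //.
  - by move=> x _; rewrite lee_fin normc_ge0.
  - by apply: measurable_Enormc; exact: cmeasurableB.
  - by apply: emeasurable_funD; exact: measurable_Enormc.
  move=> x _; rewrite -EFinD lee_fin [normc (h x - f x)]normcB.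
  apply: le_trans (normc_triangle _ _).
  by rewrite (_ : f x - h x + (h x - g x) = f x - g x)//; ring.
rewrite ge0_integralD//; try exact: measurable_Enormc.
- by move=> x _; rewrite lee_fin normc_ge0.
- by move=> x _; rewrite lee_fin normc_ge0.
Qed.

Lemma weak_sub f g s : bounded_supp f -> bounded_supp g -> 0 < s ->
  (mu [set x | (s < normc (T f x - T g x))%R] <=
   (W / s)%:E * N1 (fun x => f x - g x)%R)%E.
Proof.
move=> nf ng s0.
have [_ f2] := bounded_supp_cLp hB hfin nf; have [_ g2] := bounded_supp_cLp hB hfin ng.
have nd : bounded_supp (fun x => f x - g x).
  have -> : (fun x => f x - g x) = (fun x => f x + -1 * g x).
    by apply/funext => x; rewrite mulN1r.
  by apply: bounded_suppD => //; exact: bounded_suppZ.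
have [_ d2] := bounded_supp_cLp hB hfin nd.
rewrite -(@lee_pmul2l _ s%:E) ?lte_fin// muleA -EFinM mulrC divfK ?gt_eqF//.
apply: le_trans (Tweak nd s0); rewrite lee_wpmul2l ?lee_fin ?(ltW s0)//.
apply: le_mu_ae.
- by apply: measurable_normc_gt; apply: cmeasurableB; exact: Tmeas.
- by apply: measurable_normc_gt; exact: Tmeas.
have := Tlin (-1) g2 f2; apply: filterS => x.
have -> : (fun y => -1 * g y + f y) = (fun y => f y - g y).
  by apply/funext => y; rewrite mulN1r addrC.
by move=> Tx /=; rewrite Tx mulN1r addrC.
Qed.

(** A value at [f] for the extension of [T] to [L_1], characterized by its distance in
    measure to the images of nearby functions; it is unique up to null sets. *)
Definition ext_value f h := cmeasurable h /\ forall g s, bounded_supp g -> 0 < s ->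
  (mu [set x | (s < normc (h x - T g x))%R] <=
   (2 * W / s)%:E * N1 (fun x => f x - g x)%R)%E.

(** Truncations [p k] of [f] at [L_1] distance [4^-k] have images whose successive
    differences exceed [2^-k] only on a set [A k] of measure of order [2^-k].  Outside
    the null set [N] of the points in infinitely many [A k], the images
    converge; replacing them by 0 on [N] makes the limit exist everywhere and be
    measurable. *)
Lemma ext_value_exists (x0 : X) f : cLp mu 1%:E f -> exists h, ext_value f h.
Proof.
move=> f1; have [mf _] := (cLp1P mu f).1 f1.
pose e k : R := 2^-1 ^+ k.
have e0 k : 0 < e k by rewrite exprn_gt0// invr_gt0.
have e1 k : e k <= 1 by rewrite exprn_ile1// ?invr_ge0// invf_le1 ?ler1n.
have eS k : e k.+1 = e k / 2 by rewrite /e exprS mulrC.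
have /choice[n nP] k : exists n, (N1 (fun x => f x - trunc x0 f n x)%R <= (e k * e k)%:E)%E.
  have [m _ /(_ m (leqnn m)) hm] := near_small (trunc_L1 hB x0 f1) (mulr_gt0 (e0 k) (e0 k)).
  by exists m.
pose p k := trunc x0 f (n k).
have np k : bounded_supp (p k) by exact: bounded_supp_trunc.
have mp k : cmeasurable (p k) by have [] := np k.
pose u k := T (p k).
have mu_ k : cmeasurable (u k) by apply: Tmeas; have [] := bounded_supp_cLp hB hfin (np k).
pose A k := [set x | e k < normc (u k.+1 x - u k x)].
have mA k : measurable (A k) by apply: measurable_normc_gt; exact: cmeasurableB.
have bA k : (mu (A k) <= (2 * W * e k)%:E)%E.
  have := weak_sub (np k.+1) (np k) (e0 k); rewrite -/(u _) -/(u _) -/(A k) => h.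
  have -> : 2 * W * e k = W / e k * (2 * (e k * e k)) by field; rewrite gt_eqF.
  have We : 0 <= W / e k by rewrite divr_ge0 ?ltW.
  apply: (le_trans h); rewrite (EFinM (W / e k)) lee_wpmul2l ?lee_fin//.
  apply: le_trans (N1_triangle (mp _) (mp _) mf) _.
  apply: le_trans (leeD (nP _) (nP _)) _; rewrite -EFinD lee_fin eS.
  have := e0 k; nra.
pose E k := \bigcup_l A (k + l)%N.
have mE k : measurable (E k) by exact: bigcup_measurable.
have bE k : (mu (E k) <= (4 * W * e k)%:E)%E.
  apply: le_trans (measure_sigma_subadditive _ (fun l => mA (k + l)%N) (mE k) (@subset_refl _ _)) _.
  have c0 : 0 <= 4 * W * e k by rewrite !mulr_ge0 ?(ltW W0) ?(ltW (e0 k)).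
  have := @epsilon_trick R (fun=> 0%E) _ xpredT (fun=> lexx _) c0.
  have -> : (\sum_(0 <= i <oo) 0 = 0 :> \bar R)%E by apply: eseries0.
  rewrite add0e; apply: le_trans; apply: lee_nneseries => // l _.
  rewrite add0e; apply: le_trans (bA _) _; rewrite lee_fin natrX -exprVn exprS /e exprD.
  by rewrite le_eqVlt; apply/orP; left; apply/eqP; field.
pose N := \bigcap_k E k.
have mN : measurable N by exact: bigcapT_measurable.
pose v k x := u k x * (\1_(~` N) x)%:C.
have mv k : cmeasurable (v k).
  by apply: cmeasurableM => //; apply: cmeasurable_real; apply: measurable_indic; exact: measurableC.
have good k x : ~ E k x -> exists z : R[i],
    [/\ complex.Re (v l x) @[l --> \oo] --> complex.Re z,
        complex.Im (v l x) @[l --> \oo] --> complex.Im z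
      & normc (z - u k x) <= 4 * e k].
  move=> nE; have nN : ~ N x by move=> /(_ k Logic.I).
  have vE l : v l x = u l x by rewrite /v indicE mem_set// mulr1.
  have [|z [z1 z2 z3]] := @complex_geo_cvg R (fun l => v l x) k.
    move=> l kl; rewrite !vE leNgt; apply/negP => Al; apply: nE; exists (l - k)%N => //.
    by rewrite /A subnKC.
  by exists z; split=> //; rewrite -vE.
have /choice[h hP] x : exists z : R[i],
    [/\ complex.Re (v l x) @[l --> \oo] --> complex.Re z,
        complex.Im (v l x) @[l --> \oo] --> complex.Im z
      & forall k, ~ E k x -> normc (z - u k x) <= 4 * e k].
  have [Nx|nN] := pselect (N x).
    exists 0; split=> [||k]; last by move/(_ (Nx k Logic.I)).
      apply: cvg_near_cst; near=> l.
      by rewrite /v indicE memNset ?mulr0// => /(_ Nx).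
    apply: cvg_near_cst; near=> l.
    by rewrite /v indicE memNset ?mulr0// => /(_ Nx).
  have [k nE] : exists k, ~ E k x.
    by apply: contrapT => /forallNP h; apply: nN => k _; apply: contrapT; exact: h.
  have [z [z1 z2 _]] := good k x nE; exists z; split=> // l nEl.
  have [z' [z1' z2' z3']] := good l x nEl; suff -> : z = z' by [].
  apply/eqP; rewrite eq_complex (cvg_unique _ z1 z1')//= (cvg_unique _ z2 z2')//.
  by rewrite !eqxx.
have mh : cmeasurable h.
  split.
    apply: (@measurable_fun_cvg _ _ _ setT (fun l x => complex.Re (v l x))).
      by move=> l; have [] := mv l.
    by move=> x _; have [] := hP x.
  apply: (@measurable_fun_cvg _ _ _ setT (fun l x => complex.Im (v l x))).
    by move=> l; have [] := mv l.
  by move=> x _; have [] := hP x.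
exists h; split=> // g s ng s0; have [mg _ _] := ng.
have mTg : cmeasurable (T g) by apply: Tmeas; have [] := bounded_supp_cLp hB hfin ng.
apply/lee_addgt0Pr => eta eta0.
pose c := 4 * W + 2 * W / s.
have Ws : 0 <= 2 * W / s by rewrite divr_ge0 ?mulr_ge0 ?ltW.
have c0 : 0 < c by rewrite ltr_pwDl ?mulr_gt0.
have [k] : exists k, e k <= Num.min (eta / c) (s / 8).
  by apply: geo_small; rewrite lt_min !divr_gt0.
rewrite le_min => /andP[ec es].
pose D := [set x | s / 2 < normc (u k x - T g x)].
have s2 : 0 < s / 2 by rewrite divr_gt0.
have mD : measurable D by apply: measurable_normc_gt; exact: cmeasurableB.
apply: (@le_trans _ _ (mu (E k `|` D))).
  apply: le_mu.
  - by apply: measurable_normc_gt; exact: cmeasurableB.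
  - exact: measurableU.
  move=> x /= sx; have [Ex|nE] := pselect (E k x); [by left|right].
  have [_ _ /(_ k nE) hk] := hP x.
  rewrite /D /= ltNge; apply/negP => ux; move: sx; apply/negP; rewrite -leNgt.
  have -> : h x - T g x = (h x - u k x) + (u k x - T g x) by ring.
  apply: le_trans (normc_triangle _ _) _; lra.
apply: le_trans (measureU2 _ _ _) _ => //.
apply: le_trans (leeD (bE k) (weak_sub (np k) ng s2)) _.
apply: (@le_trans _ _ ((4 * W * e k)%:E + (2 * W / s)%:E *
    (N1 (fun x => f x - g x)%R + (e k)%:E))%E).
  apply: leeD => //.
  have -> : W / (s / 2) = 2 * W / s by field; rewrite gt_eqF.
  rewrite lee_wpmul2l ?lee_fin//.
  apply: le_trans (N1_triangle (mp _) mg mf) _; rewrite addeC; apply: leeD => //.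
  by apply: le_trans (nP k) _; rewrite lee_fin; apply: ler_piMr => //; exact: ltW.
rewrite ge0_muleDr ?absintegral_ge0 ?lee_fin ?(ltW (e0 k))//; rewrite addeCA; apply: leeD => //.
rewrite -EFinM -EFinD lee_fin -mulrDl -/c.
by rewrite mulrC -ler_pdivlMr.
Unshelve. all: by end_near. Qed.

End extension.

Section extended_operator.
Context {R : realType} {d : measure_display} {X : measurableMetricType d R}.
Variable mu : {measure set X -> \bar R}.
Hypotheses (hB : is_Borel X) (hfin : finite_on_bounded mu).
Variable T : (X -> R[i]) -> (X -> R[i]).
Hypothesis Tlin : linear_on_Lp mu 2%:E T.
Variables C2 W : R.
Hypotheses (C20 : 0 < C2) (W0 : 0 < W).
Hypothesis TL2 : forall f, cLp mu 2%:E f ->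
  cmeasurable (T f) /\ (L2mass mu (T f) <= C2%:E * L2mass mu f)%E.

Let N1 f := absintegral mu setT f.
Let Tmeas f : cLp mu 2%:E f -> cmeasurable (T f).
Proof. by move=> /TL2[]. Qed.
Let Tmeas_bs f : bounded_supp f -> cmeasurable (T f).
Proof. by move=> nf; apply: Tmeas; have [] := bounded_supp_cLp hB hfin nf. Qed.

(** The heights [n.+1%:R^-1] suffice, and the set above each of them is null. *)
Lemma ae_zero (h : X -> R[i]) : cmeasurable h ->
  (forall s eta : R, 0 < s -> 0 < eta ->
     (mu [set x | (s < normc (h x))%R] <= eta%:E)%E) ->
  {ae mu, forall x, h x = 0}.
Proof.
move=> mh small.
have h1 : {ae mu, forall x, forall n : nat, ~ (n.+1%:R^-1 < normc (h x))}.
  apply/ae_foralln => n; exists [set x | n.+1%:R^-1 < normc (h x)]; split.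
  - exact: measurable_normc_gt.
  - apply/eqP; rewrite eq_le measure_ge0 andbT; apply/lee_addgt0Pr => eta eta0.
    by rewrite add0e; apply: small; rewrite // invr_gt0 ltr0n.
  - by move=> x /= /contrapT.
apply: filterS h1 => x hx; apply: eq0_normc; apply/eqP; rewrite eq_le normc_ge0 andbT.
apply/ler_addgt0Pr => eta eta0; rewrite add0r.
have /ltr_add_invr[n] := eta0; rewrite add0r => hn.
apply: le_trans (ltW hn); rewrite leNgt; apply/negP; exact: hx.
Qed.

Lemma ext_value_weak (x0 : X) f h (s : R) : ext_value mu T W f h -> 0 < s ->
  (s%:E * mu [set x | (s < normc (h x))%R] <= (2 * W)%:E * N1 f)%E.
Proof.
move=> [mh hP] s0.
have n0 : bounded_supp (fun _ : X => 0 : R[i]).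
  split; first exact: cmeasurable_cst.
  - by exists 0 => y; rewrite normc0.
  - by exists x0, 1.
have T0 := linear_L2_0 Tlin.
have h1 : (mu [set x | (s < normc (h x))%R] <= (2 * W / s)%:E * N1 f)%E.
  have -> : N1 f = N1 (fun x => f x - 0) by congr N1; apply/funext => x; rewrite subr0.
  apply: le_trans (hP _ _ n0 s0); apply: le_mu_ae; first exact: measurable_normc_gt.
    by apply: measurable_normc_gt; apply: cmeasurableB => //; exact: Tmeas_bs.
  by apply: filterS T0 => x Tx /=; rewrite Tx subr0.
apply: (@le_trans _ _ (s%:E * ((2 * W / s)%:E * N1 f))%E).
  by apply: lee_wpmul2l => //; rewrite lee_fin ltW.
by rewrite muleA -EFinM mulrC divfK ?gt_eqF.
Qed.

(** Truncations approximate [f] both in [L_1] and in [L_2]. *)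
Lemma ext_value_agree (x0 : X) f h : ext_value mu T W f h -> cLp mu 1%:E f -> cLp mu 2%:E f ->
  {ae mu, forall x, h x = T f x}.
Proof.
move=> [mh hP] f1 f2.
have mTf := Tmeas f2; have [mf _] := (cLp1P mu f).1 f1.
have h0 : {ae mu, forall x, h x - T f x = 0}.
  apply: ae_zero; first exact: cmeasurableB.
  move=> s eta s0 eta0.
  pose c1 := 2 * W / (s / 2); pose c2 := C2 / (s / 2) ^+ 2.
  have s2 : 0 < s / 2 by rewrite divr_gt0.
  have c10 : 0 < c1 by rewrite divr_gt0// mulr_gt0.
  have c20 : 0 < c2 by rewrite divr_gt0// exprn_gt0.
  have e1 : 0 < eta / 2 / c1 by apply: divr_gt0 => //; exact: divr_gt0.
  have e2 : 0 < eta / 2 / c2 by apply: divr_gt0 => //; exact: divr_gt0.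
  have [m _ /(_ m (leqnn m)) [a1 a2]] := filterI (near_small (trunc_L1 hB x0 f1) e1)
    (near_small (trunc_L2 hB x0 f2) e2).
  set p := trunc x0 f m in a1 a2.
  have np : bounded_supp p by exact: bounded_supp_trunc.
  have [_ p2] := bounded_supp_cLp hB hfin np.
  pose q x := -1 * f x + p x.
  have q2 : cLp mu 2%:E q by apply: cLp2D => //; exact: cLp2Z.
  have [mTq lTq] := TL2 q2.
  have qm : L2mass mu q = L2mass mu (fun x => f x - p x).
    apply: eq_integral => x _; congr (_ ^+ _)%:E.
    by rewrite normcB /q mulN1r addrC.
  pose D1 := [set x | s / 2 < normc (h x - T p x)].
  pose D2 := [set x | s / 2 < normc (T q x)].
  have mTp := Tmeas_bs np.
  have mD1 : measurable D1 by apply: measurable_normc_gt; exact: cmeasurableB.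
  have mD2 : measurable D2 by exact: measurable_normc_gt.
  apply: (@le_trans _ _ (mu (D1 `|` D2))).
    apply: le_mu_ae.
    - by apply: measurable_normc_gt; exact: cmeasurableB.
    - exact: measurableU.
    have := Tlin (-1) f2 p2; apply: filterS => x Tx /= sx.
    have [|n1] := ltP (s / 2) (normc (h x - T p x)); first by left.
    right; rewrite /D2 /= Tx mulN1r ltNge; apply/negP => n2; move: sx; apply/negP.
    rewrite -leNgt; have -> : h x - T f x = (h x - T p x) + (- T f x + T p x) by ring.
    by apply: le_trans (normc_triangle _ _) _; lra.
  apply: le_trans (measureU2 _ _ _) _ => //.
  have -> : eta = c1 * (eta / 2 / c1) + c2 * (eta / 2 / c2).
    by field; rewrite !gt_eqF.
  rewrite EFinD; apply: leeD.
    apply: le_trans (hP _ _ np s2) _; rewrite -/c1 (EFinM c1); apply: lee_wpmul2l => //.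
    by rewrite lee_fin ltW.
  rewrite -(@lee_pmul2l _ ((s / 2) ^+ 2)%:E) ?lte_fin ?exprn_gt0//.
  apply: le_trans (L2mass_lt mu mTq s2) _; apply: (le_trans lTq).
  have -> : (((s / 2) ^+ 2)%:E * (c2 * (eta / 2 / c2))%:E = C2%:E * (eta / 2 / c2)%:E)%E.
    have -> : C2 = (s / 2) ^+ 2 * c2 by rewrite /c2 mulrC divfK// gt_eqF// exprn_gt0.
    by rewrite -!EFinM; congr EFin; exact: mulrA.
  by apply: lee_wpmul2l; rewrite ?lee_fin ?(ltW C20)// qm.
by apply: filterS h0 => x /eqP; rewrite subr_eq0 => /eqP.
Qed.

(** The height [s] is shared between the three functions; the factor [na + 1] absorbs
    the scalar, which may be 0. *)
Lemma ext_value_linear (x0 : X) a f g hf hg h : cLp mu 1%:E f -> cLp mu 1%:E g ->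
  ext_value mu T W f hf -> ext_value mu T W g hg ->
  ext_value mu T W (fun x => a * f x + g x) h ->
  {ae mu, forall x, h x = a * hf x + hg x}.
Proof.
move=> f1 g1 [mhf fP] [mhg gP] [mh hP].
have [mf _] := (cLp1P mu f).1 f1; have [mg _] := (cLp1P mu g).1 g1.
have maf : cmeasurable (fun x => a * hf x + hg x).
  by apply: cmeasurableD => //; apply: cmeasurableM => //; exact: cmeasurable_cst.
have h0 : {ae mu, forall x, h x - (a * hf x + hg x) = 0}.
  apply: ae_zero; first exact: cmeasurableB.
  move=> s eta s0 eta0.
  pose na := normc a; have na0 : 0 <= na by exact: normc_ge0.
  have na1 : 0 < na + 1 by rewrite ltr_pwDr.
  have s3 : 0 < s / 3 by rewrite divr_gt0.
  have sa3 : 0 < s / 3 / (na + 1) by rewrite divr_gt0.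
  pose c1 := 2 * W / (s / 3); pose c2 := 2 * W / (s / 3 / (na + 1)).
  have c10 : 0 < c1 by rewrite divr_gt0// mulr_gt0.
  have c20 : 0 < c2 by rewrite divr_gt0// mulr_gt0.
  pose c := c1 * (na + 1) + c2 + c1.
  have c0 : 0 < c by rewrite !addr_gt0// mulr_gt0.
  have e0 : 0 < eta / c by rewrite divr_gt0.
  have [m _ /(_ m (leqnn m)) [a1 a2]] := filterI (near_small (trunc_L1 hB x0 f1) e0)
    (near_small (trunc_L1 hB x0 g1) e0).
  set p := trunc x0 f m in a1; set q := trunc x0 g m in a2.
  have np : bounded_supp p by exact: bounded_supp_trunc.
  have nq : bounded_supp q by exact: bounded_supp_trunc.
  have nr : bounded_supp (fun x => a * p x + q x) by apply: bounded_suppD => //; exact: bounded_suppZ.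
  have [mp _ _] := np; have [mq _ _] := nq.
  have [_ p2] := bounded_supp_cLp hB hfin np; have [_ q2] := bounded_supp_cLp hB hfin nq.
  pose D1 := [set x | s / 3 < normc (h x - T (fun y => a * p y + q y) x)].
  pose D2 := [set x | s / 3 / (na + 1) < normc (hf x - T p x)].
  pose D3 := [set x | s / 3 < normc (hg x - T q x)].
  have mTp := Tmeas_bs np; have mTq := Tmeas_bs nq; have mTr := Tmeas_bs nr.
  have mD1 : measurable D1 by apply: measurable_normc_gt; exact: cmeasurableB.
  have mD2 : measurable D2 by apply: measurable_normc_gt; exact: cmeasurableB.
  have mD3 : measurable D3 by apply: measurable_normc_gt; exact: cmeasurableB.
  have mD12 : measurable (D1 `|` D2) by exact: measurableU.
  apply: (@le_trans _ _ (mu ((D1 `|` D2) `|` D3))).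
    apply: le_mu_ae.
    - by apply: measurable_normc_gt; exact: cmeasurableB.
    - exact: measurableU.
    have := Tlin a p2 q2; apply: filterS => x Tx /= sx.
    have [|n1] := ltP (s / 3) (normc (h x - T (fun y => a * p y + q y) x)).
      by left; left.
    have [|n2] := ltP (s / 3 / (na + 1)) (normc (hf x - T p x)); first by left; right.
    right; rewrite /D3 /= ltNge; apply/negP => n3; move: sx; apply/negP.
    rewrite -leNgt.
    have -> : h x - (a * hf x + hg x) = (h x - T (fun y => a * p y + q y) x) +
        (a * - (hf x - T p x) + - (hg x - T q x)) by rewrite Tx; ring.
    apply: le_trans (normc_triangle _ _) _.
    apply: le_trans (lerD (lexx _) (normc_triangle _ _)) _.
    have n2' : normc (a * - (hf x - T p x)) <= s / 3.
      rewrite normcM normcN -/na; apply: (@le_trans _ _ ((na + 1) * (s / 3 / (na + 1)))).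
        by apply: ler_pM => //; rewrite ?normc_ge0// lerDl.
      by rewrite mulrC divfK ?gt_eqF.
    have n3' : normc (- (hg x - T q x)) <= s / 3 by rewrite normcN.
    by have := lerD n1 (lerD n2' n3'); lra.
  apply: le_trans (measureU2 _ _ _) _ => //.
  apply: le_trans (leeD (measureU2 _ _ _) (lexx _)) _ => //.
  have -> : eta = c1 * ((na + 1) * (eta / c)) + c2 * (eta / c) + c1 * (eta / c).
    have cE z : c1 * ((na + 1) * z) + c2 * z + c1 * z = c * z by rewrite /c; ring.
    by rewrite cE mulrC divfK ?gt_eqF.
  rewrite !EFinD; apply: leeD; first apply: leeD.
  - apply: le_trans (hP _ _ nr s3) _; rewrite -/c1 (EFinM c1); apply: lee_wpmul2l.
      by rewrite lee_fin ltW.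
    have -> : (fun x => a * f x + g x - (a * p x + q x)) =
        (fun x => a * (f x - p x) + (g x - q x)) by apply/funext => x; ring.
    have mfp : cmeasurable (fun x => f x - p x) by exact: cmeasurableB.
    have mgq : cmeasurable (fun x => g x - q x) by exact: cmeasurableB.
    apply: le_trans (absintegralD mu measurableT _ mgq) _.
      by apply: cmeasurableM => //; exact: cmeasurable_cst.
    rewrite absintegralZ// mulrDl mul1r EFinD; apply: leeD => //.
    by rewrite EFinM; apply: lee_wpmul2l; rewrite ?lee_fin.
  - apply: le_trans (fP _ _ np sa3) _; rewrite -/c2 (EFinM c2); apply: lee_wpmul2l => //.
    by rewrite lee_fin ltW.
  - apply: le_trans (gP _ _ nq s3) _; rewrite -/c1 (EFinM c1); apply: lee_wpmul2l => //.
    by rewrite lee_fin ltW.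
by apply: filterS h0 => x /eqP; rewrite subr_eq0 => /eqP.
Qed.

End extended_operator.

(** * Calderon-Zygmund operators *)

Section calderon_zygmund.
Context {R : realType} {d : measure_display} {X : measurableMetricType d R}.
Variables (mu : {measure set X -> \bar R}) (lam : X -> R -> R).
Hypotheses (hB : is_Borel X) (hG : geometrically_doubling X).
Hypotheses (hfin : finite_on_bounded mu) (hlam : upper_doubling mu lam).

(** The constants are replaced by positive ones: [C] by [`|C| + 1], and the weak
    type constant by its maximum with 1, which matters when the space is empty. *)
Lemma CZ_weak_bounded_supp T : CZ_operator mu lam T -> bounded_on_L2 mu T ->
  exists2 W : R, 0 < W & forall f s, bounded_supp f -> 0 < s ->
  (s%:E * mu [set x | (s < normc (T f x))%R] <= W%:E * absintegral mu setT f)%E.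
Proof.
move=> [K [C [tau [tau01 Ks Ksm]]] TK] Tb.
have [Tlin _] := Tb; have [C2 C20 TL2] := L2mass_bounded Tb.
have [lam0 lam_nd lam_mu [Cl lam_dbl]] := hlam.
have mdist0 (x y : X) : x != y -> 0 < mdist x y by rewrite mdist_gt0.
have C'0 : 0 < `|C| + 1 by rewrite ltr_pwDr.
have CC' : C <= `|C| + 1.
  by apply: le_trans (ler_norm _) _; rewrite lerDl.
have Ks' x y : x != y -> normc (K x y) <= (`|C| + 1) / lam x (mdist x y).
  move=> xy; apply: le_trans (Ks _ _ xy) _; rewrite ler_wpM2r// invr_ge0 ltW//.
  by apply: lam0; exact: mdist0.
have Ksm' x y y' : x != y -> mdist y y' <= mdist x y / 2 ->
    normc (K x y - K x y') <=
    (`|C| + 1) * (mdist y y' `^ tau / (mdist x y `^ tau * lam x (mdist x y))).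
  move=> xy yy; apply: le_trans (_ : _ <= normc (K x y - K x y') + normc (K y x - K y' x)) _.
    by rewrite lerDl normc_ge0.
  apply: le_trans (Ksm _ _ _ xy yy) _; rewrite ler_wpM2r//.
  rewrite divr_ge0 ?powR_ge0// mulr_ge0 ?powR_ge0// ltW//.
  by apply: lam0; exact: mdist0.
pose w := Num.max 1 (weak_const Cl (`|C| + 1) tau C2).
have w0 : 0 < w by rewrite lt_max ltr01.
exists (48 * w); first by rewrite mulr_gt0.
apply: (weak_bounded_supp hB hfin Tlin _ w0); first by move=> f /TL2[].
move=> u B x0 r0 t mu_ u0 uB uout t0.
apply: le_trans (weak_nonneg hB hG hfin lam0 lam_nd lam_mu lam_dbl C'0 tau01
  Ks' Ksm' TK Tlin C20 TL2 mu_ u0 uB uout t0) _.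
apply: lee_wpmul2r; last by rewrite lee_fin le_max lexx orbT.
by apply: integral_ge0 => x _; rewrite lee_fin.
Qed.

(** A value of the extension is chosen for each function of [L_1]. *)
Lemma CZ_weak_type T : CZ_operator mu lam T -> bounded_on_L2 mu T ->
  maps_L1_to_weakL1 mu T.
Proof.
move=> TCZ Tb; have [W W0 Tweak] := CZ_weak_bounded_supp TCZ Tb.
have [Tlin _] := Tb; have [C2 C20 TL2] := L2mass_bounded Tb.
have Tmeas f : cLp mu 2%:E f -> cmeasurable (T f) by move=> /TL2[].
have [[x0 _]|nX] := pselect (exists x : X, True); last first.
  exists (fun _ _ => 0); split.
  - by move=> a f g _ _; apply: aeW => x; exfalso; apply: nX; exists x.
  - by move=> f _ _; apply: aeW => x; exfalso; apply: nX; exists x.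
  exists 0 => f _; split; first exact: cmeasurable_cst.
  rewrite mul0e; apply: ub_ereal_sup => _ [s /= s0 <-].
  rewrite (_ : [set x | _] = set0) ?measure0 ?mule0//.
  by apply/seteqP; split=> // x; exfalso; apply: nX; exists x.
have /choice[T1 T1P] f : exists h, cLp mu 1%:E f -> ext_value mu T W f h.
  have [f1|nf] := pselect (cLp mu 1%:E f); last by exists (fun=> 0).
  by have [h hP] := ext_value_exists hB hfin Tlin Tmeas W0 Tweak x0 f1; exists h.
exists T1; split.
- move=> a f g f1 g1; have fg1 : cLp mu 1%:E (fun x => a * f x + g x).
    have [mf fI] := (cLp1P mu f).1 f1; have [mg gI] := (cLp1P mu g).1 g1.
    have maf : cmeasurable (fun x => a * f x).
      by apply: cmeasurableM => //; exact: cmeasurable_cst.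
    apply/cLp1P; split; first exact: cmeasurableD.
    apply: le_lt_trans (absintegralD mu measurableT maf mg) _.
    by rewrite absintegralZ// lte_add_pinfty// lte_mul_pinfty ?lee_fin ?normc_ge0.
  exact: (ext_value_linear hB hfin Tlin W0 TL2 x0 f1 g1 (T1P _ f1) (T1P _ g1) (T1P _ fg1)).
- by move=> f f1 f2; exact: (ext_value_agree hB hfin Tlin C20 W0 TL2 x0 (T1P _ f1) f1 f2).
exists (2 * W) => f f1; have fP := T1P _ f1; split; first by have [] := fP.
apply: ub_ereal_sup => _ [s /= s0 <-]; rewrite cLnorm1E.
exact: (ext_value_weak hB hfin Tlin TL2 x0 fP s0).
Qed.

End calderon_zygmund.

(** * The theorem *)

Theorem theoremA2 (R : realType) (Cd : R) (hCd : 0 < Cd) :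
  exists alpha0 beta0 : R, [/\ 1 < alpha0, 1 < beta0 &
  forall alpha beta : R, alpha0 <= alpha -> beta0 <= beta ->
  forall (d : measure_display) (X : measurableMetricType d R)
    (mu : {measure set X -> \bar R}) (lam : X -> R -> R)
    (delta : R) (S : dyadic_system X delta Cd),
  is_Borel X -> geometrically_doubling X ->
  non_atomic mu -> finite_on_bounded mu -> upper_doubling mu lam ->
  0 < delta < 1 ->
  let A := dyadic_cubes S in
  (exists2 C : R, 0 < C &
   forall (f : X -> R[i]) (t : R),
   cLp mu 1%:E f -> (cLnorm mu 1%:E f / mu setT < t%:E)%E ->
   forall (J : set nat) (Q : nat -> set X),
   set_bij J (maximal_cubes A (level_set mu Cd A f t)) Q ->
   forall B : nat -> mball X, (forall j, J j -> fits Cd (B j) (Q j)) ->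
   forall Rc : nat -> set X,
   (* In the third condition below R_j is strictly larger than Q_j unless it is
      the whole space, which 3 Cd B_j `<=` R_j forces in a connected space. *)
   (forall j, J j -> [/\ doubling_cube mu Cd A alpha beta (Rc j),
                         dilate (3 * Cd) (B j) `<=` Rc j
                       & Rc j = Q j -> Rc j = setT]) ->
   exists phi : nat -> X -> R[i],
   [/\ (* size *)
       (forall j, J j -> cmeasurable (phi j) /\
          (cLnorm mu +oo (phi j) <=
             C%:E * ((mu (Rc j))^-1 * absintegral mu (Q j) f))%E) /\
       ({ae mu, forall x, csummable J (fun j => phi j x)} /\
        (cLnorm mu +oo (fun x => csum J (fun j => phi j x)) <= (C * t)%:E)%E),
       (* support and mean *)
       (forall j, J j ->
          [/\ forall x, ~ Rc j x -> phi j x = 0,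
              cintegrable mu setT (phi j),
              cintegral mu setT (phi j) = cintegral mu (Q j) (cutoff J Q f j),
              (absintegral mu (Q j) (cutoff J Q f j) <=
                 C%:E * absintegral mu (Q j) f)%E
            & (absintegral mu (Q j) f <=
                 C%:E * absintegral mu (Q j) (cutoff J Q f j))%E])
     & (* decomposition *)
       {ae mu, forall x,
          csummable J (fun j => cutoff J Q f j x - phi j x) /\
          f x = good_part J Q f phi x + bad_part J Q f phi x}]) /\
  (forall T : (X -> R[i]) -> (X -> R[i]),
     CZ_operator mu lam T -> bounded_on_L2 mu T -> maps_L1_to_weakL1 mu T)].
Proof.
(* doubling at the scale 2 * Cd of the balls of the maximal function suffices *)
exists (2 + 2 * Cd), 2; split; [by rewrite ltr_pwDr ?mulr_gt0 ?ler1n|by rewrite ltr1n|].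
move=> alpha beta hal hbe d X mu lam delta S hB hG _ hfin hlam _ A.
have hal' : 2 * Cd <= alpha by apply: le_trans hal; rewrite lerDr.
have hbe' : 1 <= beta by apply: le_trans hbe; rewrite ler1n.
split; last by move=> T; exact: CZ_weak_type.
set N := (dy_number S).+1.
have N1 : 1 <= N%:R :> R by rewrite ler1n.
have N0 : 0 <= N%:R :> R by rewrite ler0n.
have s0 : 0 <= 16 * N%:R ^+ 2 * beta.
  by rewrite !mulr_ge0 ?sqr_ge0// (le_trans ler01 hbe').
pose C := 4 + N%:R + 16 * N%:R ^+ 2 * beta.
have C4 : 4 <= C by rewrite /C; lra.
have CN : N%:R <= C by rewrite /C; lra.
have Cs : 16 * N%:R ^+ 2 * beta <= C by rewrite /C; lra.
exists C; first by lra.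
move=> f t fL1 ft J Q Qbij B BQ Rc RcP.
have t0 : 0 <= t.
  rewrite -lee_fin; apply: le_trans (ltW ft).
  by rewrite cLnorm1E mule_ge0 ?absintegral_ge0// inve_ge0.
have [phi [p1 [p2 p2'] p3 p4]] := cz_functions hB hfin hCd hal' hbe' fL1 ft Qbij BQ RcP.
exists phi; split=> //.
  split; last first.
    by split=> //; apply: (le_trans p2'); rewrite lee_fin ler_wpM2r.
  move=> j Jj; have [mphi hphi] := p1 j Jj; split=> //.
  apply: (le_trans hphi); rewrite lee_wpmul2r ?lee_fin//.
  by rewrite mule_ge0 ?absintegral_ge0// inve_ge0.
move=> j Jj; have [q1 q2 q3 q4 q5] := p3 j Jj; split=> //.
  apply: (le_trans q4); rewrite -[leLHS]mul1e; apply: lee_wpmul2r.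
    exact: absintegral_ge0.
  by rewrite lee_fin; lra.
by apply: (le_trans q5); apply: lee_wpmul2r; [exact: absintegral_ge0|rewrite lee_fin].
Qed.
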